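(* Let $M$ be a hypersurface satisfying the setting RSS2 described in the context, and let $M_t$ be the solution, defined on a maximal time interval $[0,T[$, of the volume-preserving mean curvature flow $\frac{\partial X_t}{\partial t}=(\overline H_t-H_t)N_t$ with initial condition $M$ and such that $M_t$ meets $\partial G$ orthogonally at its boundary for every $t$. Then the generating curve of $M_t$ remains a graph over the axis of revolution for every $t\in[0,T[$.
   Context: Ambient space. Let $J\subset\mathbb{R}$ be an interval and $B^n_R\subset\mathbb{R}^n$ the open Euclidean ball of radius $R\in\,]0,\infty]$. A rotationally symmetric space with respect to an axis is $\overline M=J\times B^n_R$ endowed with a $C^\infty$ Riemannian metric of the form $\overline g=dr^2+f^2(r)\,dz^2+h^2(r)\,g_S$ in the cylindrical coordinates $r=|x|$, $z$, $u=x/|x|$ of $(z,x)\in\overline M$, where $g_S$ is the standard metric of sectional curvature $1$ on $S^{n-1}$. The axis of rotation is $\{r=0\}$. Smoothness of $\overline g$ gives $f'(0)=0$, $h(0)=0$, $h'(0)=1$, and one normalizes $f(0)=1$; $'$ denotes the derivative with respect to $r$. Curvatures. $S_{zi}=-\frac{h'f'}{hf}$ is the sectional curvature of the plane spanned by $\partial_z$ and a unit vector $E_i$ tangent to the spheres $\{z=\text{const},\,r=\text{const}\}$; $S_{ri}=-\frac{h''}{h}$ is that of the plane spanned by $\partial_r$ and $E_i$. Setting RSS. For $a<b$ let $G=\{(r,z,u)\in\overline M: a\le z\le b\}$. $M$ is a smoothly embedded hypersurface of revolution around the axis of rotation, contained in $G$, generated by the graph of a function $r(z)>0$, $z\in[a,b]$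 (i.e. $M=\{(r(z),z,u)\}$), with boundary $\partial M\subset\partial G$, which intersects $\partial G$ orthogonally at the boundary and encloses an $(n+1)$-volume $V$ inside $G$. Setting RSS2. $M$ is in the setting RSS and either (a) $S_{zi}<0$ and $S_{ri}\le 0$ on $\overline M$, or (b) $\overline M$ is the Euclidean space ($R=\infty$, $J=\mathbb{R}$, $f\equiv1$, $h(r)=r$). Flow. $X_t:M\to\overline M$ is a smooth family of immersions with image $M_t$; $N_t$ is the outward unit normal, $H_t$ is the trace of the Weingarten map $Y\mapsto\overline\nabla_YN_t$ (positive for round spheres in $\mathbb{R}^{n+1}$), and $\overline H_t=\int_{M_t}H_t\,dv_{g_t}\big/\int_{M_t}dv_{g_t}$. The boundary condition includes $\partial M_t\subset\partial G$. Since the flow commutes with isometries, $M_t$ is invariant under $SO(n)$, hence a hypersurface of revolution with a generating curve in the $(r,z)$ half-plane; this curve is a graph over the axis when it is the graph of a smooth function $z\mapsto r_t(z)$, equivalently when $\langle N_t,\partial_r\rangle>0$ on $M_t$. *)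

(* Defs.v *)
From HB Require Import structures.
From mathcomp Require Import all_boot all_order all_algebra.
From mathcomp Require Import all_classical all_reals all_analysis.

Set Implicit Arguments.
Unset Strict Implicit.
Unset Printing Implicit Defensive.

Import Order.TTheory GRing.Theory Num.Theory.
Import numFieldNormedType.Exports.

Local Open Scope classical_set_scope.
Local Open Scope ring_scope.

Section Smooth.
Context {R : realType} {V W : normedModType R}.

Fixpoint iter_derive (vs : seq V) (F : V -> W) : V -> W :=
  if vs is v :: vs' then fun p => 'D_v (iter_derive vs' F) p else F.

(* C^oo on an open set U of a finite-dimensional space: all iterated
   directional derivatives exist and are continuous on U. *)
Definition smooth_on (U : set V) (F : V -> W) : Prop :=
  forall (vs : seq V) (p : V), U p ->
    {for p, continuous (iter_derive vs F)} /\
    forall v : V, derivable (iter_derive vs F) p v.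

(* Smoothness on a set that need not be open (a submanifold, possibly with
   boundary or corners): F is a smooth extension of its restriction to A.  The
   values of F off A are auxiliary; at points of A the derivatives of F in
   directions tangent to A depend only on the restriction of F to A. *)
Definition smooth_near (A : set V) (F : V -> W) : Prop :=
  exists U : set V, [/\ open U, A `<=` U & smooth_on U F].

End Smooth.

Section Euclid.
Context {R : realType} {n : nat}.

Definition dotp (x y : 'rV[R]_n) : R := \sum_(i < n) x 0 i * y 0 i.

(* The library norm on 'rV[R]_n is the sup norm; this is the Euclidean one. *)
Definition enorm (x : 'rV[R]_n) : R := Num.sqrt (dotp x x).

End Euclid.

(* The space R x R^n with Cartesian coordinates (z, x). *)
Notation cspace R n := (R * 'rV[R]_n)%type.

Section Ambient.
Context {R : realType} {n : nat}.
Local Notation V := (cspace R n).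

(* J x B^n_Rad, with Rad possibly +oo. *)
Definition ambient (J : set R) (Rad : \bar R) : set V :=
  [set p | J p.1 /\ ((enorm p.2)%:E < Rad)%E].

(* f^2(r) dz^2 + dr^2 + h^2(r) g_S, evaluated at p on the tangent vectors v, w,
   where dr(v) = <x, v_x> / r and du(v) = (v_x - dr(v) x / r) / r.  On the axis
   the value is the only one that can make the metric continuous there, given
   h(0) = 0 and the normalization f(0) = 1. *)
Definition rot_metric (f h : R -> R) (p v w : V) : R :=
  let x := p.2 in
  let r := enorm x in
  let dr (y : V) := dotp x y.2 / r in
  let du (y : V) := r^-1 *: (y.2 - (dr y / r) *: x) in
  if x == 0 then v.1 * w.1 + dotp v.2 w.2
  else f r ^+ 2 * (v.1 * w.1) + dr v * dr w
       + h r ^+ 2 * dotp (du v) (du w).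

(* The smoothness clause is smoothness of the metric in Cartesian coordinates,
   across the axis included; it entails f'(0) = 0 and h'(0) = 1. *)
Definition rot_sym_space (J : set R) (Rad : \bar R) (f h : R -> R) : Prop :=
  [/\ is_interval J,
      (0 < Rad)%E,
      f 0 = 1 /\ h 0 = 0,
      (forall r : R, 0 < r -> (r%:E < Rad)%E -> 0 < f r /\ 0 < h r) &
      forall v w : V,
        smooth_near (ambient J Rad) (fun p => rot_metric f h p v w)].

Definition e_z : V := (1, 0).

(* The radial unit field d/dr, defined off the axis. *)
Definition e_r (p : V) : V := (0, (enorm p.2)^-1 *: p.2).

End Ambient.

Section Curvatures.
Context {R : realType}.

Definition S_zi_off (f h : R -> R) (r : R) : R :=
  - (derive1 h r * derive1 f r) / (h r * f r).

Definition S_ri_off (h : R -> R) (r : R) : R := - derive1 (derive1 h) r / h r.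

(* On the axis the two quotients are 0/0; there the curvatures are the limits
   of their values off the axis. *)
Definition S_zi (f h : R -> R) (r : R) : R :=
  if r == 0 then lim (S_zi_off f h s @[s --> 0^'+]) else S_zi_off f h r.

Definition S_ri (h : R -> R) (r : R) : R :=
  if r == 0 then lim (S_ri_off h s @[s --> 0^'+]) else S_ri_off h r.

End Curvatures.

Section Integral.
Context {R : realType}.

(* Iterated Lebesgue integral over R^n. *)
Fixpoint iter_integral (n : nat) : ('rV[R]_n -> R) -> R :=
  match n return ('rV[R]_n -> R) -> R with
  | 0%N => fun phi => phi 0
  | m.+1 => fun phi =>
      \int[@lebesgue_measure R]_(t in setT)
        iter_integral (fun y : 'rV[R]_m =>
          phi (row_mx (t%:M : 'rV[R]_1) y : 'rV[R]_(1 + m)))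
  end.

(* Integral over the unit sphere for the standard measure sigma, through
   \int_(|x| < 1) phi (x / |x|) dx = (\int_0^1 r^(n-1) dr) \int phi dsigma. *)
Definition sphere_integral (n : nat) (phi : 'rV[R]_n -> R) : R :=
  n%:R * iter_integral (fun x : 'rV[R]_n =>
    if enorm x < 1 then phi ((enorm x)^-1 *: x) else 0).

End Integral.

Section Hypersurfaces.
Context {R : realType} {n : nat}.
Local Notation V := (cspace R n).

(* [a, b] x S^(n-1), the manifold parametrizing the hypersurfaces. *)
Definition cyl (a b : R) : set V :=
  [set q | a <= q.1 <= b /\ enorm q.2 = 1].

Definition cyl_boundary (a b : R) : set V :=
  [set q | (q.1 = a \/ q.1 = b) /\ enorm q.2 = 1].

Definition slab_boundary (a b : R) : set V := [set p | p.1 = a \/ p.1 = b].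

Definition cyl_tangent (q : V) : set V := [set v | dotp q.2 v.2 = 0].

(* Some basis of cyl_tangent q, orthonormal for the product of the Euclidean
   metric of R and the round metric of the sphere.  The area element and the
   mean curvature below do not depend on the choice. *)
Definition cyl_frame (q : V) : {ffun 'I_n -> V} :=
  xget [ffun=> 0] [set e : {ffun 'I_n -> V} |
    (forall i, cyl_tangent q (e i)) /\
    (forall i j, (e i).1 * (e j).1 + dotp (e i).2 (e j).2 = (i == j)%:R)].

Definition revolution (rho : R -> R) (q : V) : V := (q.1, rho q.1 *: q.2).

Variable g : V -> V -> V -> R.

(* Christoffel symbol of the first kind,
   g (Gamma (v, w), y) = g (nabla_v w, y) for constant fields v, w. *)
Definition christoffel (p v w y : V) : R :=
  2^-1 * ('D_v (fun q => g q w y) p + 'D_w (fun q => g q v y) p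
          - 'D_y (fun q => g q v w) p).

Definition immersion (a b : R) (Y : V -> V) : Prop :=
  forall q, cyl a b q ->
  forall v, cyl_tangent q v -> v != 0 -> 'D_v Y q != 0.

Definition normal_at (Y : V -> V) (q nu : V) : Prop :=
  forall v, cyl_tangent q v -> g (Y q) nu ('D_v Y q) = 0.

Definition unit_normal (a b : R) (Y N : V -> V) : Prop :=
  forall q, cyl a b q -> normal_at Y q (N q) /\ g (Y q) (N q) (N q) = 1.

Definition meets_orthogonally (a b : R) (Y : V -> V) : Prop :=
  forall q, cyl_boundary a b q ->
    slab_boundary a b (Y q) /\
    forall nu, normal_at Y q nu -> g (Y q) nu e_z = 0.

Definition gram (Y : V -> V) (q : V) : 'M[R]_n :=
  let e := cyl_frame q in
  \matrix_(i < n, j < n) g (Y q) ('D_(e i) Y q) ('D_(e j) Y q).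

(* Entries g (nabla_(e_i) N, dY e_j). *)
Definition second_form (Y N : V -> V) (q : V) : 'M[R]_n :=
  let e := cyl_frame q in
  \matrix_(i < n, j < n)
    (g (Y q) ('D_(e i) N q) ('D_(e j) Y q)
     + christoffel (Y q) ('D_(e i) Y q) (N q) ('D_(e j) Y q)).

(* second_form *m invmx gram is the matrix of the Weingarten map
   v |-> nabla_v N in the basis (dY e_i). *)
Definition mean_curvature (Y N : V -> V) (q : V) : R :=
  \tr (second_form Y N q *m invmx (gram Y q)).

Definition area_element (Y : V -> V) (q : V) : R := Num.sqrt (\det (gram Y q)).

Definition hyp_integral (a b : R) (Y : V -> V) (phi : V -> R) : R :=
  \int[@lebesgue_measure R]_(s in `[a, b]%classic)
    sphere_integral (fun u : 'rV[R]_n => phi (s, u) * area_element Y (s, u)).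

Definition average_mean_curvature (a b : R) (Y N : V -> V) : R :=
  hyp_integral a b Y (mean_curvature Y N) / hyp_integral a b Y (fun=> 1).

(* The hypersurface generated by the graph of rho over [a, b] lies in the
   ambient space M and meets the boundary of the slab orthogonally. *)
Definition setting_RSS (M : set V) (a b : R) (rho : R -> R) : Prop :=
  [/\ a < b,
      smooth_near `[a, b]%classic rho,
      (forall z, a <= z <= b -> 0 < rho z),
      (forall q, cyl a b q -> M (revolution rho q)) &
      meets_orthogonally a b (revolution rho)].

Definition time_domain (T : \bar R) : set R :=
  [set t | 0 <= t /\ (t%:E < T)%E].

(* X t is the immersion at time t and N t its unit normal; the latter is
   outward at time 0 and, by continuity, outward at all times. *)
Definition flow_with_normal (M : set V) (a b : R) (rho : R -> R)
    (T : \bar R) (X N : R -> V -> V) : Prop :=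
  let D := [set p : R * V | time_domain T p.1 /\ cyl a b p.2] in
  [/\ smooth_near D (fun p => X p.1 p.2) /\ smooth_near D (fun p => N p.1 p.2),
      (forall q, cyl a b q ->
         X 0 q = revolution rho q /\ 0 < g (X 0 q) (N 0 q) (e_r (X 0 q))),
      (forall t, time_domain T t ->
         [/\ forall q, cyl a b q -> M (X t q),
             immersion a b (X t),
             unit_normal a b (X t) (N t) &
             meets_orthogonally a b (X t)]) &
      forall t q, time_domain T t -> cyl a b q ->
        'D_1 (X ^~ q) t =
          (average_mean_curvature a b (X t) (N t)
           - mean_curvature (X t) (N t) q) *: N t q].

Definition vpmcf_solution (M : set V) (a b : R) (rho : R -> R)
    (T : \bar R) (X : R -> V -> V) : Prop :=
  (0 < T)%E /\ exists N : R -> V -> V, flow_with_normal M a b rho T X N.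

(* The solution on its maximal time interval: every solution with the same
   initial hypersurface is a restriction of X to a shorter interval. *)
Definition maximal_vpmcf_solution (M : set V) (a b : R) (rho : R -> R)
    (T : \bar R) (X : R -> V -> V) : Prop :=
  vpmcf_solution M a b rho T X /\
  forall (T' : \bar R) (X' : R -> V -> V), vpmcf_solution M a b rho T' X' ->
    (T' <= T)%E /\
    forall t q, time_domain T' t -> cyl a b q -> X' t q = X t q.

End Hypersurfaces.

Section SettingRSS2.
Context {R : realType}.

Definition euclidean_space (J : set R) (Rad : \bar R) (f h : R -> R) : Prop :=
  [/\ J = setT, Rad = +oo%E & forall r, 0 <= r -> f r = 1 /\ h r = r].

Definition setting_RSS2 (n : nat) (J : set R) (Rad : \bar R) (f h : R -> R)
    (a b : R) (rho : R -> R) : Prop :=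
  setting_RSS (n := n) (rot_metric f h) (ambient J Rad) a b rho /\
  ((forall r : R, 0 <= r -> (r%:E < Rad)%E -> S_zi f h r < 0 /\ S_ri h r <= 0)
   \/ euclidean_space J Rad f h).

(* The hypersurface parametrized by Y is generated by the graph of a smooth
   function over the axis. *)
Definition is_graph_over_axis (n : nat) (a b : R)
    (Y : cspace R n -> cspace R n) : Prop :=
  exists rho : R -> R,
    [/\ smooth_near `[a, b]%classic rho,
        (forall z, a <= z <= b -> 0 < rho z) &
        Y @` cyl a b = revolution rho @` cyl a b].

End SettingRSS2.

(* Main.v *)
(* The flow commutes with rotations: conjugating X by an orthogonal map gives a solution with
   the same initial hypersurface, so by maximality X t (s, u) = (z (t, s), y (t, s) u), and the
   normal is (nu (t, s), w (t, s) u).  One has z_s = k w and y_s = - k f^2 nu with k > 0, so the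
   generating curve is a graph as long as w > 0.
   The curvature assumptions give f', h' >= 0.  While w > 0 the averaged mean curvature is then
   nonnegative: the curvature of the generating curve is the derivative of its angle with the
   axis, which is integrated by parts against h^(n-1); the boundary terms vanish because the
   hypersurface meets the boundary of the slab orthogonally.
   At a minimum of w along a slice,
     w_t >= f^2 nu^2 w (q' - (f'/f) q),   q = f'/f + (n-1) h'/h,
   so w decays at most exponentially, and it stays positive because w = 1 on the boundary.
   Hence z (t, .) is an increasing diffeomorphism of [a, b], and M_t is generated by the graph
   of y (t, .) composed with its inverse. *)
Require Import Defs.
From HB Require Import structures.
From mathcomp Require Import all_boot all_order all_algebra.
From mathcomp Require Import all_classical all_reals all_analysis.
From mathcomp Require Import measurable_realfun ring lra.

Set Implicit Arguments.
Unset Strict Implicit.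
Unset Printing Implicit Defensive.

Import Order.TTheory GRing.Theory Num.Theory.
Import numFieldNormedType.Exports.

Local Open Scope classical_set_scope.
Local Open Scope ring_scope.

(** * Bounded linear maps and directional derivatives *)

(** Maximality identifies the rotated solutions with [X], but says nothing about the normal. That
    [N] has the same symmetry is recovered from [X]: [k] cannot vanish, is positive at time 0, and
    its square is determined by [z] and [y]. Rotating a solution also requires the averaged mean
    curvature to be rotation invariant, while the sphere integral is an iterated Lebesgue integral
    of a discontinuous integrand; invariance is obtained for products of flips and plane rotations,
    which already act transitively on the sphere. Smoothness is given through extensions whose
    values off the parameter domain carry no information. The geometric identities hold on the
    closed strip alone, and at its edges they are differentiated one-sidedly. The sign of the
    averaged mean curvature is available only while [w > 0], and it enters the minimum estimate
    multiplied by [f']. Hence the argument works at the first time when an exponentially rescaled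
    [w] reaches a fixed positive level: there [w] is still positive on the whole slice. *)

Section Calculus.
Context {R : realType}.

(** A predicate on plain functions, so that projections, pairings and their composites can be used
    as lambda terms. *)
Definition blin (V W : normedModType R) (c : V -> W) : Prop :=
  (forall k p q, c (k *: p + q) = k *: c p + c q) /\
  exists2 M : R, 0 < M & forall p, `|c p| <= M * `|p|.

Section Blin.
Context {V W : normedModType R} (c : V -> W).
Hypothesis hc : blin c.

Lemma blinD p q : c (p + q) = c p + c q.
Proof. by have [h _] := hc; rewrite -[p in LHS]scale1r h scale1r. Qed.
Lemma blin0 : c 0 = 0.
Proof. by have := blinD 0 0; rewrite addr0 => /eqP; rewrite -subr_eq subrr => /eqP. Qed.
Lemma blinZ k p : c (k *: p) = k *: c p.
Proof. by have [h _] := hc; rewrite -[k *: p]addr0 h blin0 addr0. Qed.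
Lemma blinB p q : c (p - q) = c p - c q.
Proof. by rewrite blinD -scaleN1r blinZ scaleN1r. Qed.
Lemma blin_continuous : continuous c.
Proof.
move=> p; apply/cvgrPdist_le => e e0.
have [_ [M M0 hM]] := hc.
near=> q; rewrite -blinB (le_trans (hM _))// mulrC -ler_pdivlMr//.
near: q; apply: cvgr_dist_le; rewrite ?divr_gt0//.
Unshelve. all: by end_near. Qed.

Lemma is_derive_blin (U : normedModType R) (F : U -> V) p v d :
  is_derive p v F d -> is_derive p v (c \o F) (c d).
Proof.
move=> [dF <-].
have : (fun h : R => h^-1 *: (((c \o F) \o shift p) (h *: v) - (c \o F) p)) @ 0^'
   --> c ('D_v F p).
  rewrite (_ : (fun h => _) = c \o
    (fun h : R => h^-1 *: ((F \o shift p) (h *: v) - F p))); last first.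
    by apply/funext => h /=; rewrite blinZ blinB.
  by apply: cvg_comp; [exact: dF | exact: blin_continuous].
move=> H; split; first by apply/cvg_ex; eexists; exact: H.
exact: cvg_lim H.
Qed.

End Blin.

(** The two difference quotients are the same function of [h]; only the line through [x] matters, so
    [phi] need not be linear. *)
Lemma is_derive_affine (U V W : normedModType R) (phi : U -> V) (F : V -> W)
    (x u : U) (v : V) d :
  (forall h : R, phi (h *: u + x) = h *: v + phi x) ->
  is_derive (phi x) v F d -> is_derive x u (F \o phi) d.
Proof.
move=> hphi [dF <-].
have E : (fun h : R => h^-1 *: (((F \o phi) \o shift x) (h *: u) - (F \o phi) x))
   = (fun h : R => h^-1 *: ((F \o shift (phi x)) (h *: v) - F (phi x))).
  by apply/funext => h /=; rewrite hphi.
split; first by rewrite /derivable E; exact: dF.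
by rewrite /derive E.
Qed.

Lemma is_derive_line (V W : normedModType R) (F : V -> W) (p v : V) (x : R) d :
  is_derive (p + x *: v) v F d -> is_derive x 1 (fun e : R => F (p + e *: v)) d.
Proof.
move=> hF; apply: (@is_derive_affine _ _ _ (fun e : R => p + e *: v)) hF => h.
by rewrite [_%:A]mulr1 scalerDl addrCA.
Qed.

(** Only the derivative along [v] is assumed, not differentiability, so linearity in the direction
    is proved on the line: restrict [F] to it and compose with [h |-> k * h], which also covers
    [k = 0]. *)
Lemma is_deriveZdir (V W : normedModType R) (F : V -> W) (p v : V) (k : R) d :
  is_derive p v F d -> is_derive p (k *: v) F (k *: d).
Proof.
move=> dF.
pose phi (h : R) := F (h *: v + p).
have dphi : is_derive (0 : R) 1 phi d.
  have := @is_derive_line _ _ F p v 0 d; rewrite scale0r addr0 => /(_ dF).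
  by congr (is_derive _ _ _ _); apply/funext => h; rewrite /phi addrC.
have [/derivable1_diffP df E] := dphi.
pose m (h : R) : R := k * h.
have m0 : m 0 = 0 by rewrite /m mulr0.
have dm : is_derive (0 : R) 1 m k.
  rewrite (_ : m = k \*: (id : R -> R^o)) //; apply: is_derive_eq; exact: mulr1.
have fm : differentiable m (0 : R) by apply/derivable1_diffP; case: dm.
have fp : differentiable phi (m 0) by rewrite m0.
have D : differentiable (phi \o m) (0 : R) by exact: differentiable_comp.
have -> : k *: d = 'D_1 (phi \o m) (0 : R).
  rewrite deriveE// diff_comp//= m0 -deriveE//.
  have -> : 'd m 0 1 = k by rewrite -deriveE// derive_val.
  have -> : 'D_k phi 0 = 'D_(k *: 1) phi 0 by congr ('D_ _ _ _); rewrite [RHS]mulr1.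
  by rewrite deriveE// linearZ/= -deriveE// E.
have E' : (fun h : R => F (h *: (k *: v) + p)) = phi \o m.
  by apply/funext => h; rewrite /phi/= scalerA mulrC.
split; first by apply/derivable1P; rewrite E'; exact/derivable1_diffP.
rewrite /derive; set g1 := fun h => h^-1 *: _; set g2 := fun h => h^-1 *: _.
suff -> : g1 = g2 by [].
by apply/funext => h; rewrite /g1 /g2/= [_%:A]mulr1 addr0 m0 /phi scale0r add0r
  scalerA mulrC.
Qed.

Lemma is_derive_segment_continuous (f df : R -> R) (a b : R) :
  (forall x : R, a <= x <= b -> is_derive x 1 f (df x)) ->
  {within `[a, b], continuous f}.
Proof.
move=> h; apply: derivable_within_continuous => x; rewrite in_itv/= => xab.
by have [] := h x xab.
Qed.

Lemma MVT01 (f df : R -> R) :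
  (forall x : R, 0 <= x <= 1 -> is_derive x 1 f (df x)) ->
  exists2 c, 0 <= c <= 1 & f 1 - f 0 = df c.
Proof.
move=> h.
have [||c c01 E] := @MVT_segment R f df 0 1 ler01.
- by move=> x; rewrite in_itv/= => /andP[x0 x1]; apply: h; rewrite !ltW.
- exact: is_derive_segment_continuous h.
- by exists c; [move: c01; rewrite in_itv|rewrite E subr0 mulr1].
Qed.

(** Finite dimension, in the form of finitely many vectors with bounded coordinate functionals; this
    form is stable under products. *)
Definition coordinates (V : normedModType R) (s : seq (V * (V -> R))) : Prop :=
  (forall x, List.In x s -> blin x.2) /\
  forall p, p = \sum_(x <- s) x.2 p *: x.1.

(** One step of the path along the coordinate directions: [P h] is the part of the increment already
    made, and the mean value theorem along [b] evaluates ['D_b F] at a point close to [p]. *)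
Lemma C1_step (V : normedModType R) (U : set V) (F : V -> R) (p b : V)
    (c : V -> R) (P : V -> V) :
  open U -> U p -> (forall q v, U q -> derivable F q v) ->
  {for p, continuous ('D_b F)} -> blin c -> blin P ->
  forall e : R, 0 < e ->
  \forall h \near (0 : V),
    `|F (p + P h + c h *: b) - F (p + P h) - c h * 'D_b F p| <= e * `|h|.
Proof.
move=> oU Up dF cF bc bP e e0.
have [_ [M M0 hM]] := bc.
have eM : 0 < e / M by rewrite divr_gt0.
have nD : \forall q \near p, `|'D_b F p - 'D_b F q| <= e / M.
  by move/cvgrPdist_le : cF; apply.
have : \forall q \near p, U q /\ `|'D_b F p - 'D_b F q| <= e / M.
  near=> q; split; first by near: q; exact: open_nbhs_nbhs.
  by near: q.
case/nbhs_normP => d /= d0 hd.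
near=> h.
have hs : `|P h| + `|c h *: b| < d.
  near: h.
  have : (fun h => `|P h| + `|c h *: b|) @ (0 : V) --> `|P 0| + `|c 0 *: b|.
    apply: cvgD; apply: cvg_norm; first exact: blin_continuous.
    by apply: cvgZr_tmp; exact: blin_continuous.
  rewrite (blin0 bP) (blin0 bc) scale0r !normr0 addr0 => /cvgrPdist_lt/(_ _ d0).
  apply: filterS => h; rewrite sub0r normrN ger0_norm// addr_ge0//.
have inU (x : R) : 0 <= x <= 1 -> ball_ Num.norm p d (p + P h + x *: (c h *: b)).
  move=> /andP[x0 x1]; rewrite /ball_/= -addrA opprD addrA subrr sub0r normrN.
  rewrite (le_lt_trans (ler_normD _ _))// (le_lt_trans _ hs)// lerD2l.
  by rewrite normrZ ger0_norm// ler_piMl.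
have [x|x x01] := @MVT01 (fun x : R => F (p + P h + x *: (c h *: b)))
    (fun x => c h *: 'D_b F (p + P h + x *: (c h *: b))).
  move=> x01; apply: is_derive_line; apply: is_deriveZdir.
  by apply: derivableP; apply: dF; have [] := hd _ (inU x x01).
rewrite scale1r scale0r addr0 => ->.
rewrite -mulrBr normrM mulrC.
have [_] := hd _ (inU x x01); rewrite distrC => hD.
apply: (le_trans (ler_pM _ _ hD (hM h))) => //.
by rewrite mulrA divfK// gt_eqF.
Unshelve. all: by end_near. Qed.

(** Telescoping of [C1_step] over the coordinates; boundedness of the partial increment is carried
    along because the next step needs it. *)
Lemma C1_increment (V : normedModType R) (U : set V) (F : V -> R) (p : V)
    (s : seq (V * (V -> R))) :
  open U -> U p -> (forall q v, U q -> derivable F q v) ->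
  (forall v, {for p, continuous ('D_v F)}) ->
  (forall x, List.In x s -> blin x.2) ->
  blin (fun h => \sum_(x <- s) x.2 h *: x.1) /\
  forall e : R, 0 < e ->
  \forall h \near (0 : V),
    `|F (p + \sum_(x <- s) x.2 h *: x.1) - F p - \sum_(x <- s) x.2 h * 'D_(x.1) F p|
      <= e * `|h|.
Proof.
move=> oU Up dF cF; elim: s => [|[b c] s IH] hs.
  split.
    split=> [k q q'|]; first by rewrite !big_nil scaler0 addr0.
    by exists 1 => // q; rewrite big_nil normr0 mul1r.
  by move=> e e0; near=> h; rewrite !big_nil addr0 !subrr normr0 mulr_ge0// ltW.
have bc : blin c by have := hs (b, c) (or_introl erefl).
have [bP IH2] := IH (fun x xs => hs x (or_intror xs)).
split.
  split=> [k q q'|].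
    have [hP _] := bP; rewrite !big_cons /= hP (proj1 bc) scalerDl scalerDr scalerA.
    by rewrite addrACA.
  have [_ [M M0 hM]] := bP; have [_ [N N0 hN]] := bc.
  exists (N * (`|b| + 1) + M); first by rewrite addr_gt0// mulr_gt0// ltr_wpDl.
  move=> q; rewrite big_cons/= mulrDl (le_trans (ler_normD _ _))// lerD//.
  rewrite normrZ mulrAC ler_pM//.
  by rewrite lerDl.
move=> e e0.
have e2 : 0 < e / 2 by rewrite divr_gt0.
have S1 := C1_step oU Up dF (cF b) bc bP e2.
have S2 := IH2 _ e2.
near=> h.
have H1 : `|F (p + (\sum_(x <- s) x.2 h *: x.1) + c h *: b)
   - F (p + \sum_(x <- s) x.2 h *: x.1) - c h * 'D_b F p| <= e / 2 * `|h|.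
  by near: h.
have H2 : `|F (p + \sum_(x <- s) x.2 h *: x.1) - F p
   - \sum_(x <- s) x.2 h * 'D_(x.1) F p| <= e / 2 * `|h|.
  by near: h.
rewrite !big_cons/= [c h *: b + _]addrC addrA [e]splitr mulrDl.
apply: le_trans (lerD H1 H2); apply: le_trans (ler_normD _ _).
by rewrite le_eqVlt; apply/orP; left; apply/eqP; congr (`| _ |); ring.
Unshelve. all: by end_near. Qed.

(** [smooth_on] speaks of directional derivatives only. Continuity of the partial derivatives
    upgrades them to a Frechet derivative, which gives the chain rule and linearity in the
    direction. *)
Lemma C1_differentiable (V : normedModType R) (s : seq (V * (V -> R)))
    (U : set V) (F : V -> R) (p : V) : coordinates s ->
  open U -> U p -> (forall q v, U q -> derivable F q v) ->
  (forall v, {for p, continuous ('D_v F)}) -> differentiable F p.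
Proof.
move=> [bs hs] oU Up dF cF.
have [_ inc] := C1_increment oU Up dF cF bs.
pose df h := \sum_(x <- s) x.2 h * 'D_(x.1) F p.
have ldf : linear df.
  move=> k q q'; rewrite /df -[k *: (\sum_(x <- s) _)]/(k * _) mulr_sumr -big_split/=.
  have : (forall x, List.In x s -> blin x.2) by [].
  elim: (s) => [|x r IH] hr; rewrite ?big_nil// !big_cons IH; last first.
    by move=> y yr; apply: hr; right.
  congr (_ + _); have [-> _] := hr x (or_introl erefl).
  by rewrite mulrDl -mulrA.
pose L : {linear V -> R} := HB.pack_for {linear V -> R} df
  (GRing.isLinear.Build R V R *:%R df ldf).
have cL : continuous L.
  move=> q; rewrite /L/=/df.
  have : (forall x, List.In x s -> blin x.2) by [].
  elim: (s) => [|x r IH] hr.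
    rewrite (_ : (fun h => _) = cst 0); first exact: cst_continuous.
    by apply/funext => h; rewrite big_nil.
  rewrite (_ : (fun h => _) = (fun h => x.2 h * 'D_(x.1) F p +
    \sum_(x <- r) x.2 h * 'D_(x.1) F p)); last first.
    by apply/funext => h; rewrite big_cons.
  apply: (@continuousD _ _ _ (fun h => x.2 h * 'D_(x.1) F p)).
    apply: cvgMr_tmp; exact: (blin_continuous (hr x (or_introl erefl))).
  by apply: IH => y yr; apply: hr; right.
have E : F \o shift p = cst (F p) + L +o_ (0 : V) id.
  apply/eqaddoP => e e0; near=> h.
  have -> : (F \o shift p - (cst (F p) + L)) h = F (p + h) - F p - df h.
    by rewrite !fctE /= opprD addrA [h + p]addrC.
  have {1}-> : h = \sum_(x <- s) x.2 h *: x.1 by exact: hs.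
  by near: h; exact: inc.
by apply/diff_locallyP; rewrite (diff_unique cL E).
Unshelve. all: by end_near. Qed.

End Calculus.

(** * Functions smooth on an open set *)

Section Smooth.
Context {R : realType}.

Lemma blin_id (V : normedModType R) : blin (id : V -> V).
Proof. by split=> //; exists 1 => // p; rewrite mul1r. Qed.

Lemma blin_comp (U V W : normedModType R) (c : V -> W) (d : U -> V) :
  blin c -> blin d -> blin (c \o d).
Proof.
move=> [c1 [M M0 c2]] [d1 [N N0 d2]]; split=> [k p q|]/=; first by rewrite d1 c1.
exists (M * N); first exact: mulr_gt0.
by move=> p; rewrite (le_trans (c2 _))// -mulrA ler_pM2l.
Qed.

Lemma blin_fst (V W : normedModType R) : blin (fst : V * W -> V).
Proof. by split=> //; exists 1 => // p; rewrite mul1r/= [leRHS]prod_normE le_max lexx. Qed.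

Lemma blin_snd (V W : normedModType R) : blin (snd : V * W -> W).
Proof.
by split=> //; exists 1 => // p; rewrite mul1r/= [leRHS]prod_normE le_max lexx orbT.
Qed.

Lemma blin_pair (U V W : normedModType R) (c : U -> V) (d : U -> W) :
  blin c -> blin d -> blin (fun p => (c p, d p)).
Proof.
move=> [c1 [M M0 c2]] [d1 [N N0 d2]]; split=> [k p q|]; first by rewrite c1 d1.
exists (M + N); first exact: addr_gt0.
move=> p; rewrite prod_normE/= ge_max; apply/andP; split.
  by rewrite (le_trans (c2 _))// ler_wpM2r// lerDl ltW.
by rewrite (le_trans (d2 _))// ler_wpM2r// lerDr ltW.
Qed.

Lemma blin_zero (V W : normedModType R) : blin (fun _ : V => 0 : W).
Proof.
split=> [k p q|]; first by rewrite scaler0 addr0.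
by exists 1 => // p; rewrite normr0 mul1r.
Qed.

Lemma blin_coord n (i : 'I_n) : blin (fun p : 'rV[R]_n => p 0 i).
Proof.
split=> [k p q|]; first by rewrite !mxE.
exists 1 => // p; rewrite mul1r [leRHS]mx_normrE.
exact: (le_bigmax _ (fun ij : 'I_1 * 'I_n => `|p ij.1 ij.2|) (0, i)).
Qed.

Lemma blin_scale (V : normedModType R) (v : V) : blin (fun k : R => k *: v).
Proof.
split=> [k p q|]; first by rewrite scalerDl scalerA.
exists (`|v| + 1) => [|p]; first by rewrite ltr_wpDl.
by rewrite normrZ mulrC ler_wpM2r// lerDl.
Qed.

Lemma coordinates_R : coordinates [:: (1 : R, id : R -> R)].
Proof.
split=> [x [<-|//]|p]; first exact: blin_id.
by rewrite big_seq1/= [RHS]mulr1.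
Qed.

Lemma coordinates_rV n : coordinates
  [seq (delta_mx 0 i : 'rV[R]_n, fun p : 'rV[R]_n => p 0 i) | i <- enum 'I_n].
Proof.
split=> [x|p].
  elim: (enum _) => [//|i s IH] [<-|/IH//]; exact: blin_coord.
by rewrite big_map big_enum/= [LHS]row_sum_delta.
Qed.

Lemma coordinates_prod (V W : normedModType R) (s : seq (V * (V -> R)))
    (t : seq (W * (W -> R))) : coordinates s -> coordinates t ->
  coordinates ([seq ((x.1, 0) : V * W, x.2 \o fst) | x <- s] ++
               [seq ((0, x.1) : V * W, x.2 \o snd) | x <- t]).
Proof.
move=> [s1 s2] [t1 t2]; split=> [x|[p q]].
  rewrite List.in_app_iff !List.in_map_iff => -[[y [<- ys]]|[y [<- yt]]] /=.
    exact: (blin_comp (s1 _ ys) (@blin_fst _ _)).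
  exact: (blin_comp (t1 _ yt) (@blin_snd _ _)).
rewrite big_cat !big_map/= {1}(s2 p) {1}(t2 q).
rewrite (_ : \sum_(j <- s) _ = (\sum_(j <- s) j.2 p *: j.1, 0)); last first.
  elim: (s) => [|y r IH]; first by rewrite !big_nil.
  by rewrite !big_cons IH; congr pair; rewrite /= scaler0 addr0.
rewrite (_ : \sum_(j <- t) _ = (0, \sum_(j <- t) j.2 q *: j.1)); last first.
  elim: (t) => [|y r IH]; first by rewrite !big_nil.
  by rewrite !big_cons IH; congr pair; rewrite /= scaler0 addr0.
by congr pair; rewrite /= ?addr0 ?add0r.
Qed.

Lemma open_near_eq (V W : normedModType R) (U : set V) (f g : V -> W) p :
  open U -> U p -> (forall q, U q -> f q = g q) -> \near p, f p = g p.
Proof. by move=> oU Up h; near=> q; apply: h; near: q; exact: open_nbhs_nbhs.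
Unshelve. all: by end_near. Qed.

Lemma continuous_open_eq (V W : normedModType R) (U : set V) (f g : V -> W) p :
  open U -> U p -> (forall q, U q -> f q = g q) -> {for p, continuous f} ->
  {for p, continuous g}.
Proof.
move=> oU Up h; rewrite /prop_for /continuous_at (h p Up); apply: cvg_trans.
by apply: near_eq_cvg; apply: (open_near_eq oU Up) => q Uq; rewrite h.
Qed.

Lemma iter_derive_rcons (V W : normedModType R) vs v (F : V -> W) :
  iter_derive (rcons vs v) F = iter_derive vs ('D_v F).
Proof. by elim: vs => //= w vs ->. Qed.

Lemma smooth_on_derive (V W : normedModType R) (U : set V) (F : V -> W) v :
  smooth_on U F -> smooth_on U ('D_v F).
Proof. by move=> h vs p Up; rewrite -iter_derive_rcons; exact: h. Qed.

Lemma smooth_onW (V W : normedModType R) (U U' : set V) (F : V -> W) :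
  U' `<=` U -> smooth_on U F -> smooth_on U' F.
Proof. by move=> s h vs p /s; exact: h. Qed.

Section Facts.
Context {V W : normedModType R} (U : set V) (F : V -> W).
Hypothesis sF : smooth_on U F.

Lemma smooth_on_continuous p : U p -> {for p, continuous F}.
Proof. by move=> /(sF [::])[]. Qed.

Lemma smooth_on_derivable p v : U p -> derivable F p v.
Proof. by move=> /(sF [::])[_]; apply. Qed.

Lemma smooth_on_is_derive p v : U p -> is_derive p v F ('D_v F p).
Proof. by move=> Up; apply/derivableP/smooth_on_derivable. Qed.

End Facts.

Lemma smooth_on_blin (U V W : normedModType R) (A : set U) (F : U -> V)
    (c : V -> W) : open A -> blin c -> smooth_on A F -> smooth_on A (c \o F).
Proof.
move=> oA bc sF.
have E vs : forall p, A p -> iter_derive vs (c \o F) p = c (iter_derive vs F p).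
  elim: vs => //= v vs IH p Ap.
  rewrite (@near_eq_derive _ _ _ _ (c \o iter_derive vs F)); last first.
    exact: open_near_eq IH.
  have [_] := is_derive_blin bc (derivableP (proj2 (sF vs p Ap) v)).
  by [].
move=> vs p Ap; split; last first.
  move=> v; apply: (@near_eq_derivable _ _ _ (c \o iter_derive vs F)).
    by apply: (open_near_eq oA Ap) => q Aq; rewrite E.
  by have [] := is_derive_blin bc (derivableP (proj2 (sF vs p Ap) v)).
have [cf _] := sF vs p Ap.
apply: (@continuous_open_eq _ _ A (c \o iter_derive vs F)) => //.
  by move=> q Aq; rewrite E.
by apply: continuous_comp; [exact: cf|exact: blin_continuous].
Qed.

(** Deriving the composite along [vs] is deriving [F] along the images of [vs] under the linear part
    [L]. This restricts the flow to time slices, to the curve over the pole and to rays. *)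
Lemma smooth_on_affine (U V W : normedModType R) (A : set V) (F : V -> W)
    (phi L : U -> V) : open A -> blin L -> (forall p q, phi (p + q) = L p + phi q) ->
  smooth_on A F ->
  (forall vs p, A (phi p) -> iter_derive vs (F \o phi) p = iter_derive (map L vs) F (phi p))
  /\ smooth_on (phi @^-1` A) (F \o phi).
Proof.
move=> oA bL hphi sF.
have cphi : continuous phi.
  move=> p; have -> : phi = (fun q => L q + phi 0).
    by apply/funext => q; rewrite -hphi addr0.
  by apply: continuousD; [exact: blin_continuous|exact: cst_continuous].
have oB : open (phi @^-1` A) by apply: open_comp.
have D G p v : A (phi p) -> derivable G (phi p) (L v) ->
    is_derive p v (G \o phi) ('D_(L v) G (phi p)).
  move=> Ap dG; apply: (is_derive_affine _ (derivableP dG)) => h.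
  by rewrite hphi (blinZ bL).
have E vs : forall p, A (phi p) -> iter_derive vs (F \o phi) p = iter_derive (map L vs) F (phi p).
  elim: vs => //= v vs IH p Ap.
  rewrite (@near_eq_derive _ _ _ _ (iter_derive (map L vs) F \o phi)); last first.
    exact: (open_near_eq oB).
  by have [_] := D _ _ p v Ap (proj2 (sF (map L vs) _ Ap) (L v)).
split=> // vs p Ap; split; last first.
  move=> v; apply: (@near_eq_derivable _ _ _ (iter_derive (map L vs) F \o phi)).
    by apply: (open_near_eq oB Ap) => q Aq; rewrite E.
  by have [] := D _ _ p v Ap (proj2 (sF (map L vs) _ Ap) (L v)).
have [cf _] := sF (map L vs) _ Ap.
apply: (@continuous_open_eq _ _ _ (iter_derive (map L vs) F \o phi) _ _ oB) => //.
  by move=> q Aq; rewrite E.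
by apply: continuous_comp; [exact: cphi|exact: cf].
Qed.

Lemma smooth_on_differentiable (V W : normedModType R) sV sW (U : set V)
    (F : V -> W) p : coordinates (V := V) sV -> coordinates (V := W) sW ->
  open U -> smooth_on U F -> U p -> differentiable F p.
Proof.
move=> cV [bW hW] oU sF Up.
have -> : F = fun q => \sum_(x <- sW) x.2 (F q) *: x.1.
  by apply/funext => q; exact: hW.
elim: (sW) bW => [|x s IH] bW.
  rewrite (_ : (fun q => _) = cst 0); first exact: differentiable_cst.
  by apply/funext => q; rewrite big_nil.
rewrite (_ : (fun q => _) = (fun q => x.2 (F q) *: x.1) +
  (fun q => \sum_(x <- s) x.2 (F q) *: x.1)); last first.
  by apply/funext => q; rewrite big_cons.
apply: differentiableD; last by apply: IH => y ys; apply: bW; right.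
apply: (@differentiableZl _ _ _ (fun q => x.2 (F q))).
have sx : smooth_on U (x.2 \o F).
  by apply: smooth_on_blin => //; apply: bW; left.
apply: (@C1_differentiable _ _ sV U) => //.
- by move=> q v Uq; exact: smooth_on_derivable sx _ _ Uq.
- by move=> v; exact: smooth_on_continuous (smooth_on_derive v sx) _ Up.
Qed.

End Smooth.

(** * Symmetry of second derivatives and one-variable calculus *)

Section SecondDerivatives.
Context {R : realType}.

(** The mean value theorem applied twice: along [v] to a difference in direction [w], then along [w]
    to ['D_v F]. *)
Lemma second_difference (V : normedModType R) (U : set V) (F : V -> R) (p v w : V)
    (d h : R) : smooth_on U F -> ball_ Num.norm p d `<=` U ->
  `|h| * (`|v| + `|w|) < d ->
  exists2 q, ball_ Num.norm p d q &
    F (p + h *: v + h *: w) - F (p + h *: v) - F (p + h *: w) + F p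
      = h ^+ 2 * 'D_w ('D_v F) q.
Proof.
move=> sF dU hd.
have inB (x y : R) : 0 <= x <= 1 -> 0 <= y <= 1 ->
    ball_ Num.norm p d (p + y *: (h *: w) + x *: (h *: v)).
  move=> /andP[x0 x1] /andP[y0 y1].
  rewrite /ball_/= -addrA opprD addrA subrr sub0r normrN (le_lt_trans _ hd)//.
  rewrite (le_trans (ler_normD _ _))// !normrZ (ger0_norm x0) (ger0_norm y0).
  by rewrite mulrDr addrC lerD// ler_piMl// mulr_ge0.
pose f (x : R) := F (p + h *: w + x *: (h *: v)) - F (p + x *: (h *: v)).
have df (x : R) : 0 <= x <= 1 -> is_derive x 1 f
    (h *: 'D_v F (p + h *: w + x *: (h *: v)) - h *: 'D_v F (p + x *: (h *: v))).
  move=> x01; apply: is_deriveB; apply: is_derive_line; apply: is_deriveZdir;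
    apply: (smooth_on_is_derive sF); apply: dU.
    by have := inB x 1 x01; rewrite scale1r; apply; rewrite ler01 lexx.
  by have := inB x 0 x01; rewrite scale0r addr0; apply; rewrite ler01 lexx.
have [x x01] := MVT01 df.
rewrite /f !scale1r !scale0r !addr0 => E1.
have sDF := smooth_on_derive v sF.
have dg (y : R) : 0 <= y <= 1 -> is_derive y 1
    (fun y : R => 'D_v F (p + x *: (h *: v) + y *: (h *: w)))
    (h *: 'D_w ('D_v F) (p + x *: (h *: v) + y *: (h *: w))).
  move=> y01; apply: (@is_derive_line _ _ _ ('D_v F)); apply: is_deriveZdir.
  by apply: (smooth_on_is_derive sDF); apply: dU; rewrite addrAC; exact: inB.
have [y y01] := MVT01 dg.
rewrite !scale1r scale0r addr0 => E2.
exists (p + x *: (h *: v) + y *: (h *: w)); first by rewrite addrAC; exact: inB.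
move: E1; rewrite -scalerBr [p + h *: w + x *: _]addrAC E2.
rewrite -[h *: (h *: _)]/(h * (h * _)) mulrA -expr2 => <-.
by rewrite [p + h *: v + _]addrAC; ring.
Qed.

(** The second difference is symmetric in [v] and [w], so the two mixed derivatives take a common
    value at points arbitrarily close to [p]; continuity concludes. *)
Lemma schwarz (V : normedModType R) (U : set V) (F : V -> R) (p v w : V) :
  open U -> smooth_on U F -> U p -> 'D_v ('D_w F) p = 'D_w ('D_v F) p.
Proof.
move=> oU sF Up.
set A := 'D_v _ p; set B := 'D_w _ p.
apply/eqP; rewrite -subr_eq0 -normr_le0; apply/ler_addgt0Pl => e e0.
have e2 : 0 < e / 2 by rewrite divr_gt0.
have cA := smooth_on_continuous (smooth_on_derive v (smooth_on_derive w sF)) Up.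
have cB := smooth_on_continuous (smooth_on_derive w (smooth_on_derive v sF)) Up.
have nU : \forall q \near p, U q by exact: open_nbhs_nbhs.
have nA : \forall q \near p, `|A - 'D_v ('D_w F) q| <= e / 2.
  by move/cvgrPdist_le : cA; apply.
have nB : \forall q \near p, `|B - 'D_w ('D_v F) q| <= e / 2.
  by move/cvgrPdist_le : cB; apply.
have : \forall q \near p, [/\ U q, `|A - 'D_v ('D_w F) q| <= e / 2 &
    `|B - 'D_w ('D_v F) q| <= e / 2].
  by apply: filterS3 nU nA nB => q Uq qA qB; split.
case/nbhs_normP => d /= d0 hd.
(* The increments then stay in the ball of radius [d]; the [+ 1] covers [v = w = 0]. *)
pose h := d / 2 / (`|v| + `|w| + 1).
have vw : 0 < `|v| + `|w| + 1 by rewrite ltr_wpDl// addr_ge0.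
have h0 : 0 < h by rewrite /h !divr_gt0.
have hh : `|h| * (`|v| + `|w|) < d.
  rewrite gtr0_norm// /h mulrAC ltr_pdivrMr//.
  have : 0 <= `|v| + `|w| by rewrite addr_ge0.
  move: (`|v| + `|w|) => k k0; nra.
have hh' : `|h| * (`|w| + `|v|) < d by rewrite [_ + `|v|]addrC.
have dU : ball_ Num.norm p d `<=` U by move=> q /hd[].
have [q /hd[_ _ qB] E1] := second_difference sF dU hh.
have [r /hd[_ rA _] E2] := second_difference sF dU hh'.
have E : 'D_w ('D_v F) q = 'D_v ('D_w F) r.
  apply: (@mulfI _ (h ^+ 2)); first by rewrite expf_neq0// gt_eqF.
  apply: (etrans (esym E1) (etrans _ E2)); rewrite [p + h *: w + _]addrAC.
  exact: (congr1 (fun x => x + F p) (addrAC _ _ _)).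
move: rA qB; rewrite E addr0; move: ('D_v ('D_w F) r) => x.
clear; clearbody A B => rA qB.
rewrite (le_trans (ler_distD x A B))// [leRHS]splitr.
by apply: lerD; [exact: rA|rewrite distrC; exact: qB].
Qed.

Lemma is_derive_curve (V W : normedModType R) (g : R -> V) (F : V -> W) (x : R) v :
  is_derive x 1 g v -> differentiable F (g x) ->
  is_derive x 1 (F \o g) ('D_v F (g x)).
Proof.
move=> [/derivable1_diffP dg <-] dF.
have dFg : differentiable (F \o g) x by exact: differentiable_comp.
split; first exact/derivable1_diffP.
by rewrite [LHS]deriveE// diff_comp//= -deriveE// -deriveE.
Qed.

Lemma derive_dirD (V W : normedModType R) (F : V -> W) p v w :
  differentiable F p -> 'D_(v + w) F p = 'D_v F p + 'D_w F p.
Proof. by move=> dF; rewrite !deriveE// linearD. Qed.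

Lemma derive_dirZ (V W : normedModType R) (F : V -> W) p (k : R) v :
  differentiable F p -> 'D_(k *: v) F p = k *: 'D_v F p.
Proof. by move=> dF; rewrite !deriveE// linearZ. Qed.

Lemma derive_dir_sum (V W : normedModType R) (F : V -> W) p n (k : 'I_n -> R)
    (v : 'I_n -> V) : differentiable F p ->
  'D_(\sum_i k i *: v i) F p = \sum_i k i *: 'D_(v i) F p.
Proof.
move=> dF; rewrite deriveE// linear_sum; apply: eq_bigr => i _.
by rewrite linearZ/= -deriveE.
Qed.

(** The two-sided derivative exists, but [f] is known on the segment only. The limit may be taken
    from the right if [s < b] and from the left at [b], where the quotients vanish. This is how
    identities on the closed strip are differentiated up to its edges. *)
Lemma is_derive_segment_cst (W : normedModType R) (f : R -> W) (a b s : R) d :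
  a < b -> a <= s <= b -> is_derive s 1 f d ->
  (forall x, a <= x <= b -> f x = 0) -> d = 0.
Proof.
move=> ab /andP[sa sb] [df <-] f0.
have fs : f s = 0 by apply: f0; rewrite sa.
have [sb'|bs] := ltP s b.
  rewrite /derive cvg_at_rightE; last exact: df.
  apply: cvg_lim => //; apply: cvg_near_cst; near=> h.
  rewrite /= fs subr0 f0 ?scaler0// [_%:A]mulr1; apply/andP; split.
    by rewrite (le_trans sa)// lerDr.
  by rewrite -lerBrDr; near: h; apply: nbhs_right_le; rewrite subr_gt0.
have {}bs : s = b by apply/eqP; rewrite eq_le sb.
rewrite /derive cvg_at_leftE; last exact: df.
apply: cvg_lim => //; apply: cvg_near_cst; near=> h.
rewrite /= fs subr0 f0 ?scaler0// [_%:A]mulr1; apply/andP; split; last first.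
  by rewrite (le_trans _ sb)// gerDr.
by rewrite -lerBlDr; near: h; apply: nbhs_left_ge; rewrite subr_lt0 bs.
Unshelve. all: by end_near. Qed.

Lemma is_derive_segment_eq (W : normedModType R) (f g : R -> W) (a b s : R) d e :
  a < b -> a <= s <= b -> is_derive s 1 f d -> is_derive s 1 g e ->
  (forall x, a <= x <= b -> f x = g x) -> d = e.
Proof.
move=> ab sab df dg fg; apply/eqP; rewrite -subr_eq0; apply/eqP.
apply: (@is_derive_segment_cst _ (f - g) a b s) => //.
by move=> x xab; rewrite !fctE fg// subrr.
Qed.

Lemma segment_positive (f : R -> R) (a b : R) : a <= b ->
  {within `[a, b], continuous f} -> (forall x, a <= x <= b -> f x != 0) ->
  0 < f a -> 0 < f b.
Proof.
move=> ab cf f0 fa; rewrite ltNge; apply/negP => fb.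
have H : Num.min (f a) (f b) <= 0 <= Num.max (f a) (f b).
  by rewrite ge_min le_max fb (ltW fa) orbT.
have [c] := IVT ab cf H.
by rewrite in_itv/= => /f0/eqP.
Qed.

(** If [d < 0], then [df] is negative just to the right of [c], and [f] would drop below its
    minimum. *)
Lemma second_derivative_min (f df : R -> R) (a b c : R) d : a < c < b ->
  (forall x, a < x < b -> is_derive x 1 f (df x)) ->
  is_derive c 1 df d ->
  (forall x, a < x < b -> f c <= f x) -> df c = 0 /\ 0 <= d.
Proof.
move=> /andP[ac cb] hf hd fmin.
have cab : c \in `]a, b[ by rewrite in_itv/= ac.
have [_ E] : is_derive c 1 f 0.
  apply: (@derive1_at_min R f a b c) => //.
  - by rewrite (le_trans (ltW ac))// ltW.
  - by move=> x; rewrite in_itv/= => /hf[].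
have dfc : df c = 0 by have [|_ <-] := hf c _; rewrite ?ac.
split=> //; rewrite leNgt; apply/negP => d0.
have [ddf E2] := hd.
move/cvgr_lt : ddf; rewrite -/('D_1 df c) E2 => /(_ _ d0).
rewrite near_withinE => /nbhs_normP[e /= e0 he].
pose x := c + Num.min e (b - c) / 2.
have m0 : 0 < Num.min e (b - c) by rewrite lt_min e0 subr_gt0.
have [me mb] : Num.min e (b - c) <= e /\ Num.min e (b - c) <= b - c.
  by rewrite !ge_min !lexx orbT.
have cx : c < x by rewrite /x ltrDl divr_gt0.
have xb : x < b by rewrite /x; lra.
have cf : {within `[c, x], continuous f}.
  apply: (@is_derive_segment_continuous _ _ df) => y /andP[cy yx]; apply: hf.
  by rewrite (lt_le_trans ac)// (le_lt_trans yx).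
have df' y : y \in `]c, x[ -> is_derive y 1 f (df y).
  rewrite in_itv/= => /andP[cy yx]; apply: hf.
  by rewrite (lt_trans ac)// (lt_trans yx).
have [y] := MVT cx df' cf.
rewrite in_itv/= => /andP[cy yx] E3.
have : f x < f c.
  rewrite -subr_lt0 E3 pmulr_llt0 ?subr_gt0//.
  have yc : 0 < y - c by rewrite subr_gt0.
  have /he : ball_ Num.norm 0 e (y - c).
    by rewrite /ball_/= sub0r normrN gtr0_norm//; rewrite /x in yx; lra.
  rewrite gt_eqF// => /(_ isT); rewrite /= dfc subr0 [_%:A]mulr1 subrK.
  by rewrite pmulr_rlt0// invr_gt0.
by rewrite ltNge fmin// (lt_trans ac).
Qed.

End SecondDerivatives.

(** * Integrals over the line and the plane *)

Section LineIntegrals.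
Context {R : realType}.
Notation mu := (@lebesgue_measure R).

Lemma mu_itv (L : R) : 0 <= L -> mu `[- L, L]%classic = (2 * L)%:E.
Proof.
move=> L0; transitivity (lebesgue_measure (`[- L, L]%classic : set R)) => //.
rewrite lebesgue_measure_itv/= lte_fin; case: ifPn => [_|].
  by rewrite -EFinB/= opprK mulr2n mulrDl mul1r.
rewrite -leNgt => LL; have -> : L = 0 by apply/eqP; rewrite eq_le; apply/andP; split; lra.
by rewrite mulr0.
Qed.

Lemma Rintegral_support (f : R -> R) (x y : R) :
  (forall t, ~~ (x <= t <= y) -> f t = 0) ->
  \int[mu]_(t in setT) f t = \int[mu]_(t in `[x, y]) f t.
Proof.
move=> f0; rewrite [RHS]Rintegral_mkcond; congr (Rintegral _ _ _).
apply/funext => t; rewrite patchE; case: ifPn => //.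
rewrite notin_setE/= in_itv/= => /negP; exact: f0.
Qed.

Section Bounded.
Variables (f : R -> R) (L C : R).
Hypotheses (L0 : 0 <= L) (mf : measurable_fun setT f)
  (fC : forall t, `|f t| <= C) (fL : forall t, L < `|t| -> f t = 0).

Lemma support_patch : f = f \_ `[- L, L].
Proof.
apply/funext => t; rewrite patchE; case: ifPn => //.
rewrite notin_setE/= in_itv/= -ler_norml => /negP; rewrite -ltNge; exact: fL.
Qed.

Lemma bounded_support_integrable : mu.-integrable setT (EFin \o f).
Proof.
rewrite (_ : EFin \o f = (EFin \o f) \_ `[- L, L]); last first.
  by rewrite {1}support_patch restrict_EFin.
have mI : measurable (`[- L, L]%classic : set (measurableTypeR R)) by [].
have [H _] := @integrable_mkcond _ _ R mu `[- L, L] (EFin \o f) mI.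
apply: H.
apply: measurable_bounded_integrable => //.
- by apply: (le_lt_trans (y := (2 * L)%:E)); [rewrite -mu_itv|exact: ltry].
- exact: measurable_funS mf.
- by exists C; split; [exact: num_real|move=> M CM t _; apply: le_trans (fC t) (ltW CM)].
Qed.

Lemma Rintegral_bound : `|\int[mu]_(t in setT) f t| <= C * (2 * L).
Proof.
have C0 : 0 <= C by rewrite (le_trans _ (fC 0)).
rewrite (@Rintegral_support _ (- L) L); last first.
  by move=> t; rewrite -ler_norml -ltNge; exact: fL.
have mI : measurable (`[- L, L]%classic : set (measurableTypeR R)) by [].
have int_f : mu.-integrable `[- L, L] (EFin \o f).
  by apply: integrableS bounded_support_integrable.
rewrite (le_trans (le_normr_Rintegral mI int_f))//.
have fin : (mu (`[(- L)%R, L]%classic) < +oo)%E.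
  by apply: (le_lt_trans (y := (2 * L)%:E)); [rewrite -mu_itv|exact: ltry].
have -> : C * (2 * L) = \int[mu]_(t in `[- L, L]) C.
  rewrite Rintegral_cst//.
  by have /= -> : mu `[- L, L]%classic = (2 * L)%:E by exact: mu_itv.
apply: le_Rintegral => //.
- exact: integrable_norm.
- apply: measurable_bounded_integrable => //.
  exists `|C|; split; [exact: num_real|move=> M CM t _; exact: ltW].
Qed.

End Bounded.

Lemma Rintegral_shift (f : R -> R) (L c : R) : 0 <= L -> continuous f ->
  (forall t, L < `|t| -> f t = 0) ->
  \int[mu]_(t in setT) f (t + c) = \int[mu]_(t in setT) f t.
Proof.
(* The window contains the support of the translate, and shifted by [c] it contains the support of
   [f]. *)
move=> L0 cf fL; pose a := - (L + `|c|); pose b := L + `|c|.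
have ab : a <= b by rewrite /a /b; have := normr_ge0 c; lra.
have cc := ler_norm c; have cN : - c <= `|c| by rewrite -normrN ler_norm.
rewrite (@Rintegral_support (fun t => f (t + c)) a b); last first.
  move=> t h; apply: fL; rewrite ltNge; apply: contra h; rewrite ler_norml /a /b.
  by move=> /andP[h1 h2]; apply/andP; split; lra.
rewrite (@Rintegral_support f (a + c) (b + c)); last first.
  move=> t h; apply: fL; rewrite ltNge; apply: contra h; rewrite ler_norml /a /b.
  by move=> /andP[h1 h2]; apply/andP; split; lra.
have D : derive1 (fun t : R => t + c) = cst 1.
  by apply/funext => z; rewrite derive1E derive_val addr0.
have H := @integration_by_substitution_increasing R (fun t => t + c) f a b ab.
congr fine; rewrite /= H ?D.
- by apply: eq_integral => t _; rewrite fctE /= mulr1.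
- by move=> x y _ _; rewrite ltrD2r.
- by move=> x _; exact: cst_continuous.
- exact: is_cvg_cst.
- exact: is_cvg_cst.
- split.
  + by move=> x _; exact: ex_derive.
  + by apply: cvg_at_right_filter; apply: cvgD; [exact: cvg_id|exact: cvg_cst].
  + by apply: cvg_at_left_filter; apply: cvgD; [exact: cvg_id|exact: cvg_cst].
- exact: continuous_subspaceT.
Qed.

Lemma Rintegral_opp (f : R -> R) (L : R) : 0 <= L -> continuous f ->
  (forall t, L < `|t| -> f t = 0) ->
  \int[mu]_(t in setT) f (- t) = \int[mu]_(t in setT) f t.
Proof.
move=> L0 cf fL.
have s (g : R -> R) : (forall t, L < `|t| -> g t = 0) ->
    \int[mu]_(t in setT) g t = \int[mu]_(t in `[- L, L]) g t.
  move=> gL; apply: Rintegral_support => t; rewrite -ler_norml -ltNge; exact: gL.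
rewrite s; last by move=> t tL; rewrite fL// normrN.
rewrite s//; congr fine.
rewrite -[in RHS](opprK L).
rewrite integration_by_substitution_oppr ?opprK//; first lra.
exact: continuous_subspaceT.
Qed.

(** Uniform continuity passes to partial integrals of functions with bounded support, with an
    explicit modulus; this is what the inductions on the dimension use. *)
Definition ucont (V : normedModType R) (f : V -> R) :=
  forall e : R, 0 < e -> exists2 d : R, 0 < d &
    forall x y, `|x - y| < d -> `|f x - f y| <= e.

Lemma ucont_continuous (V : normedModType R) (f : V -> R) : ucont f -> continuous f.
Proof.
move=> uf x; apply/cvgrPdist_le => e /uf[d d0 h]; near=> y; apply: h.
by near: y; apply: cvgr_dist_lt.
Unshelve. all: by end_near. Qed.

Lemma Fubini_ucont (f : R -> R -> R) (L C : R) : 0 <= L ->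
  ucont (fun p : R * R => f p.1 p.2) ->
  (forall x y, `|f x y| <= C) ->
  (forall x y, L < `|x| \/ L < `|y| -> f x y = 0) ->
  \int[mu]_(x in setT) \int[mu]_(y in setT) f x y =
  \int[mu]_(y in setT) \int[mu]_(x in setT) f x y.
Proof.
move=> L0 uf fC fL.
have c1 x : continuous (f x).
  apply: ucont_continuous => e /uf[d d0 h]; exists d => // y y' yy.
  apply: (h (x, y) (x, y')); rewrite prod_normE/= subrr normr0 gt_max yy.
  by rewrite (le_lt_trans _ yy).
have c2 y : continuous (f^~ y).
  apply: ucont_continuous => e /uf[d d0 h]; exists d => // x x' xx.
  apply: (h (x, y) (x', y)); rewrite prod_normE/= subrr normr0 gt_max xx.
  by rewrite (le_lt_trans _ xx).
have mf : measurable_fun setT (fun p : R * R => f p.1 p.2).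
  (* Joint measurability: with the first variable frozen on the grid of mesh [1 / k.+1], preimages
     are countable unions of measurable rectangles; then let [k] tend to infinity. *)
  pose h (k : nat) (x : R) : R := (Num.floor (k.+1%:R * x))%:~R / k.+1%:R.
  apply: (@measurable_realfun.measurable_fun_cvg _ _ _ _ (fun k p => f (h k p.1) p.2)).
    move=> k _ B mB; rewrite setTI.
    rewrite (_ : _ @^-1` _ = \bigcup_(j in @setT int)
      ([set x | Num.floor (k.+1%:R * x) = j] `*`
       [set y | B (f (j%:~R / k.+1%:R) y)])); last first.
      apply/seteqP; split => [[x y]/= Bf|[x y] [j _ [/= <-]]//].
      by exists (Num.floor (k.+1%:R * x)).
    apply: countable_bigcupT_measurable => // j; apply: measurableX.
      rewrite (_ : [set x | _] = `[j%:~R / k.+1%:R, (j + 1)%:~R / k.+1%:R[%classic).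
        exact: measurable_itv.
      apply/seteqP; split => x /=; rewrite in_itv/= ler_pdivrMr// ltr_pdivlMr//.
        by move=> <-; rewrite ![x * _]mulrC floor_le_tmp floorD1_gt.
      by rewrite ![x * _]mulrC => /floor_def.
    rewrite -[X in measurable X]setTI.
    exact: (measurable_realfun.continuous_measurable_fun (c1 _) measurableT mB).
  move=> [x y] _ /=.
  apply: (@continuous_cvg _ _ _ _ _ _ (f^~ y) x); first exact: c2.
  apply/cvgrPdist_le => e e0; near=> k.
  have k0 : 0 < k.+1%:R :> R by rewrite ltr0n.
  have h1 : h k x <= x by rewrite /h ler_pdivrMr// mulrC floor_le_tmp.
  have h2 : x - h k x <= k.+1%:R^-1.
    rewrite lerBlDl -[k.+1%:R^-1]mul1r -mulrDl ler_pdivlMr// mulrC ltW//.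
    by rewrite -intrD1 floorD1_gt.
  rewrite ger0_norm ?subr_ge0// (le_trans h2)//.
  by apply: ltW; near: k; exact: (near_infty_natSinv_lt (PosNum e0)).
have int1 (g : R -> R) : continuous g -> (forall t, `|g t| <= C) ->
   (forall t, L < `|t| -> g t = 0) -> mu.-integrable setT (EFin \o g).
  move=> cg gC gL; apply: (bounded_support_integrable L0 _ gC gL).
  exact: measurable_realfun.continuous_measurable_fun.
pose I : set (measurableTypeR R) := `[- L, L]%classic.
have mI : measurable I by exact: measurable_itv.
have intf : (mu \x mu)%E.-integrable setT (fun p : R * R => (f p.1 p.2)%:E).
  have mII : measurable (I `*` I) by exact: measurableX.
  rewrite (_ : (fun p => _) = (EFin \o (fun p : R * R => f p.1 p.2)) \_ (I `*` I)); last first.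
    apply/funext => -[x y]; rewrite patchE; case: ifPn => //.
    rewrite notin_setE/= /I/= !in_itv/= -!ler_norml => /not_andP h.
    by rewrite fL// !ltNge; case: h => /negP; [left|right].
  have [H _] := @integrable_mkcond _ _ R (mu \x mu)%E (I `*` I)
    (EFin \o (fun p : R * R => f p.1 p.2)) mII.
  apply: H; apply: measurable_bounded_integrable => //.
  - rewrite /= product_measure1E//.
    have E : mu I = (2 * L)%:E by exact: mu_itv.
    apply: (@le_lt_trans _ _ ((2 * L)%:E * (2 * L)%:E)%E); last by rewrite -EFinM ltry.
    by rewrite -[X in (_ <= X * X)%E]E.
  - exact: measurable_funS mf.
  - by exists C; split; [exact: num_real|move=> M CM t _; apply: le_trans (fC _ _) (ltW CM)].
have K (g : R -> R) : continuous g -> (forall t, `|g t| <= C) ->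
   (forall t, L < `|t| -> g t = 0) ->
   (fine (\int[mu]_x (g x)%:E))%:E = (\int[mu]_x (g x)%:E)%E.
  by move=> cg gC gL; rewrite fineK//; apply: integrable_fin_num => //; exact: int1.
have := Fubini intf; rewrite /= /Rintegral => E.
transitivity (fine (\int[mu]_x \int[mu]_y (f x y)%:E)%E).
  congr fine; apply: eq_integral => x _; apply: K => //.
  by move=> y yL; rewrite fL//; right.
rewrite E; congr fine; apply: eq_integral => y _; apply/esym; apply: K => //.
by move=> x xL; rewrite fL//; left.
Unshelve. all: by end_near. Qed.

End LineIntegrals.

(** * Iterated integrals of test functions; shears and rotations of the plane *)

Section IteratedIntegral.
Context {R : realType}.
Notation mu := (@lebesgue_measure R).

Lemma rV_norm_le n (x : 'rV[R]_n) (c : R) : 0 <= c -> (forall i, `|x 0 i| <= c) -> `|x| <= c.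
Proof.
move=> c0 h; rewrite [leLHS]mx_normrE; apply: bigmax_le => // -[i j] _ /=.
by rewrite ord1.
Qed.

Lemma coord_norm_le n (x : 'rV[R]_n) i : `|x 0 i| <= `|x|.
Proof.
rewrite [leRHS]mx_normrE.
exact: (le_bigmax _ (fun ij : 'I_1 * 'I_n => `|x ij.1 ij.2|) (0, i)).
Qed.

(** The form in which [iter_integral] splits off the first variable. *)
Definition consv n (t : R) (y : 'rV[R]_n) : 'rV[R]_n.+1 :=
  row_mx (t%:M : 'rV[R]_1) y : 'rV[R]_(1 + n).

Lemma consv0 n t (y : 'rV[R]_n) : consv t y 0 0 = t.
Proof.
rewrite /consv (_ : 0 = lshift n 0 :> 'I_(1 + n)); last exact: val_inj.
by rewrite [LHS](row_mxEl (t%:M : 'rV_1) y) mxE eqxx.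
Qed.

Lemma consvS n t (y : 'rV[R]_n) i : consv t y 0 (lift 0 i) = y 0 i.
Proof.
rewrite /consv (_ : lift 0 i = rshift 1 i :> 'I_(1 + n)); last exact: val_inj.
by rewrite [LHS](row_mxEr (t%:M : 'rV_1) y).
Qed.

Lemma consv_eta n (x : 'rV[R]_n.+1) : x = consv (x 0 0) (\row_i x 0 (lift 0 i)).
Proof.
apply/rowP => i; case: (unliftP 0 i) => [j ->|->]; last by rewrite consv0.
by rewrite consvS mxE.
Qed.

Lemma consv_inj n t t' (y y' : 'rV[R]_n) : consv t y = consv t' y' -> t = t' /\ y = y'.
Proof.
move=> E; split; first by rewrite -(consv0 t y) E consv0.
by apply/rowP => i; rewrite -(consvS t y) E consvS.
Qed.

Lemma consvZD n (k : R) t t' (y y' : 'rV[R]_n) :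
  k *: consv t y + consv t' y' = consv (k * t + t') (k *: y + y').
Proof.
apply/rowP => i; have E (A B : 'rV[R]_n.+1) : (k *: A + B) 0 i = k * A 0 i + B 0 i.
  by rewrite !mxE.
rewrite E; case: (unliftP 0 i) => [j ->|->]; last by rewrite !consv0.
by rewrite !consvS !mxE.
Qed.

Lemma consvB n t t' (y y' : 'rV[R]_n) : consv t y - consv t' y' = consv (t - t') (y - y').
Proof. by rewrite addrC -scaleN1r consvZD mulN1r scaleN1r addrC [- y' + y]addrC. Qed.

Lemma consv_norm n t (y : 'rV[R]_n) : `|consv t y| = Num.max `|t| `|y|.
Proof.
apply/eqP; rewrite eq_le; apply/andP; split.
  apply: rV_norm_le => [|i]; first by rewrite le_max normr_ge0.
  case: (unliftP 0 i) => [j ->|->]; last by rewrite consv0 le_max lexx.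
  by rewrite consvS le_max coord_norm_le orbT.
rewrite ge_max; apply/andP; split; first by rewrite -{1}(consv0 t y) coord_norm_le.
by apply: rV_norm_le => // i; rewrite -(consvS t y) coord_norm_le.
Qed.

Lemma iter_integralS n (F : 'rV[R]_n.+1 -> R) :
  iter_integral F = \int[mu]_(t in setT) iter_integral (fun y => F (consv t y)).
Proof. by []. Qed.

(** The support radius and the bound are parameters: slicing keeps both, and integrals are then
    estimated by [C * (2 * L) ^+ n]. *)
Record testfun n (L C : R) (F : 'rV[R]_n -> R) : Prop := Testfun {
  test_ucont : ucont F;
  test_bound : forall x, `|F x| <= C;
  test_support : forall x, L < `|x| -> F x = 0 }.

Lemma testfun_slice n L C (F : 'rV[R]_n.+1 -> R) t :
  testfun L C F -> testfun L C (fun y => F (consv t y)).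
Proof.
move=> [uF bF sF]; split=> [e /uF[d d0 h]|//|y yL].
  exists d => // y y' yy; apply: h; rewrite consvB consv_norm subrr normr0 gt_max yy.
  by rewrite (le_lt_trans _ yy).
by apply: sF; rewrite consv_norm lt_max yL orbT.
Qed.

Lemma testfun_comb n L C C' k (F G : 'rV[R]_n -> R) :
  testfun L C F -> testfun L C' G -> testfun L (C + `|k| * C') (fun x => F x + k * G x).
Proof.
move=> [uF bF sF] [uG bG sG]; split=> [e e0|x|x xL]; last by rewrite sF// sG// mulr0 addr0.
  have k0 : 0 < `|k| + 1 by rewrite ltr_wpDl.
  have e1 : 0 < e / 2 by rewrite divr_gt0.
  have e2 : 0 < e / 2 / (`|k| + 1) by rewrite divr_gt0.
  have [d d0 hd] := uF _ e1; have [d' d'0 hd'] := uG _ e2.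
  exists (Num.min d d'); first by rewrite lt_min d0.
  move=> x y; rewrite lt_min => /andP[/hd xd /hd' xd'].
  rewrite (_ : _ - _ = (F x - F y) + k * (G x - G y)); last by ring.
  rewrite (le_trans (ler_normD _ _))// (splitr e) lerD// normrM.
  rewrite (le_trans (ler_pM _ _ (lexx _) xd'))// mulrCA ler_piMr//; first exact: ltW.
  by rewrite ler_pdivrMr// mul1r lerDl.
by rewrite (le_trans (ler_normD _ _))// lerD// normrM ler_pM.
Qed.

Lemma testfunW n L C C' (F : 'rV[R]_n -> R) : testfun L C F ->
  (forall x, `|F x| <= C') -> testfun L C' F.
Proof. by move=> [? ? ?] ?. Qed.

Lemma ucont_measurable (f : R -> R) : ucont f -> measurable_fun setT f.
Proof.
move=> /ucont_continuous; exact: measurable_realfun.continuous_measurable_fun.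
Qed.

(** Bound and linearity are proved in one induction: continuity of the inner integral in the outer
    variable is the bound applied to a difference, which is a linear combination. *)
Lemma iter_integral_test n L : 0 <= L ->
  (forall C (F : 'rV[R]_n -> R), testfun L C F ->
    `|iter_integral F| <= C * (2 * L) ^+ n) /\
  (forall C C' k (F G : 'rV[R]_n -> R), testfun L C F -> testfun L C' G ->
    iter_integral (fun x => F x + k * G x) = iter_integral F + k * iter_integral G).
Proof.
move=> L0; elim: n => [|n [IHb IHl]].
  by split=> [C F [_ b _]|//]; rewrite expr0 mulr1; exact: b.
have L20 : 0 <= (2 * L) ^+ n by rewrite exprn_ge0// mulr_ge0.
have par C F : testfun L C F ->
  [/\ ucont (fun t => iter_integral (fun y : 'rV[R]_n => F (consv t y))),
   (forall t, `|iter_integral (fun y : 'rV[R]_n => F (consv t y))| <= C * (2 * L) ^+ n) &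
   (forall t, L < `|t| -> iter_integral (fun y : 'rV[R]_n => F (consv t y)) = 0)].
  move=> tF; have tS t := testfun_slice t tF.
  split=> [e e0|t|t tL]; last 2 first.
  - exact: IHb.
  - apply/eqP; rewrite -normr_le0 (le_trans (IHb 0 _ _))// ?mul0r//.
    by apply: testfunW (tS t) _ => y; rewrite (test_support tF) ?normr0// consv_norm lt_max tL.
  have k0 : 0 < (2 * L) ^+ n + 1 by rewrite ltr_wpDl.
  (* The inner integral enlarges the error by at most [(2 * L) ^+ n]; the [+ 1] keeps the
     denominator positive. *)
  have e1 : 0 < e / ((2 * L) ^+ n + 1) by rewrite divr_gt0.
  have [d d0 hd] := test_ucont tF e1.
  exists d => // t t' tt; rewrite -mulN1r -(IHl _ _ _ _ _ (tS t) (tS t')).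
  rewrite (le_trans (IHb (e / ((2 * L) ^+ n + 1)) _ _))//.
    apply: testfunW (testfun_comb (-1) (tS t) (tS t')) _ => y.
    rewrite mulN1r; apply: hd; rewrite consvB subrr consv_norm normr0 gt_max tt.
    by rewrite (le_lt_trans _ tt).
  by rewrite mulrAC ler_pdivrMr// ler_wpM2l// ?lerDl// ltW.
split=> [C F /par[p1 p2 p3]|C C' k F G tF tG].
  have := Rintegral_bound L0 (ucont_measurable p1) p2 p3.
  by rewrite -[C * _ * _]mulrA -exprSr.
have [p1 p2 p3] := par _ _ tF; have [q1 q2 q3] := par _ _ tG.
rewrite !iter_integralS.
under eq_Rintegral => t _ do rewrite (IHl _ _ k _ _ (testfun_slice t tF) (testfun_slice t tG)).
have iF := bounded_support_integrable L0 (ucont_measurable p1) p2 p3.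
have iG := bounded_support_integrable L0 (ucont_measurable q1) q2 q3.
have ikG : mu.-integrable setT (EFin \o (fun t => k *
    iter_integral (fun y : 'rV[R]_n => G (consv t y)))).
  apply: (@bounded_support_integrable _ _ L (`|k| * (C' * (2 * L) ^+ n))) => //.
  - by apply: measurable_realfun.measurable_funM; [exact: measurable_cst|exact: ucont_measurable].
  - by move=> t; rewrite normrM ler_wpM2l.
  - by move=> t tL; rewrite q3// mulr0.
by rewrite RintegralD// RintegralZl.
Qed.

Lemma iter_integral_bound n L C (F : 'rV[R]_n -> R) : 0 <= L -> testfun L C F ->
  `|iter_integral F| <= C * (2 * L) ^+ n.
Proof. by move=> L0; have [+ _] := iter_integral_test n L0; exact. Qed.

Lemma iter_integral_comb n L C C' k (F G : 'rV[R]_n -> R) : 0 <= L ->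
  testfun L C F -> testfun L C' G ->
  iter_integral (fun x => F x + k * G x) = iter_integral F + k * iter_integral G.
Proof. by move=> L0 tF; have [_ +] := iter_integral_test n L0; apply; exact: tF. Qed.

Lemma iter_integral_diff n L C e (F G : 'rV[R]_n -> R) : 0 <= L ->
  testfun L C F -> testfun L C G -> (forall x, `|F x - G x| <= e) ->
  `|iter_integral F - iter_integral G| <= e * (2 * L) ^+ n.
Proof.
move=> L0 tF tG FG; rewrite -mulN1r -(iter_integral_comb (-1) L0 tF tG).
apply: iter_integral_bound => //; apply: testfunW (testfun_comb (-1) tF tG) _ => x.
by rewrite mulN1r.
Qed.

Lemma testfun_eq0 n L C (F : 'rV[R]_n -> R) : 0 <= L -> testfun L C F ->
  (forall x, F x = 0) -> iter_integral F = 0.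
Proof.
move=> L0 tF F0; apply/eqP; rewrite -normr_le0.
rewrite (le_trans (iter_integral_bound (C := 0) L0 _)) ?mul0r//.
by apply: testfunW tF _ => x; rewrite F0 normr0.
Qed.

Lemma iter_integral_param n L C (F : 'rV[R]_n.+1 -> R) : 0 <= L -> testfun L C F ->
  [/\ ucont (fun t => iter_integral (fun y : 'rV[R]_n => F (consv t y))),
   (forall t, `|iter_integral (fun y : 'rV[R]_n => F (consv t y))| <= C * (2 * L) ^+ n) &
   (forall t, L < `|t| -> iter_integral (fun y : 'rV[R]_n => F (consv t y)) = 0)].
Proof.
move=> L0 tF; have tS t := testfun_slice t tF.
have L20 : 0 <= (2 * L) ^+ n by rewrite exprn_ge0// mulr_ge0.
split=> [e e0|t|t tL]; last 2 first.
- exact: iter_integral_bound.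
- by apply: (testfun_eq0 L0 (tS t)) => y; rewrite (test_support tF)// consv_norm lt_max tL.
have k0 : 0 < (2 * L) ^+ n + 1 by rewrite ltr_wpDl.
have e1 : 0 < e / ((2 * L) ^+ n + 1) by rewrite divr_gt0.
have [d d0 hd] := test_ucont tF e1.
exists d => // t t' tt.
apply: (le_trans (iter_integral_diff L0 (tS t) (tS t') _)) => [y|].
  apply: hd; rewrite consvB subrr consv_norm normr0 gt_max tt.
  by rewrite (le_lt_trans _ tt).
by rewrite mulrAC ler_pdivrMr// ler_wpM2l// ?lerDl// ltW.
Qed.

Lemma ucont_lip (V W : normedModType R) (K : R) (F : W -> R) (A : V -> W) :
  ucont F -> (forall x y, `|A x - A y| <= K * `|x - y|) -> ucont (F \o A).
Proof.
move=> uF hA e /uF[d d0 h].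
have K0 : 0 < `|K| + 1 by rewrite ltr_wpDl.
exists (d / (`|K| + 1)); first by rewrite divr_gt0.
move=> x y; rewrite ltr_pdivlMr// => xy; apply: h; rewrite (le_lt_trans (hA _ _))//.
rewrite (le_lt_trans _ xy)// mulrC ler_wpM2l// (le_trans (ler_norm _))// lerDl//.
Qed.

Record testfun2 (L C : R) (g : R -> R -> R) : Prop := Testfun2 {
  test2_ucont : ucont (fun p : R * R => g p.1 p.2);
  test2_bound : forall x y, `|g x y| <= C;
  test2_support : forall x y, L < `|x| \/ L < `|y| -> g x y = 0 }.

Lemma testfun2_upper L C a g : 0 <= L -> testfun2 L C g ->
  testfun2 ((1 + `|a|) * L) C (fun t u => g (t + a * u) u).
Proof.
move=> L0 [ug bg sg]; split=> [|//|t u tu].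
  apply: (@ucont_lip _ _ (1 + `|a|) (fun p : R * R => g p.1 p.2)
    (fun p : R * R => (p.1 + a * p.2, p.2)) ug) => -[x y] [x' y'] /=.
  have xx : `|x - x'| <= `|(x - x', y - y')| by rewrite prod_normE/= le_max lexx.
  have yy : `|y - y'| <= `|(x - x', y - y')| by rewrite prod_normE/= le_max lexx orbT.
  rewrite [leLHS]prod_normE/= ge_max; apply/andP; split; last first.
    by rewrite (le_trans yy)// ler_peMl// lerDl.
  rewrite (_ : _ - _ = (x - x') + a * (y - y')); last by ring.
  by rewrite (le_trans (ler_normD _ _))// mulrDl mul1r lerD// normrM ler_wpM2l.
apply: sg; have [yu|yu] := ltP L `|u|; [by right|left].
have {tu} tu : (1 + `|a|) * L < `|t|.
  case: tu => // uL; have := lt_le_trans uL yu.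
  by rewrite mulrDl mul1r gtrDl ltNge mulr_ge0.
have : `|t| <= `|t + a * u| + `|a| * L.
  rewrite -[t in leLHS](addrK (a * u)) (le_trans (ler_normB _ _))// lerD2l normrM.
  by rewrite ler_wpM2l.
by move: tu; lra.
Qed.

Lemma testfun2_swap L C g : testfun2 L C g -> testfun2 L C (fun t u => g u t).
Proof.
move=> [ug bg sg]; split=> [|//|t u [tu|tu]]; last 2 first.
- by apply: sg; right.
- by apply: sg; left.
apply: (@ucont_lip _ _ 1 (fun p : R * R => g p.1 p.2)
    (fun p : R * R => (p.2, p.1)) ug) => -[x y] [x' y'].
by rewrite mul1r !prod_normE/= maxC.
Qed.

Lemma testfun2_lower L C a g : 0 <= L -> testfun2 L C g ->
  testfun2 ((1 + `|a|) * L) C (fun t u => g t (u + a * t)).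
Proof.
move=> L0 tg.
exact: (testfun2_swap (testfun2_upper a L0 (testfun2_swap tg))).
Qed.

Notation int2 g := (\int[mu]_(t in setT) \int[mu]_(u in setT) g t u).

Lemma test2_slice L C g t : testfun2 L C g ->
  continuous (g t) /\ forall u, L < `|u| -> g t u = 0.
Proof.
move=> [ug bg sg]; split=> [|u uL]; last by apply: sg; right.
apply: ucont_continuous; apply: (@ucont_lip _ _ 1 (fun p : R * R => g p.1 p.2)
  (fun u : R => (t, u)) ug) => x y.
by rewrite mul1r prod_normE/= subrr normr0 ge_max lexx normr_ge0.
Qed.

Lemma int2_lower L C a g : 0 <= L -> testfun2 L C g ->
  int2 (fun t u => g t (u + a * t)) = int2 g.
Proof.
move=> L0 tg; apply: eq_Rintegral => t _.
have [c1 c2] := test2_slice t tg; exact: (Rintegral_shift (a * t) L0 c1 c2).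
Qed.

Lemma int2_swap L C g : 0 <= L -> testfun2 L C g -> int2 g = int2 (fun t u => g u t).
Proof. by move=> L0 [ug bg sg]; exact: (Fubini_ucont L0 ug bg sg). Qed.

Lemma int2_upper L C a g : 0 <= L -> testfun2 L C g ->
  int2 (fun t u => g (t + a * u) u) = int2 g.
Proof.
move=> L0 tg; have L'0 : 0 <= (1 + `|a|) * L by rewrite mulr_ge0// addr_ge0.
rewrite (int2_swap L'0 (testfun2_upper a L0 tg)).
by rewrite (int2_lower a L0 (testfun2_swap tg)) -(int2_swap L0 tg).
Qed.

(* The rotation is a product of three shears, each of which preserves the integral by
   translation invariance in one variable. *)
Lemma int2_rotation L C (c s : R) g : 0 <= L -> testfun2 L C g ->
  c ^+ 2 + s ^+ 2 = 1 -> s != 0 ->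
  int2 (fun t u => g (c * t - s * u) (s * t + c * u)) = int2 g.
Proof.
(* For the rotation by an angle this is minus the tangent of the half angle: the outer two shears
   use [a], the middle one uses [s]. *)
move=> L0 tg cs s0; set a := (c - 1) / s.
have L1 : 0 <= (1 + `|a|) * L by rewrite mulr_ge0// addr_ge0.
have L2 : 0 <= (1 + `|s|) * ((1 + `|a|) * L) by rewrite mulr_ge0// addr_ge0.
rewrite -[RHS](int2_upper a L0 tg).
have tg1 := testfun2_upper a L0 tg.
rewrite -[RHS](int2_lower s L1 tg1).
have tg2 := testfun2_lower s L1 tg1.
rewrite -[RHS](int2_upper a L2 tg2).
apply: eq_Rintegral => t _; apply: eq_Rintegral => u _.
have as1 : a * s = c - 1 by rewrite /a divfK.
have E1 : u + s * (t + a * u) = s * t + c * u.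
  by rewrite (_ : u + _ = s * t + (1 + a * s) * u); [rewrite as1 addrCA subrr addr0|ring].
rewrite E1; congr g; apply: (mulfI s0).
have -> : s * (t + a * u + a * (s * t + c * u)) =
  s * t + (a * s) * u + (a * s) * (s * t + c * u) by ring.
rewrite as1; have s2 : s * s = 1 - c * c by rewrite -cs; ring.
by rewrite mulrBr !mulrA s2; ring.
Qed.

End IteratedIntegral.

(** * Euclidean structure and orthogonal maps *)

Section Euclidean.
Context {R : realType}.

Lemma continuous_at_sum (T : topologicalType) (W : normedModType R) I (r : seq I)
    (F : I -> T -> W) p : (forall i, {for p, continuous (F i)}) ->
  {for p, continuous (fun q => \sum_(i <- r) F i q)}.
Proof.
move=> cF; elim: r => [|i r IH].
  rewrite (_ : (fun q => _) = cst 0); first exact: cst_continuous.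
  by apply/funext => q; rewrite big_nil.
rewrite (_ : (fun q => _) = (fun q => F i q + \sum_(j <- r) F j q)).
  by apply: continuousD => //; exact: cF.
by apply/funext => q; rewrite big_cons.
Qed.

Lemma continuous_at_prod (T : topologicalType) I (r : seq I) (F : I -> T -> R) p :
  (forall i, {for p, continuous (F i)}) ->
  {for p, continuous (fun q => \prod_(i <- r) F i q)}.
Proof.
move=> cF; elim: r => [|i r IH].
  rewrite (_ : (fun q => _) = cst 1); first exact: cst_continuous.
  by apply/funext => q; rewrite big_nil.
rewrite (_ : (fun q => _) = (fun q => F i q * \prod_(j <- r) F j q)).
  by apply: continuousM => //; exact: cF.
by apply/funext => q; rewrite big_cons.
Qed.

Section Dot.
Context {n : nat}.
Implicit Types x y : 'rV[R]_n.

Lemma dotpC x y : dotp x y = dotp y x.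
Proof. by apply: eq_bigr => i _; rewrite mulrC. Qed.
Lemma dotpDr x y z : dotp x (y + z) = dotp x y + dotp x z.
Proof. by rewrite -big_split; apply: eq_bigr => i _ /=; rewrite mxE mulrDr. Qed.
Lemma dotpDl x y z : dotp (x + y) z = dotp x z + dotp y z.
Proof. by rewrite dotpC dotpDr ![dotp z _]dotpC. Qed.
Lemma dotpZr k x y : dotp x (k *: y) = k * dotp x y.
Proof. by rewrite [RHS]mulr_sumr; apply: eq_bigr => i _ /=; rewrite mxE mulrCA. Qed.
Lemma dotpZl k x y : dotp (k *: x) y = k * dotp x y.
Proof. by rewrite dotpC dotpZr dotpC. Qed.
Lemma dotp0r x : dotp x 0 = 0.
Proof. by rewrite -(scale0r 0) dotpZr mul0r. Qed.
Lemma dotp0l x : dotp 0 x = 0. Proof. by rewrite dotpC dotp0r. Qed.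
Lemma dotpNr x y : dotp x (- y) = - dotp x y.
Proof. by rewrite -scaleN1r dotpZr mulN1r. Qed.
Lemma dotpBr x y z : dotp x (y - z) = dotp x y - dotp x z.
Proof. by rewrite dotpDr dotpNr. Qed.
Lemma dotp_ge0 x : 0 <= dotp x x.
Proof. by apply: sumr_ge0 => i _; rewrite -expr2 sqr_ge0. Qed.
Lemma dotp_eq0 x : (dotp x x == 0) = (x == 0).
Proof.
apply/eqP/eqP => [|->]; last exact: dotp0r.
move=> /eqP; rewrite psumr_eq0 => [/allP h|i _]; last by rewrite -expr2 sqr_ge0.
apply/rowP => i; rewrite mxE.
by have := h i (mem_index_enum i); rewrite /= -expr2 sqrf_eq0 => /eqP.
Qed.
Lemma enorm_ge0 x : 0 <= enorm x. Proof. exact: sqrtr_ge0. Qed.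
Lemma sqr_enorm x : enorm x ^+ 2 = dotp x x.
Proof. by rewrite sqr_sqrtr// dotp_ge0. Qed.
Lemma enormZ k x : enorm (k *: x) = `|k| * enorm x.
Proof. by rewrite /enorm dotpZl dotpZr mulrA -expr2 sqrtrM ?sqr_ge0// sqrtr_sqr. Qed.
Lemma enorm_eq0 x : (enorm x == 0) = (x == 0).
Proof. by rewrite sqrtr_eq0 -dotp_eq0 eq_le dotp_ge0 andbT. Qed.
Lemma enorm0 : enorm (0 : 'rV[R]_n) = 0. Proof. by apply/eqP; rewrite enorm_eq0. Qed.
Lemma enorm1P x : (enorm x = 1) <-> (dotp x x = 1).
Proof.
split=> [E|E]; first by rewrite -sqr_enorm E expr1n.
by rewrite /enorm E sqrtr1.
Qed.
Lemma enorm_gt0 x : x != 0 -> 0 < enorm x.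
Proof. by move=> x0; rewrite lt_neqAle enorm_ge0 eq_sym enorm_eq0 x0. Qed.
Lemma enorm_normalize x : x != 0 -> enorm ((enorm x)^-1 *: x) = 1.
Proof.
move=> /enorm_gt0 x0; rewrite enormZ ger0_norm ?invr_ge0 ?ltW//.
by rewrite mulVf// gt_eqF.
Qed.

Lemma norm_le_enorm x : `|x| <= enorm x.
Proof.
apply: rV_norm_le => [|i]; first exact: enorm_ge0.
rewrite -sqrtr_sqr ler_wsqrtr// expr2 /dotp (bigD1 i)//= lerDl.
by apply: sumr_ge0 => j _; rewrite -expr2 sqr_ge0.
Qed.

Lemma enorm_le_norm x : enorm x <= n%:R * `|x|.
Proof.
rewrite -[leRHS]ger0_norm ?mulr_ge0// -sqrtr_sqr ler_wsqrtr//.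
rewrite /dotp (@le_trans _ _ (\sum_(i < n) `|x| ^+ 2))//.
  apply: ler_sum => i _; rewrite -expr2 -real_normK ?num_real//.
  by rewrite lerXn2r ?nnegrE// coord_norm_le.
rewrite sumr_const card_ord exprMn -[_ ^+ 2 *+ n]mulr_natl ler_wpM2r ?sqr_ge0//.
by rewrite -natrX ler_nat; case: n => // m; rewrite expnS leq_pmulr.
Qed.

Lemma continuous_dotp (T : topologicalType) (F G : T -> 'rV[R]_n) p :
  {for p, continuous F} -> {for p, continuous G} ->
  {for p, continuous (fun q => dotp (F q) (G q))}.
Proof.
move=> cF cG.
have cc (H : T -> 'rV[R]_n) i : {for p, continuous H} ->
    {for p, continuous (fun q => H q 0 i)}.
  move=> cH; apply: (@continuous_comp _ _ _ H (fun x : 'rV[R]_n => x 0 i)) => //.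
  exact: (blin_continuous (blin_coord i)).
by apply: continuous_at_sum => i; apply: continuousM; exact: cc.
Qed.

Lemma continuous_enorm : continuous (@enorm R n).
Proof.
move=> x; apply: (@continuous_comp _ _ _ (fun x : 'rV[R]_n => dotp x x) Num.sqrt).
  by apply: continuous_dotp; exact: cvg_id.
exact: sqrt_continuous.
Qed.

End Dot.

Lemma dotp_consv n t t' (y y' : 'rV[R]_n) :
  dotp (consv t y) (consv t' y') = t * t' + dotp y y'.
Proof.
rewrite /dotp big_ord_recl !consv0; congr (_ + _).
by apply: eq_bigr => i _; rewrite !consvS.
Qed.

Lemma heine_cantor n (L : R) (F : 'rV[R]_n -> R) :
  continuous F -> (forall x, L < `|x| -> F x = 0) -> ucont F.
Proof.
move=> cF sF e e0.
(* The margin 1 ensures that a point outside [K] and all points at distance less than 1 from it lie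
   outside the support. *)
pose K : set 'rV[R]_n := [set x | `|x| <= L + 1].
have cK : compact K.
  apply: bounded_closed_compact.
    exists (L + 1); split; first exact: num_real.
    by move=> M LM x Kx; apply: le_trans Kx (ltW LM).
  apply: (@closed_comp _ _ (fun x : 'rV[R]_n => `|x|) [set r | r <= L + 1]).
    by move=> x _; exact: norm_continuous.
  exact: closed_le.
have e2 : 0 < e / 2 by rewrite divr_gt0.
have cov (x : 'rV[R]_n) : K x -> \forall x' \near x & i \near 0^'+,
    forall z, `|x' - z| < i -> `|F x' - F z| <= e.
  move=> _; have /cvgrPdist_le/(_ _ e2) : F y @[y --> x] --> F x by exact: cF.
  case/nbhs_normP => d /= d0 hd.
  have d2 : 0 < d / 2 by rewrite divr_gt0.
  exists (ball x (d / 2), [set i | i < d / 2]) => /=.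
    split; first exact: nbhsx_ballx.
    by apply: nbhs_right_lt.
  move=> [y i] /= [+ id] z yz; rewrite -ball_normE /= => xy.
  have xz : `|x - z| < d.
    rewrite (le_lt_trans (ler_distD y _ _))// (splitr d) ltrD//.
    exact: lt_trans id.
  have xy' : `|x - y| < d by rewrite (lt_le_trans xy)// ler_pdivrMr// mulr2n mulrDr mulr1 lerDl ltW.
  rewrite (le_trans (ler_distD (F x) _ _))// (splitr e) lerD//.
    by rewrite distrC; exact: hd.
  exact: hd.
have := (compact_near_coveringP K).1 cK R (0^'+)
  (fun (i : R) x => forall z, `|x - z| < i -> `|F x - F z| <= e) _ cov.
move=> /(_ _).
rewrite near_withinE => /nbhs_normP[d /= d0 hd].
pose d' := Num.min (d / 2) 1.
have d'0 : 0 < d' by rewrite lt_min divr_gt0//=.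
exists d' => // x y xy.
have [Kx|Kx] := leP `|x| (L + 1).
  have dd : ball_ Num.norm 0 d d'.
    rewrite /ball_/= sub0r normrN gtr0_norm// /d' gt_min ltr_pdivrMr//.
    by rewrite mulr2n mulrDr mulr1 ltrDl d0.
  exact: (hd _ dd d'0 x Kx).
have xL : L < `|x| by rewrite (le_lt_trans _ Kx)// lerDl.
have yL : L < `|y|.
  have : `|x| <= `|x - y| + `|y| by rewrite -{1}(subrK y x) ler_normD.
  have : `|x - y| < 1 by rewrite (lt_le_trans xy)// ge_min lexx orbT.
  by move: Kx; lra.
by rewrite !sF// subrr normr0 ltW.
Qed.

Lemma consv00 n : consv 0 0 = 0 :> 'rV[R]_n.+1.
Proof.
by apply/rowP => i; case: (unliftP 0 i) => [j ->|->]; rewrite ?consvS ?consv0 !mxE.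
Qed.

Lemma consvZ n (k t : R) (y : 'rV[R]_n) : k *: consv t y = consv (k * t) (k *: y).
Proof. by rewrite -[LHS]addr0 -consv00 consvZD !addr0. Qed.

Definition linmap n (A : 'rV[R]_n -> 'rV[R]_n) :=
  forall k x y, A (k *: x + y) = k *: A x + A y.

(** The inverse is part of the data because the rotated flow is [B] after [X] after [A]. *)
Record orthmap n (A B : 'rV[R]_n -> 'rV[R]_n) : Prop := Orthmap {
  orth_lin : linmap A;
  orth_dotp : forall x y, dotp (A x) (A y) = dotp x y;
  orthK : cancel A B;
  orthKV : cancel B A }.

Lemma orthmap_sym n (A B : 'rV[R]_n -> 'rV[R]_n) : orthmap A B -> orthmap B A.
Proof.
move=> [lA dA AK BK]; split=> // [k x y|x y]; last by rewrite -dA !BK.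
by apply: (can_inj AK); rewrite lA !BK.
Qed.

Lemma orthmap_comp n (A B A' B' : 'rV[R]_n -> 'rV[R]_n) :
  orthmap A B -> orthmap A' B' -> orthmap (A \o A') (B' \o B).
Proof.
move=> [lA dA AK BK] [lA' dA' AK' BK']; split=> [k x y|x y|x|x] /=.
- by rewrite lA' lA.
- by rewrite dA dA'.
- by rewrite AK AK'.
- by rewrite BK' BK.
Qed.

Section OrthFacts.
Context {n : nat} (A B : 'rV[R]_n -> 'rV[R]_n).
Hypothesis o : orthmap A B.

Lemma orthD x y : A (x + y) = A x + A y.
Proof. by have := orth_lin o 1 x y; rewrite !scale1r. Qed.
Lemma orth0 : A 0 = 0.
Proof. by have /eqP := orthD 0 0; rewrite addr0 -subr_eq subrr => /eqP. Qed.
Lemma orthZ k x : A (k *: x) = k *: A x.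
Proof. by have := orth_lin o k x 0; rewrite orth0 !addr0. Qed.
Lemma orthB x y : A (x - y) = A x - A y.
Proof. by rewrite orthD -scaleN1r orthZ scaleN1r. Qed.
Lemma orth_enorm x : enorm (A x) = enorm x.
Proof. by rewrite /enorm (orth_dotp o). Qed.
Lemma orth_norm x : `|A x| <= n%:R * `|x|.
Proof. by rewrite (le_trans (norm_le_enorm _))// orth_enorm enorm_le_norm. Qed.
Lemma blin_orth : blin A.
Proof.
split; first exact: (orth_lin o).
exists (n%:R + 1) => [|x]; first by rewrite ltr_wpDl.
by rewrite (le_trans (orth_norm x))// ler_wpM2r// lerDl.
Qed.
Lemma orth_norm_lower x : `|x| <= n%:R * `|A x|.
Proof. by rewrite (le_trans (norm_le_enorm _))// -orth_enorm enorm_le_norm. Qed.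

Lemma testfun_orth L C F : testfun L C F -> testfun (n%:R * L) C (F \o A).
Proof.
move=> [uF bF sF]; split=> [|x|x xL] /=; last 2 first.
- exact: bF.
- apply: sF; have := lt_le_trans xL (orth_norm_lower x).
  have [n0|n0] := posnP n; last by rewrite ltr_pM2l// ltr0n.
  by have -> : n%:R = 0 :> R; [rewrite n0|rewrite !mul0r ltxx].
by apply: (ucont_lip (K := n%:R) uF) => x y; rewrite -orthB orth_norm.
Qed.
End OrthFacts.

Definition test_invariant n (A : 'rV[R]_n -> 'rV[R]_n) := forall L C F, 0 <= L ->
  testfun L C F -> iter_integral (fun x => F (A x)) = iter_integral F.

(** Invariance of the integral is bundled with orthogonality and shown for generators closed under
    composition; these suffice to carry the pole to every unit vector. *)
Definition good_orth n (A B : 'rV[R]_n -> 'rV[R]_n) :=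
  orthmap A B /\ test_invariant A.

Lemma good_orth_id n : good_orth (id : 'rV[R]_n -> 'rV[R]_n) id.
Proof. by []. Qed.

Lemma good_orth_comp n (A B A' B' : 'rV[R]_n -> 'rV[R]_n) :
  good_orth A B -> good_orth A' B' -> good_orth (A \o A') (B' \o B).
Proof.
move=> [oA iA] [oA' iA']; split; first exact: orthmap_comp.
move=> L C F L0 tF /=; have tFA := testfun_orth oA tF.
have nL : 0 <= n%:R * L by rewrite mulr_ge0.
by rewrite (iA' _ _ _ nL tFA); exact: iA tF.
Qed.

Definition tailv n (x : 'rV[R]_n.+1) : 'rV[R]_n := \row_i x 0 (lift 0 i).

Lemma tailv_consv n t (y : 'rV[R]_n) : tailv (consv t y) = y.
Proof. by apply/rowP => i; rewrite mxE consvS. Qed.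

Lemma consv1_eta n (x : 'rV[R]_n.+1) : exists t y, x = consv t y.
Proof. by exists (x 0 0), (tailv x); exact: consv_eta. Qed.

Definition liftv n (A : 'rV[R]_n -> 'rV[R]_n) (x : 'rV[R]_n.+1) : 'rV[R]_n.+1 :=
  consv (x 0 0) (A (tailv x)).

Lemma liftv_consv n (A : 'rV[R]_n -> 'rV[R]_n) t y : liftv A (consv t y) = consv t (A y).
Proof. by rewrite /liftv consv0 tailv_consv. Qed.

Lemma good_orth_lift n (A B : 'rV[R]_n -> 'rV[R]_n) :
  good_orth A B -> good_orth (liftv A) (liftv B).
Proof.
move=> [[lA dA AK BK] iA]; split.
  split=> [k x y|x y|x|x].
  - by rewrite (consv_eta x) (consv_eta y) consvZD !liftv_consv lA consvZD.
  - by rewrite (consv_eta x) (consv_eta y) !liftv_consv !dotp_consv dA.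
  - by have [t [y ->]] := consv1_eta x; rewrite (liftv_consv A) (liftv_consv B) AK.
  - by have [t [y ->]] := consv1_eta x; rewrite (liftv_consv B) (liftv_consv A) BK.
move=> L C F L0 tF; rewrite !iter_integralS; apply: eq_Rintegral => t _.
under eq_fun do rewrite liftv_consv.
exact: (iA _ _ _ L0 (testfun_slice t tF)).
Qed.

Definition flipv n (x : 'rV[R]_n.+1) : 'rV[R]_n.+1 := consv (- x 0 0) (tailv x).

Lemma flipv_consv n t (y : 'rV[R]_n) : flipv (consv t y) = consv (- t) y.
Proof. by rewrite /flipv consv0 tailv_consv. Qed.

Lemma good_orth_flip n : good_orth (@flipv n) (@flipv n).
Proof.
split.
  split=> [k x y|x y|x|x].
  - rewrite (consv_eta x) (consv_eta y) consvZD !flipv_consv consvZD.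
    by rewrite opprD mulrN.
  - by rewrite (consv_eta x) (consv_eta y) !flipv_consv !dotp_consv mulrNN.
  - by have [t [y ->]] := consv1_eta x; rewrite flipv_consv [LHS]flipv_consv opprK.
  - by have [t [y ->]] := consv1_eta x; rewrite flipv_consv [LHS]flipv_consv opprK.
move=> L C F L0 tF; rewrite !iter_integralS.
have [p1 p2 p3] := iter_integral_param L0 tF.
rewrite -[RHS](Rintegral_opp L0 (ucont_continuous p1) p3).
by apply: eq_Rintegral => t _; under eq_fun do rewrite flipv_consv.
Qed.

Definition rotv n (c s : R) (x : 'rV[R]_n.+2) : 'rV[R]_n.+2 :=
  consv (c * x 0 0 - s * tailv x 0 0)
    (consv (s * x 0 0 + c * tailv x 0 0) (tailv (tailv x))).

Lemma rotv_consv n c s t u (y : 'rV[R]_n) :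
  rotv c s (consv t (consv u y)) = consv (c * t - s * u) (consv (s * t + c * u) y).
Proof. by rewrite /rotv consv0 !tailv_consv consv0. Qed.

Lemma consv2_eta n (x : 'rV[R]_n.+2) : exists t u y, x = consv t (consv u y).
Proof.
by exists (x 0 0), (tailv x 0 0), (tailv (tailv x)); rewrite [LHS]consv_eta; congr consv; exact: consv_eta.
Qed.

(** Integrating out the remaining variables leaves a two-variable test function, to which the plane
    rotation applies. The condition on [s] comes from the decomposition into shears, which divides
    by [s]. *)
Lemma good_orth_rot n c s : c ^+ 2 + s ^+ 2 = 1 -> s != 0 ->
  good_orth (@rotv n c s) (rotv c (- s)).
Proof.
move=> cs s0; split.
  split=> [k x y|x y|x|x].
  - have [t [u [w ->]]] := consv2_eta x; have [t' [u' [w' ->]]] := consv2_eta y.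
    by rewrite (consvZD k t t') (consvZD k u u') 3!rotv_consv !consvZD; congr (consv _ (consv _ _)); ring.
  - have [t [u [w ->]]] := consv2_eta x; have [t' [u' [w' ->]]] := consv2_eta y.
    rewrite !rotv_consv !dotp_consv !addrA; congr (_ + _).
    transitivity ((c ^+ 2 + s ^+ 2) * (t * t' + u * u')); first by ring.
    by rewrite cs mul1r.
  - have [t [u [w ->]]] := consv2_eta x; rewrite rotv_consv [LHS]rotv_consv.
    congr (consv _ (consv _ _)).
      by transitivity ((c ^+ 2 + s ^+ 2) * t); [ring|rewrite cs mul1r].
    by transitivity ((c ^+ 2 + s ^+ 2) * u); [ring|rewrite cs mul1r].
  - have [t [u [w ->]]] := consv2_eta x; rewrite rotv_consv [LHS]rotv_consv.
    congr (consv _ (consv _ _)).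
      by transitivity ((c ^+ 2 + s ^+ 2) * t); [ring|rewrite cs mul1r].
    by transitivity ((c ^+ 2 + s ^+ 2) * u); [ring|rewrite cs mul1r].
move=> L C F L0 tF; rewrite !iter_integralS.
pose g t u := iter_integral (fun y : 'rV[R]_n => F (consv t (consv u y))).
have tS t u := testfun_slice u (testfun_slice t tF).
have tg : testfun2 L (C * (2 * L) ^+ n) g.
  split=> [e e0|t u|t u tu].
  - have k0 : 0 < (2 * L) ^+ n + 1 by rewrite ltr_wpDl// exprn_ge0// mulr_ge0.
    have e1 : 0 < e / ((2 * L) ^+ n + 1) by rewrite divr_gt0.
    have [d d0 hd] := test_ucont tF e1.
    exists d => // -[t u] [t' u']; rewrite [X in X < _ -> _]prod_normE/= gt_max.
    move=> /andP[tt uu].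
    apply: (le_trans (iter_integral_diff L0 (tS t u) (tS t' u') _)) => [y|].
      apply: hd; rewrite !consvB !consv_norm subrr normr0 !gt_max tt uu.
      by rewrite (le_lt_trans _ uu).
    by rewrite mulrAC ler_pdivrMr// ler_wpM2l// ?lerDl// ltW.
  - exact: iter_integral_bound (tS t u).
  - apply: (testfun_eq0 L0 (tS t u)) => y; apply: (test_support tF).
    by rewrite !consv_norm !lt_max; case: tu => ->; rewrite ?orbT.
rewrite -[RHS](int2_rotation L0 tg cs s0).
apply: eq_Rintegral => t _; apply: eq_Rintegral => u _.
by congr iter_integral; apply/funext => y; rewrite rotv_consv.
Qed.

(** A rotation of the first two coordinates splits the pole into the right first coordinate and a
    multiple of the next basis vector; by induction the tail is then turned into the direction of
    [tailv u]. If the tail vanishes, the identity or a flip does it. *)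
Lemma good_orth_transitive n (u : 'rV[R]_n.+1) : dotp u u = 1 ->
  exists A B, good_orth A B /\ A (consv 1 0) = u.
Proof.
have base m (v : 'rV[R]_m.+1) : dotp v v = 1 -> tailv v = 0 ->
    exists A B, good_orth A B /\ A (consv 1 0) = v.
  move=> + v0; rewrite (consv_eta v) -/(tailv v) v0 dotp_consv dotp0r addr0.
  rewrite -expr2 => /eqP; rewrite sqrf_eq1 => /orP[]/eqP ->.
    by exists id, id; split=> //; exact: good_orth_id.
  by exists (@flipv _), (@flipv _); split; [exact: good_orth_flip|rewrite flipv_consv].
elim: n u => [|n IH] u uu; first by apply: base => //; apply/rowP => -[].
have [y0|y0] := eqVneq (tailv u) 0; first exact: base.
have [A [B [gA EA]]] := IH _ ((enorm1P _).1 (enorm_normalize y0)).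
have s0 : enorm (tailv u) != 0 by rewrite enorm_eq0.
have cs : u 0 0 ^+ 2 + enorm (tailv u) ^+ 2 = 1.
  by rewrite sqr_enorm -uu [in RHS](consv_eta u) dotp_consv.
exists (liftv A \o rotv (u 0 0) (enorm (tailv u))),
  (rotv (u 0 0) (- enorm (tailv u)) \o liftv B); split.
  by apply: good_orth_comp; [exact: good_orth_lift|exact: good_orth_rot].
rewrite /= -(consv00 n) rotv_consv liftv_consv !mulr0 !mulr1 subr0 addr0 [RHS]consv_eta; congr consv.
rewrite -/(tailv u) -[RHS](scalerKV s0) -EA -(orthZ (proj1 gA)); congr (A _).
by rewrite consvZ mulr1 scaler0.
Qed.

(** When [i] is not the first index the flip fixes the pole; this is what forces the image of a
    point over the pole to be radial. *)
Lemma good_orth_flip_coord n (i : 'I_n) : exists A B : 'rV[R]_n -> 'rV[R]_n,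
  good_orth A B /\ forall x j, A x 0 j = if j == i then - x 0 j else x 0 j.
Proof.
elim: n i => [[//]|n IH] i; case: (unliftP 0 i) => [i' ->|->].
  have [A [B [gA EA]]] := IH i'; exists (liftv A), (liftv B).
  split; first exact: good_orth_lift.
  move=> x j; case: (unliftP 0 j) => [j' ->|->]; last by rewrite consv0.
  by rewrite consvS EA mxE (inj_eq lift_inj).
exists (@flipv _), (@flipv _); split; first exact: good_orth_flip.
move=> x j; case: (unliftP 0 j) => [j' ->|->]; last by rewrite consv0.
by rewrite consvS mxE.
Qed.

End Euclidean.

(** * Rotation invariance of the integral over the sphere *)

Section SphereIntegral.
Context {R : realType}.
Notation mu := (@lebesgue_measure R).

Lemma iter_integral_ge0 n (F : 'rV[R]_n -> R) : (forall x, 0 <= F x) -> 0 <= iter_integral F.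
Proof.
elim: n F => [|n IH] F F0; first exact: F0.
by rewrite iter_integralS; apply: Rintegral_ge0 => t _; apply: IH => y.
Qed.

(** Dominated convergence, one variable at a time. The limit [F] may be discontinuous, which is the
    case for the integrand of the sphere integral. *)
Lemma iter_integral_cvg n L C (G : nat -> 'rV[R]_n -> R) F : 0 <= L ->
  (forall k, testfun L C (G k)) -> (forall x, G k x @[k --> \oo] --> F x) ->
  iter_integral (G k) @[k --> \oo] --> iter_integral F.
Proof.
move=> L0; elim: n G F => [|n IH] G F tG GF; first exact: GF.
pose p k t := iter_integral (fun y : 'rV[R]_n => G k (consv t y)).
pose q t := iter_integral (fun y : 'rV[R]_n => F (consv t y)).
set D := C * (2 * L) ^+ n.
have pq t : p k t @[k --> \oo] --> q t.
  by apply: IH => [k|y]; [exact: testfun_slice (tG k)|exact: GF].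
have P k := iter_integral_param L0 (tG k).
have mp k : measurable_fun setT (p k) by have [/ucont_measurable] := P k.
have mq : measurable_fun setT q.
  by apply: (@measurable_realfun.measurable_fun_cvg _ _ _ _ p) => // t _; exact: pq.
have pD k t : `|p k t| <= D by have [_ + _] := P k; exact.
have pL k t : L < `|t| -> p k t = 0 by have [_ _ +] := P k; exact.
have qL t : L < `|t| -> q t = 0.
  move=> tL; apply: (cvg_unique _ (pq t)) => //=.
  rewrite (_ : p^~ t = cst 0); first exact: cvg_cst.
  by apply/funext => k; exact: pL.
pose I : set (measurableTypeR R) := `[- L, L]%classic.
have mI : measurable I by exact: measurable_itv.
have supp (g : R -> R) : (forall t, L < `|t| -> g t = 0) ->
    \int[mu]_(t in setT) g t = \int[mu]_(t in I) g t.
  by move=> gL; apply: Rintegral_support => t; rewrite -ler_norml -ltNge; exact: gL.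
have fin : (mu I < +oo)%E.
  by apply: (le_lt_trans (y := (2 * L)%:E)); [rewrite -mu_itv|exact: ltry].
have intD : mu.-integrable I (EFin \o cst D).
  apply: measurable_bounded_integrable => //.
  by exists `|D|; split; [exact: num_real|move=> M CM t _; exact: ltW].
have mp' k : measurable_fun I (fun t => (p k t)%:E).
  by apply/measurable_EFinP; exact: measurable_funS (mp k).
have mq' : measurable_fun I (fun t => (q t)%:E).
  by apply/measurable_EFinP; exact: measurable_funS mq.
have pq' : {ae mu, forall t, I t -> (p k t)%:E @[k --> \oo] --> (q t)%:E}.
  by apply: aeW => t _; apply: cvg_EFin; [exact: nearW|exact: pq].
have pD' : {ae mu, forall t k, I t -> (`|(p k t)%:E| <= (EFin \o cst D) t)%E}.
  by apply: aeW => t k _; rewrite /= lee_fin.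
have [iq _ cq] := dominated_convergence mI mp' mq' pq' intD pD'.
rewrite iter_integralS supp//.
rewrite (_ : (fun k => _) = (fun k => \int[mu]_(t in I) p k t)); last first.
  by apply/funext => k; rewrite iter_integralS supp//; exact: pL.
apply: (@fine_cvg _ _ _ _ (fun k => \int[mu]_(t in I) (p k t)%:E)%E).
rewrite fineK; first exact: cq.
exact: integrable_fin_num.
Qed.

(* The integrands extend smooth data given near the sphere, so nothing is known about
   them at other points. *)
Definition sphere_cont n (phi : 'rV[R]_n -> R) := exists psi : 'rV[R]_n -> R,
  forall u, enorm u = 1 -> phi u = psi u /\ {for u, continuous psi}.

(* The integrand of [sphere_integral] jumps at the origin and on the unit sphere; cut off
   by [ramp k \o enorm] it becomes a test function. *)
Definition ramp (k : nat) (r : R) : R :=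
  Num.max 0 (Num.min 1 (Num.min (k.+1%:R * r - 1) (k.+1%:R * (1 - r)))).

Lemma ramp_out k r : r <= k.+1%:R^-1 \/ 1 <= r -> ramp k r = 0.
Proof.
move=> h; apply/max_idPl; rewrite !ge_min; apply/orP; right; apply/orP.
have k0 : 0 < k.+1%:R :> R by rewrite ltr0n.
case: h => h; [left|right].
  by rewrite subr_le0 -ler_pdivlMl// mulr1.
by rewrite pmulr_rle0// subr_le0.
Qed.

Lemma ramp_bound k r : 0 <= ramp k r <= 1.
Proof. by rewrite le_max lexx/= ge_max ler01 ge_min lexx. Qed.

Lemma ramp_one k r : 0 < r < 1 -> 2 / Num.min r (1 - r) <= k.+1%:R -> ramp k r = 1.
Proof.
move=> /andP[r0 r1]; have m0 : 0 < Num.min r (1 - r) by rewrite lt_min r0 subr_gt0.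
rewrite ler_pdivrMr// => h; have k0 : 0 < k.+1%:R :> R by rewrite ltr0n.
have h1 : 2 <= k.+1%:R * r.
  by rewrite (le_trans h)// ler_pM2l// ge_min lexx.
have h2 : 2 <= k.+1%:R * (1 - r).
  by rewrite (le_trans h)// ler_pM2l// ge_min lexx orbT.
rewrite /ramp (min_idPl _) ?(max_idPr _)// le_min; apply/andP; split; lra.
Qed.

Lemma ramp_continuous k : continuous (ramp k).
Proof.
move=> r; rewrite /continuous_at; apply: (@continuous_max R R (cst 0) (fun r => Num.min 1
    (Num.min (k.+1%:R * r - 1) (k.+1%:R * (1 - r))))); first exact: cst_continuous.
rewrite /prop_for /continuous_at; apply: (@continuous_min R R (cst 1) (fun r =>
    Num.min (k.+1%:R * r - 1) (k.+1%:R * (1 - r)))); first exact: cst_continuous.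
rewrite /prop_for /continuous_at; apply: (@continuous_min R R (fun r => k.+1%:R * r - 1) (fun r => k.+1%:R * (1 - r))).
  apply: continuousB; last exact: cst_continuous.
  by apply: continuousM; [exact: cst_continuous|exact: cvg_id].
apply: continuousM; first exact: cst_continuous.
by apply: continuousB; [exact: cst_continuous|exact: cvg_id].
Qed.

Definition ramped n (psi : 'rV[R]_n -> R) (k : nat) (x : 'rV[R]_n) : R :=
  ramp k (enorm x) * psi ((enorm x)^-1 *: x).

(** At the origin the sphere integrand takes the value [phi 0], since the inverse of 0 is 0. The
    bump equals 1 there and concentrates on a null set, so it corrects the pointwise limit without
    changing the limit of the integrals. *)
Definition bump n (k : nat) (x : 'rV[R]_n) : R := Num.max 0 (1 - k.+1%:R * enorm x).

Lemma sphere_bounded n (psi : 'rV[R]_n -> R) :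
  (forall u, enorm u = 1 -> {for u, continuous psi}) ->
  exists C : R, forall u, enorm u = 1 -> `|psi u| <= C.
Proof.
move=> cpsi; pose S : set 'rV[R]_n := [set u | enorm u = 1].
have cS : compact S.
  apply: bounded_closed_compact.
    exists 1; split; first exact: num_real.
    move=> M M1 u Su; apply: le_trans (norm_le_enorm u) _; rewrite Su; exact: ltW.
  apply: (@closed_comp _ _ (@enorm R n) [set r | r = 1]).
    by move=> x _; exact: continuous_enorm.
  exact: closed_eq.
have [[u0 Su0]|S0] := pselect (S !=set0); last first.
  by exists 0 => u Su; exfalso; apply: S0; exists u.
have cN : {within S, continuous (fun u => `|psi u|)}.
  apply: continuous_in_subspaceT => u; rewrite inE => Su.
  by apply: continuous_comp; [exact: cpsi|exact: norm_continuous].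
have [c _ hc] := compact_EVT_max (ex_intro _ u0 Su0) cS cN.
by exists `|psi c| => u Su; apply: hc; rewrite inE.
Qed.

(** The normalization [x / |x|] is discontinuous only at the origin, near which the ramp vanishes;
    the ramp also vanishes outside the unit ball. *)
Lemma testfun_ramped n (psi : 'rV[R]_n -> R) (C : R) k :
  (forall u, enorm u = 1 -> {for u, continuous psi}) ->
  (forall u, enorm u = 1 -> `|psi u| <= C) -> 0 <= C -> testfun 1 C (ramped psi k).
Proof.
move=> cpsi bC C0.
have s1 x : 1 < `|x| -> ramped psi k x = 0.
  move=> x1; rewrite /ramped ramp_out ?mul0r//; right.
  by rewrite (le_trans (ltW x1))// norm_le_enorm.
split=> // [|x]; last first.
  rewrite /ramped normrM; have /andP[r0 r1] := ramp_bound k (enorm x).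
  have [->|x0] := eqVneq x 0.
    by rewrite enorm0 ramp_out ?normr0 ?mul0r//; left; rewrite invr_ge0.
  rewrite (ger0_norm r0) (le_trans (ler_wpM2l r0 (bC _ (enorm_normalize x0))))//.
  by rewrite ler_piMl.
apply: (heine_cantor (L := 1)) => // x.
have [->|x0] := eqVneq x 0.
  have k0 : 0 < (k.+1%:R : R)^-1 by rewrite invr_gt0 ltr0n.
  have : \forall y \near (0 : 'rV[R]_n), ramped psi k y = 0.
    have := @continuous_enorm R n 0; rewrite /continuous_at enorm0.
    move=> /cvgr_lt/(_ _ k0); apply: filterS => y yk.
    by rewrite /ramped ramp_out ?mul0r//; left; exact: ltW.
  move=> h; rewrite /continuous_at (nbhs_singleton h).
  exact: (cvg_near_cst 0 h).
have n0 := enorm_gt0 x0.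
apply: (@continuousM _ _ (fun x => ramp k (enorm x))
    (fun x => psi ((enorm x)^-1 *: x))).
  by apply: continuous_comp; [exact: continuous_enorm|exact: ramp_continuous].
apply: (@continuous_comp _ _ _ (fun x => (enorm x)^-1 *: x) psi).
  apply: (@continuousZ _ _ _ (fun x => (enorm x)^-1) (fun x => x)).
    by apply: (@continuousV _ _ (@enorm R n)); [rewrite gt_eqF|exact: continuous_enorm].
  exact: cvg_id.
exact: cpsi (enorm_normalize x0).
Qed.

Lemma testfun_bump n k : testfun (n := n) (k.+1%:R^-1) 1 (bump k).
Proof.
have k0 : 0 < k.+1%:R :> R by rewrite ltr0n.
have s1 (x : 'rV[R]_n) : k.+1%:R^-1 < `|x| -> bump k x = 0.
  move=> xk; apply/max_idPl; rewrite subr_le0 -ler_pdivrMl// mulr1.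
  by rewrite (le_trans (ltW xk))// norm_le_enorm.
split=> // [|x]; last first.
  rewrite ger0_norm ?le_max ?lexx// ge_max ler01 gerBl mulr_ge0 ?enorm_ge0//.
apply: heine_cantor s1 => x.
rewrite /continuous_at; apply: (@continuous_max R _ (cst 0) (fun x => 1 - k.+1%:R * enorm x)).
  exact: cst_continuous.
apply: continuousB; first exact: cst_continuous.
by apply: continuousM; [exact: cst_continuous|exact: continuous_enorm].
Qed.

Lemma bump_integral_cvg0 n :
  iter_integral (bump k : 'rV[R]_n.+1 -> R) @[k --> \oo] --> (0 : R).
Proof.
apply/cvgrPdist_le => e e0; near=> k; rewrite sub0r normrN.
have k1 : (0 : R) <= k.+1%:R^-1 by rewrite invr_ge0.
rewrite (le_trans (iter_integral_bound k1 (testfun_bump n.+1 k)))// mul1r.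
(* A base at most [min e 1] has all its positive powers at most [e], whatever the dimension. *)
have kN : k.+1%:R^-1 <= 2^-1 * Num.min e 1 :> R.
  apply: ltW; near: k.
  have e1 : 0 < 2^-1 * Num.min e 1 by rewrite mulr_gt0// lt_min e0 ltr01.
  exact: (near_infty_natSinv_lt (PosNum e1)).
have h : 2 * k.+1%:R^-1 <= Num.min e 1 by rewrite -ler_pdivlMl.
have h0 : (0 : R) <= 2 * k.+1%:R^-1 by rewrite mulr_ge0.
rewrite exprS (@le_trans _ _ (Num.min e 1 * 1))//; last by rewrite mulr1 ge_min lexx.
rewrite ler_pM ?exprn_ge0// exprn_ile1// (le_trans h)// ge_min lexx orbT.
Unshelve. all: by end_near. Qed.

Definition sphere_integrand n (phi : 'rV[R]_n -> R) (x : 'rV[R]_n) : R :=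
  if enorm x < 1 then phi ((enorm x)^-1 *: x) else 0.

(** Adding [phi 0] times the bump makes the pointwise convergence hold at the origin too; dominated
    convergence applies, and the integral of the bump tends to 0. *)
Lemma ramped_cvg n (phi psi : 'rV[R]_n.+1 -> R) :
  (forall u, enorm u = 1 -> phi u = psi u /\ {for u, continuous psi}) ->
  iter_integral (ramped psi k) @[k --> \oo] --> iter_integral (sphere_integrand phi).
Proof.
move=> h; have cpsi u : enorm u = 1 -> {for u, continuous psi} by move=> /h[].
have [C' bC'] := sphere_bounded cpsi; pose C := Num.max C' 0.
have C0 : 0 <= C by rewrite le_max lexx orbT.
have bC u : enorm u = 1 -> `|psi u| <= C.
  by move=> /bC' hu; rewrite (le_trans hu)// le_max lexx.
have tr k := testfun_ramped k cpsi bC C0.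
have tb k : testfun 1 1 (bump k : 'rV[R]_n.+1 -> R).
  have [u1 u2 u3] := testfun_bump n.+1 k; split=> // x x1; apply: u3.
  by rewrite (le_lt_trans _ x1)// invf_le1 ?ltr0n// ler1n.
have tG k := testfun_comb (phi 0) (tr k) (tb k).
have : iter_integral (fun x => ramped psi k x + phi 0 * bump k x) @[k --> \oo]
    --> iter_integral (sphere_integrand phi).
  apply: (iter_integral_cvg ler01 tG) => x.
  have [->|x0] := eqVneq x 0.
    rewrite /sphere_integrand /ramped /bump enorm0 ltr01 scaler0.
    rewrite (_ : (fun k => _) = cst (phi 0)); first exact: cvg_cst.
    apply/funext => k; rewrite ramp_out ?mul0r ?add0r; last by left; rewrite invr_ge0.
    by rewrite mulr0 subr0 (max_idPr _)// mulr1.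
  have n0 := enorm_gt0 x0.
  have near_bump : \forall k \near \oo, bump k x = 0.
    near=> k; apply/max_idPl; rewrite subr_le0 -ler_pdivrMr// mul1r.
    rewrite -[leRHS]invrK lef_pV2 ?posrE ?invr_gt0 ?ltr0n//.
    by apply: ltW; near: k; exact: (near_infty_natSinv_lt (PosNum n0)).
  apply: cvg_near_cst; rewrite /sphere_integrand; case: ifPn => [x1|].
    have m0 : 0 < Num.min (enorm x) (1 - enorm x) by rewrite lt_min n0 subr_gt0.
    have m2 : 0 < Num.min (enorm x) (1 - enorm x) / 2 by rewrite divr_gt0.
    near=> k.
    have -> : bump k x = 0 by near: k.
    rewrite mulr0 addr0 /ramped ramp_one ?n0//; first by rewrite mul1r (h _ (enorm_normalize x0)).1.
    rewrite -[2 / _]invf_div -[leRHS]invrK lef_pV2 ?posrE ?invr_gt0 ?ltr0n//.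
    apply: ltW; near: k; exact: (near_infty_natSinv_lt (PosNum m2)).
  rewrite -leNgt => x1; near=> k.
  have -> : bump k x = 0 by near: k.
  by rewrite mulr0 addr0 /ramped ramp_out ?mul0r//; right.
rewrite (_ : (fun k => _) = (fun k => iter_integral (ramped psi k) +
    phi 0 * iter_integral (bump k : 'rV[R]_n.+1 -> R))); last first.
  by apply/funext => k; exact: iter_integral_comb ler01 (tr k) (tb k).
move=> H.
have B : phi 0 * iter_integral (bump k : 'rV[R]_n.+1 -> R) @[k --> \oo] --> (0 : R).
  by rewrite -(mulr0 (phi 0)); apply: cvgMl_tmp; exact: bump_integral_cvg0.
rewrite -[X in _ --> X]subr0 (_ : (fun k => _) = (fun k => (iter_integral (ramped psi k)
  + phi 0 * iter_integral (bump k : 'rV[R]_n.+1 -> R)) -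
  phi 0 * iter_integral (bump k : 'rV[R]_n.+1 -> R))); first exact: cvgB H B.
by apply/funext => k; rewrite addrK.
Unshelve. all: by end_near. Qed.

Lemma sphere_integralE n (phi : 'rV[R]_n -> R) :
  sphere_integral phi = n%:R * iter_integral (sphere_integrand phi).
Proof. by []. Qed.

(** The integrands may differ at the origin, but both integrals are limits of the same ramped
    integrals, which see [psi] on the sphere only. *)
Lemma sphere_integral_ext n (phi phi' : 'rV[R]_n.+1 -> R) : sphere_cont phi ->
  (forall u, enorm u = 1 -> phi u = phi' u) ->
  sphere_integral phi = sphere_integral phi'.
Proof.
move=> [psi h] E; rewrite !sphere_integralE; congr (_ * _).
have h' u : enorm u = 1 -> phi' u = psi u /\ {for u, continuous psi}.
  by move=> u1; rewrite -E//; exact: h.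
exact: cvg_unique (ramped_cvg h) (ramped_cvg h').
Qed.

Lemma sphere_integral_cst n (c : R) : sphere_integral (fun _ : 'rV[R]_n.+1 => c) =
  c * sphere_integral (fun _ : 'rV[R]_n.+1 => 1).
Proof.
rewrite !sphere_integralE mulrCA; congr (_ * _).
have C d (u : 'rV[R]_n.+1) : enorm u = 1 -> d = d :> R /\ {for u, continuous (fun=> d)}.
  by move=> _; split=> //; exact: cst_continuous.
have H1 := ramped_cvg (C 1); have Hc := ramped_cvg (C c).
apply: (cvg_unique _ Hc) => //.
rewrite (_ : (fun k => _) = (fun k =>
    c * iter_integral (ramped (fun _ : 'rV[R]_n.+1 => 1) k))).
  by apply: cvgMl_tmp; exact: H1.
apply/funext => k.
have t1 : testfun 1 1 (ramped (fun _ : 'rV[R]_n.+1 => 1) k).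
  by apply: testfun_ramped => // [u _|u _]; [exact: cst_continuous|rewrite normr1].
(* [c] is split as [1 + (c - 1)] to fit the shape of [iter_integral_comb]. *)
transitivity (iter_integral (ramped (fun _ : 'rV[R]_n.+1 => 1) k) +
  (c - 1) * iter_integral (ramped (fun _ : 'rV[R]_n.+1 => 1) k)); last by ring.
rewrite -(iter_integral_comb (c - 1) ler01 t1 t1).
by congr iter_integral; apply/funext => x; rewrite /ramped; ring.
Qed.

Lemma sphere_integral_ge0 n (phi : 'rV[R]_n -> R) : (forall u, 0 <= phi u) ->
  0 <= sphere_integral phi.
Proof.
move=> h; rewrite sphere_integralE mulr_ge0// iter_integral_ge0// => x.
by rewrite /sphere_integrand; case: ifP.
Qed.

(** Orthogonal maps preserve [enorm] and commute with normalization, so ramping commutes with [A],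
    and invariance is needed for test functions only. *)
Lemma sphere_integral_orth n (A B : 'rV[R]_n.+1 -> 'rV[R]_n.+1) phi :
  good_orth A B -> sphere_cont phi -> sphere_integral (phi \o A) = sphere_integral phi.
Proof.
move=> [oA iA] [psi h]; rewrite !sphere_integralE; congr (_ * _).
have h' u : enorm u = 1 -> (phi \o A) u = (psi \o A) u /\ {for u, continuous (psi \o A)}.
  move=> u1; have Au : enorm (A u) = 1 by rewrite (orth_enorm oA).
  have [E c] := h _ Au; split=> //.
  by apply: continuous_comp => //; exact: blin_continuous (blin_orth oA) _.
apply: (cvg_unique _ (ramped_cvg h')) => //.
rewrite (_ : (fun k => _) = (fun k => iter_integral (ramped psi k))).
  exact: ramped_cvg h.
apply/funext => k.
have cpsi u : enorm u = 1 -> {for u, continuous psi} by move=> /h[].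
have [C' bC'] := sphere_bounded cpsi; pose C := Num.max C' 0.
have C0 : 0 <= C by rewrite le_max lexx orbT.
have bC u : enorm u = 1 -> `|psi u| <= C.
  by move=> /bC' hu; rewrite (le_trans hu)// le_max lexx.
rewrite -(iA _ _ _ ler01 (testfun_ramped k cpsi bC C0)).
congr iter_integral; apply/funext => x.
by rewrite /ramped /= (orth_enorm oA) -(orthZ oA).
Qed.

End SphereIntegral.

(** * Frames and independence of the choice of frame *)

Section Frames.
Context {R : realType}.

(** The matrix [E] of rows [b i] satisfies [E *m E^T = 1], hence also [E^T *m E = 1], which is the
    expansion. *)
Lemma onb_expand m (b : 'I_m -> 'rV[R]_m) :
  (forall i j, dotp (b i) (b j) = (i == j)%:R) ->
  forall x, x = \sum_i dotp x (b i) *: b i.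
Proof.
move=> ob x; pose E := \matrix_(i, k) b i 0 k.
have EE : E *m E^T = 1%:M.
  by apply/matrixP => i j; rewrite !mxE -ob; apply: eq_bigr => k _; rewrite !mxE.
rewrite -[LHS]mulmx1 -(mulmx1C EE) mulmxA mulmx_sum_row; apply: eq_bigr => i _.
congr (_ *: _); last by apply/rowP => k; rewrite !mxE.
by rewrite mxE; apply: eq_bigr => k _; rewrite !mxE.
Qed.

Section Bilinear.
Context {n : nat}.
Local Notation V := (cspace R n).

Definition ip (v w : V) : R := v.1 * w.1 + dotp v.2 w.2.

Definition bilin (b : V -> V -> R) :=
  (forall k v v' w, b (k *: v + v') w = k * b v w + b v' w) /\
  (forall k v w w', b v (k *: w + w') = k * b v w + b v w').

Lemma bilin_sum (b : V -> V -> R) m (k l : 'I_m -> R) (v w : 'I_m -> V) : bilin b ->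
  b (\sum_i k i *: v i) (\sum_j l j *: w j) = \sum_i \sum_j k i * l j * b (v i) (w j).
Proof.
move=> [b1 b2].
have b10 w' : b 0 w' = 0.
  by have := b1 1 0 0 w'; rewrite scale1r addr0 mul1r => /eqP; rewrite -subr_eq subrr => /eqP.
have b20 v' : b v' 0 = 0.
  by have := b2 1 v' 0 0; rewrite scale1r addr0 mul1r => /eqP; rewrite -subr_eq subrr => /eqP.
have s1 w' : b (\sum_i k i *: v i) w' = \sum_i k i * b (v i) w'.
  by elim/big_rec2: _ => [//|i y x _ <-]; rewrite b1.
have s2 v' : b v' (\sum_j l j *: w j) = \sum_j l j * b v' (w j).
  by elim/big_rec2: _ => [//|i y x _ <-]; rewrite b2.
rewrite s1; apply: eq_bigr => i _; rewrite s2 mulr_sumr.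
by apply: eq_bigr => j _; rewrite mulrA.
Qed.

Definition frame (q : V) (e : 'I_n -> V) :=
  (forall i, cyl_tangent q (e i)) /\ forall i j, ip (e i) (e j) = (i == j)%:R.

(** A frame together with the normal direction [q.2] is an orthonormal basis of the whole space, and
    a tangent vector has no component along [q.2]. *)
Lemma frame_expand q e : enorm q.2 = 1 -> frame q e ->
  forall v, cyl_tangent q v -> v = \sum_i ip v (e i) *: e i.
Proof.
move=> q1 [te oe] v tv.
pose b (i : 'I_n.+1) : 'rV[R]_n.+1 :=
  if unlift ord0 i is Some j then consv (e j).1 (e j).2 else consv 0 q.2.
have b0 : b 0 = consv 0 q.2 by rewrite /b unlift_none.
have bS i : b (lift 0 i) = consv (e i).1 (e i).2 by rewrite /b liftK.
have ob i j : dotp (b i) (b j) = (i == j)%:R.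
  case: (unliftP 0 i) => [i' ->|->]; case: (unliftP 0 j) => [j' ->|->].
  - by rewrite !bS dotp_consv (inj_eq lift_inj) -oe.
  - by rewrite b0 bS dotp_consv mulr0 add0r dotpC te.
  - by rewrite b0 bS dotp_consv mul0r add0r te.
  - by rewrite b0 dotp_consv mulr0 add0r (enorm1P _).1// eqxx.
have := onb_expand ob (consv v.1 v.2).
rewrite big_ord_recl b0 dotp_consv mulr0 add0r dotpC tv scale0r add0r.
have S (k : 'I_n -> R) : \sum_i k i *: consv (e i).1 (e i).2 =
    consv (\sum_i k i *: e i).1 (\sum_i k i *: e i).2.
  elim/big_rec2: _ => [|i y x _ ->]; first by rewrite consv00.
  by rewrite consvZD.
under eq_bigr => i _ do rewrite bS dotp_consv -/(ip v (e i)).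
rewrite S => /consv_inj[E1 E2].
by rewrite [LHS]surjective_pairing E1 E2 -surjective_pairing.
Qed.

Definition formmx (b : V -> V -> R) (e : 'I_n -> V) : 'M[R]_n := \matrix_(i, j) b (e i) (e j).

Lemma formmx_change q e e' : enorm q.2 = 1 -> frame q e -> frame q e' ->
  exists Q : 'M[R]_n, Q *m Q^T = 1%:M /\
    forall b, bilin b -> formmx b e' = Q *m formmx b e *m Q^T.
Proof.
move=> q1 fe fe'; pose Q := \matrix_(i, j) ip (e' i) (e j).
have E i : e' i = \sum_j Q i j *: e j.
  rewrite {1}(frame_expand q1 fe (proj1 fe' i)).
  by apply: eq_bigr => j _; rewrite mxE.
have F b : bilin b -> formmx b e' = Q *m formmx b e *m Q^T.
  move=> bb; apply/matrixP => i j; rewrite mxE !E (bilin_sum _ _ _ _ bb) !mxE.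
  rewrite exchange_big; apply: eq_bigr => k _ /=; rewrite !mxE mulr_suml.
  by apply: eq_bigr => l _; rewrite !mxE; ring.
exists Q; split=> //.
(* Orthogonality of [Q] is the change of frame formula applied to [ip], whose matrix is the identity
   in both frames. *)
have bip : bilin ip.
  have sE (k x : R) : k *: x = k * x by [].
  by split=> k v v' w; rewrite /ip/= !sE ?dotpDl ?dotpDr ?dotpZl ?dotpZr; ring.
have I e0 : frame q e0 -> formmx ip e0 = 1%:M.
  by move=> [_ o]; apply/matrixP => i j; rewrite !mxE o.
by have := F _ bip; rewrite !I// mulmx1.
Qed.

Lemma trace_form_frame q e e' b1 b2 : enorm q.2 = 1 -> frame q e -> frame q e' ->
  bilin b1 -> bilin b2 ->
  \tr (formmx b1 e' *m invmx (formmx b2 e')) = \tr (formmx b1 e *m invmx (formmx b2 e)).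
Proof.
move=> q1 fe fe' h1 h2; have [Q [QQ F]] := formmx_change q1 fe fe'.
have QQ' := mulmx1C QQ.
rewrite !F//; set A := formmx b1 e; set B := formmx b2 e.
have uQ : Q \in unitmx by case: (mulmx1_unit QQ).
have uQT : Q^T \in unitmx by case: (mulmx1_unit QQ).
have iQ : invmx Q = Q^T by rewrite -[LHS]mulmx1 -QQ mulmxA mulVmx// mul1mx.
have -> : invmx (Q *m B *m Q^T) = Q *m invmx B *m Q^T.
  have [uB|uB] := boolP (B \in unitmx).
    have uQB : Q *m B *m Q^T \in unitmx by rewrite !unitmx_mul uQ uB.
    apply: (can_inj (mulKmx uQB)); rewrite mulmxV//.
    by rewrite !mulmxA -[_ *m Q^T *m Q]mulmxA QQ' mulmx1 -[_ *m B *m _]mulmxA mulmxV// mulmx1.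
  (* On a singular matrix [invmx] is the identity, and conjugation by [Q] preserves singularity, so
     the formula survives. *)
  rewrite /invmx (negbTE uB) !unitmx_mul uQ uQT (negbTE uB)//=.
rewrite !mulmxA -[_ *m Q^T *m Q]mulmxA QQ' mulmx1 mxtrace_mulC !mulmxA QQ' mul1mx.
by [].
Qed.

Lemma det_form_frame q e e' b : enorm q.2 = 1 -> frame q e -> frame q e' ->
  bilin b -> \det (formmx b e') = \det (formmx b e).
Proof.
move=> q1 fe fe' hb; have [Q [QQ F]] := formmx_change q1 fe fe'.
rewrite F// !det_mulmx mulrAC -det_mulmx QQ det1 mul1r//.
Qed.

Lemma form_diag b1 b2 e : (forall i j, i != j -> b2 (e i) (e j) = 0) ->
  (forall i, b2 (e i) (e i) != 0) ->
  \tr (formmx b1 e *m invmx (formmx b2 e)) = \sum_i b1 (e i) (e i) / b2 (e i) (e i)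
  /\ \det (formmx b2 e) = \prod_i b2 (e i) (e i).
Proof.
move=> od d0; pose d := \row_i b2 (e i) (e i).
have E : formmx b2 e = diag_mx d.
  by apply/matrixP => i j; rewrite !mxE; have [->|/od] := eqVneq i j; rewrite ?mulr1n ?mulr0n.
have D : \det (formmx b2 e) = \prod_i b2 (e i) (e i).
  by rewrite E det_diag; apply: eq_bigr => i _; rewrite mxE.
split=> //; have u : formmx b2 e \in unitmx.
  by rewrite unitmxE D unitfE; apply/prodf_neq0 => i _.
have -> : invmx (formmx b2 e) = diag_mx (\row_i (b2 (e i) (e i))^-1).
  apply: (can_inj (mulKmx u)); rewrite mulmxV// E.
  apply/matrixP => i j; rewrite mul_diag_mx !mxE.
  by have [->|ij] := eqVneq i j; rewrite ?mulr1n ?divff// ?mulr0n mulr0.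
rewrite /mxtrace; apply: eq_bigr => i _.
by rewrite mul_mx_diag !mxE.
Qed.

End Bilinear.

(** A frame adapted to rotational symmetry: the axial direction first, then the images of the
    standard basis vectors orthogonal to the pole under a rotation taking the pole to [q.2]. *)
Lemma frame_exists n (q : cspace R n.+1) : enorm q.2 = 1 ->
  exists e : 'I_n.+1 -> cspace R n.+1, [/\ frame q e, e 0 = (1, 0) &
    forall i, (e (lift 0 i)).1 = 0].
Proof.
move=> /enorm1P q1; have [A [B [[oA _] EA]]] := good_orth_transitive q1.
pose c (i : 'I_n) : 'rV[R]_n.+1 := consv 0 (delta_mx 0 i).
have dd (i j : 'I_n) : dotp (delta_mx 0 i : 'rV[R]_n) (delta_mx 0 j) = (i == j)%:R.
  rewrite /dotp (bigD1 i)//= !mxE !eqxx mul1r big1 ?addr0// => k ki.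
  by rewrite !mxE (negbTE ki) mul0r.
pose e (i : 'I_n.+1) : cspace R n.+1 :=
  if unlift ord0 i is Some j then (0, A (c j)) else (1, 0).
have e0 : e 0 = (1, 0) by rewrite /e unlift_none.
have eS i : e (lift 0 i) = (0, A (c i)) by rewrite /e liftK.
exists e; split=> // [|i]; last by rewrite eS.
split=> [i|i j].
  rewrite /cyl_tangent/=; case: (unliftP 0 i) => [i' ->|->]; last by rewrite e0 dotp0r.
  by rewrite eS -EA (orth_dotp oA) dotp_consv mulr0 add0r dotp0l.
rewrite /ip; case: (unliftP 0 i) => [i' ->|->]; case: (unliftP 0 j) => [j' ->|->].
- by rewrite !eS/= mulr0 add0r (orth_dotp oA) dotp_consv mulr0 add0r dd (inj_eq lift_inj).
- by rewrite e0 eS/= mul0r dotp0r addr0.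
- by rewrite e0 eS/= mulr0 dotp0l addr0.
- by rewrite e0/= mulr1 dotp0l addr0.
Qed.

Lemma cyl_frameP n (q : cspace R n.+1) : enorm q.2 = 1 -> frame q (cyl_frame q).
Proof.
move=> q1; have [e [[te oe] _ _]] := frame_exists q1.
rewrite /cyl_frame; apply: (@xgetPex _ _ [set e : {ffun 'I_n.+1 -> cspace R n.+1} |
    (forall i, cyl_tangent q (e i)) /\
    (forall i j, (e i).1 * (e j).1 + dotp (e i).2 (e j).2 = (i == j)%:R)]).
by exists [ffun i => e i]; split=> [i|i j]; rewrite !ffunE; [exact: te|exact: oe].
Qed.

End Frames.

Section Forms.
Context {R : realType} {n : nat}.
Local Notation V := (cspace R n).
Implicit Types (Y N : V -> V) (p q v w : V).

Lemma scaleRE (k x : R) : k *: x = k * x. Proof. by []. Qed.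

Lemma bilin_rot_metric f h p : bilin (@rot_metric R n f h p).
Proof.
rewrite /rot_metric; case: eqP => _.
  by split=> k v v' w; rewrite /= !scaleRE ?dotpDl ?dotpDr ?dotpZl ?dotpZr; ring.
set x := p.2; set r := enorm x.
have dr k (v v' : V) : dotp x (k *: v + v').2 / r = k * (dotp x v.2 / r) + dotp x v'.2 / r.
  by rewrite /= dotpDr dotpZr mulrDl mulrA.
have du k (v v' : V) : r^-1 *: ((k *: v + v').2 - (dotp x (k *: v + v').2 / r / r) *: x) =
    k *: (r^-1 *: (v.2 - (dotp x v.2 / r / r) *: x)) +
    r^-1 *: (v'.2 - (dotp x v'.2 / r / r) *: x).
  by rewrite dr; apply/rowP => i; rewrite !mxE; ring.
by split=> k v v' w; rewrite !du !dr /= !scaleRE ?dotpDl ?dotpDr ?dotpZl ?dotpZr; ring.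
Qed.

Variable g : V -> V -> V -> R.
Hypothesis bg : forall p, bilin (g p).

Definition gramb Y q v w := g (Y q) ('D_v Y q) ('D_w Y q).
Definition secb Y N q v w :=
  g (Y q) ('D_v N q) ('D_w Y q) + christoffel g (Y q) ('D_v Y q) (N q) ('D_w Y q).

Lemma gramE Y q : gram g Y q = formmx (gramb Y q) (cyl_frame q).
Proof. by []. Qed.
Lemma second_formE Y N q : second_form g Y N q = formmx (secb Y N q) (cyl_frame q).
Proof. by []. Qed.

(** With equal outer arguments the first and third terms cancel. The diagonal is enough when the
    Gram matrix is diagonal. *)
Lemma christoffel_diag p v w : (forall v w, differentiable (fun p => g p v w) p) ->
  (forall p v w, g p v w = g p w v) ->
  christoffel g p v w v = 2^-1 * 'D_w (fun q => g q v v) p.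
Proof.
move=> _ sg; rewrite /christoffel.
have -> : (fun q => g q w v) = (fun q => g q v w) by apply/funext => q.
by rewrite addrAC subrr add0r.
Qed.

Lemma bilin_christoffel p w : (forall v w, differentiable (fun p => g p v w) p) ->
  bilin (fun v y => christoffel g p v w y).
Proof.
move=> dg.
have dd a c v : derivable (fun q => g q a c) p v by apply: diff_derivable; exact: dg.
have D1 k v v' a c : 'D_(k *: v + v') (fun q => g q a c) p =
    k * 'D_v (fun q => g q a c) p + 'D_v' (fun q => g q a c) p.
  by rewrite derive_dirD ?derive_dirZ//; exact: dg.
have D2 v k a a' c : 'D_v (fun q => g q a (k *: c + a')) p =
    k * 'D_v (fun q => g q a c) p + 'D_v (fun q => g q a a') p.
  have -> : (fun q => g q a (k *: c + a')) = (k \*: (fun q => g q a c)) + (fun q => g q a a').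
    by apply/funext => q; rewrite (proj2 (bg q)).
  by rewrite (deriveD (derivableZ (dd a c v)) (dd a a' v)) (deriveZ k (dd a c v)).
have D3 v k a a' c : 'D_v (fun q => g q (k *: c + a') a) p =
    k * 'D_v (fun q => g q c a) p + 'D_v (fun q => g q a' a) p.
  have -> : (fun q => g q (k *: c + a') a) = (k \*: (fun q => g q c a)) + (fun q => g q a' a).
    by apply/funext => q; rewrite (proj1 (bg q)).
  by rewrite (deriveD (derivableZ (dd c a v)) (dd a' a v)) (deriveZ k (dd c a v)).
have aux (k x1 x2 x3 y1 y2 y3 : R) : 2^-1 * (k * x1 + y1 + (k * x2 + y2) - (k * x3 + y3)) =
    k * (2^-1 * (x1 + x2 - x3)) + 2^-1 * (y1 + y2 - y3) by ring.
by split=> k v v' y; rewrite /christoffel ?D1 ?(D2 _ _ _ _) ?D3; exact: aux.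
Qed.

Lemma bilin_gramb Y q : differentiable Y q -> bilin (gramb Y q).
Proof.
move=> dY; split=> k v v' w; rewrite /gramb derive_dirD// derive_dirZ//.
  by rewrite (proj1 (bg _)).
by rewrite (proj2 (bg _)).
Qed.

Lemma secb_aux1 (b c : V -> V -> R) (k : R) (x x' y z z' : V) : bilin b -> bilin c ->
  b (k *: x + x') y + c (k *: z + z') y = k * (b x y + c z y) + (b x' y + c z' y).
Proof. by move=> [-> _] [-> _]; rewrite mulrDr addrACA. Qed.

Lemma secb_aux2 (b c : V -> V -> R) (k : R) (x z y y' : V) : bilin b -> bilin c ->
  b x (k *: y + y') + c z (k *: y + y') = k * (b x y + c z y) + (b x y' + c z y').
Proof. by move=> [_ ->] [_ ->]; rewrite mulrDr addrACA. Qed.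

Lemma bilin_secb Y N q : differentiable Y q -> differentiable N q ->
  (forall v w, differentiable (fun p => g p v w) (Y q)) -> bilin (secb Y N q).
Proof.
move=> dY dN dg; have [c1 c2] := bilin_christoffel (N q) dg.
have bs : bilin (fun a b => christoffel g (Y q) a (N q) b) by split.
split=> k v v' w; rewrite /secb !derive_dirD// !derive_dirZ//.
  exact: secb_aux1 (bg _) bs.
exact: secb_aux2 (bg _) bs.
Qed.

End Forms.

(** * Invariance of area element and mean curvature under orthogonal maps *)

Section Geometry.
Context {R : realType} {n : nat}.
Local Notation V := (cspace R n.+1).
Implicit Types (Y N : V -> V) (p q v w : V).
Variables (f h : R -> R).
Local Notation g := (@rot_metric R n.+1 f h).

Let bg p : bilin (g p). Proof. exact: bilin_rot_metric. Qed.

Lemma mean_curvature_frame Y N q e : enorm q.2 = 1 -> frame q e ->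
  differentiable Y q -> differentiable N q ->
  (forall v w, differentiable (fun p => g p v w) (Y q)) ->
  mean_curvature g Y N q = \tr (formmx (secb g Y N q) e *m invmx (formmx (gramb g Y q) e)).
Proof.
move=> q1 fe dY dN dg; rewrite /mean_curvature gramE second_formE.
exact: trace_form_frame q1 fe (cyl_frameP q1) (bilin_secb bg dY dN dg) (bilin_gramb bg dY).
Qed.

Lemma area_element_frame Y q e : enorm q.2 = 1 -> frame q e -> differentiable Y q ->
  area_element g Y q = Num.sqrt (\det (formmx (gramb g Y q) e)).
Proof.
move=> q1 fe dY; rewrite /area_element gramE; apply: (congr1 Num.sqrt).
exact: (det_form_frame q1 fe (cyl_frameP q1) (bilin_gramb bg dY)).
Qed.

Definition orthV (A : 'rV[R]_n.+1 -> 'rV[R]_n.+1) (p : V) : V := (p.1, A p.2).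

Lemma rot_metric_orth A B p v w : orthmap A B ->
  g (orthV A p) (orthV A v) (orthV A w) = g p v w.
Proof.
move=> o; rewrite /rot_metric /=.
have -> : (A p.2 == 0) = (p.2 == 0) by rewrite -{1}(orth0 o) (can_eq (orthK o)).
rewrite !(orth_dotp o) !(orth_enorm o); case: ifP => // _.
by rewrite -!(orthZ o) -!(orthB o) -!(orthZ o) (orth_dotp o).
Qed.

Lemma derive_affine_eq (U V' W : normedModType R) (phi : U -> V') (F : V' -> W)
    (x u : U) (v : V') :
  (forall h : R, phi (h *: u + x) = h *: v + phi x) -> 'D_u (F \o phi) x = 'D_v F (phi x).
Proof.
move=> hphi; rewrite /derive; set g1 := fun h => h^-1 *: _; set g2 := fun h => h^-1 *: _.
by suff -> : g1 = g2 by []; apply/funext => k; rewrite /g1 /g2/= hphi.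
Qed.

Lemma orthV_lin A B (k : R) v p : orthmap A B ->
  orthV A (k *: v + p) = k *: orthV A v + orthV A p.
Proof. by move=> o; rewrite /orthV /= (orth_lin o). Qed.

Lemma blin_orthV A B : orthmap A B -> blin (orthV A).
Proof.
move=> o; apply: blin_pair; first exact: blin_fst.
exact: (blin_comp (blin_orth o) (@blin_snd _ _ _)).
Qed.

Lemma orthVK A B : orthmap A B -> cancel (orthV A) (orthV B).
Proof. by move=> o [s x]; rewrite /orthV/= (orthK o). Qed.

Lemma christoffel_orth A B p v w y : orthmap A B ->
  christoffel g (orthV A p) (orthV A v) (orthV A w) (orthV A y) = christoffel g p v w y.
Proof.
move=> o; have E u a c : 'D_(orthV A u) (fun q => g q (orthV A a) (orthV A c)) (orthV A p)
    = 'D_u (fun q => g q a c) p.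
  rewrite -(@derive_affine_eq _ _ _ (orthV A) _ p u); last first.
    by move=> k; exact: orthV_lin o.
  have -> // : (fun q => g q (orthV A a) (orthV A c)) \o orthV A = (fun q => g q a c).
  by apply/funext => q; exact: rot_metric_orth o.
by rewrite /christoffel !E.
Qed.

Lemma derive_orthV A B Y q v : orthmap A B -> derivable Y (orthV A q) (orthV A v) ->
  'D_v (orthV B \o Y \o orthV A) q = orthV B ('D_(orthV A v) Y (orthV A q)).
Proof.
move=> o dY.
have D : is_derive q v (Y \o orthV A) ('D_(orthV A v) Y (orthV A q)).
  by apply: (is_derive_affine _ (derivableP dY)) => k; exact: orthV_lin o.
by have [_] := is_derive_blin (blin_orthV (orthmap_sym o)) D.
Qed.

Lemma frame_orth A B q e : orthmap A B -> frame q e -> frame (orthV A q) (orthV A \o e).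
Proof.
move=> o [te oe]; split=> [i|i j].
  by rewrite /cyl_tangent /= (orth_dotp o); exact: te.
by rewrite /ip /= (orth_dotp o); exact: oe.
Qed.

Section Equivariance.
Variables (A B : 'rV[R]_n.+1 -> 'rV[R]_n.+1) (Y N : V -> V) (q : V).
Hypotheses (o : orthmap A B) (q1 : enorm q.2 = 1).
Hypotheses (dY : differentiable Y (orthV A q)) (dN : differentiable N (orthV A q)).
Let Aq1 : enorm (orthV A q).2 = 1. Proof. by rewrite /= (orth_enorm o). Qed.
Let o' := orthmap_sym o.

Lemma gramb_orth v w :
  gramb g (orthV B \o Y \o orthV A) q v w = gramb g Y (orthV A q) (orthV A v) (orthV A w).
Proof.
rewrite /gramb !(derive_orthV o); try exact: diff_derivable.
by rewrite /= (rot_metric_orth _ _ _ o').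
Qed.

Lemma secb_orth v w :
  secb g (orthV B \o Y \o orthV A) (orthV B \o N \o orthV A) q v w =
  secb g Y N (orthV A q) (orthV A v) (orthV A w).
Proof.
have DY u : derivable Y (orthV A q) (orthV A u) by exact: diff_derivable.
have DN u : derivable N (orthV A q) (orthV A u) by exact: diff_derivable.
rewrite /secb (derive_orthV o (DY v)) (derive_orthV o (DN v)) (derive_orthV o (DY w)).
apply: (congr2 +%R); first exact: rot_metric_orth o'.
exact: christoffel_orth o'.
Qed.

Lemma formmx_eq b b' (e e' : 'I_n.+1 -> V) :
  (forall i j, b (e i) (e j) = b' (e' i) (e' j)) -> formmx b e = formmx b' e'.
Proof. by move=> E; apply/matrixP => i j; rewrite !mxE. Qed.

(** [cyl_frame] at the rotated point need not be the rotated [cyl_frame]; independence of the frame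
    bridges the two. *)
Lemma area_element_orth :
  area_element g (orthV B \o Y \o orthV A) q = area_element g Y (orthV A q).
Proof.
rewrite (area_element_frame Aq1 (frame_orth o (cyl_frameP q1)) dY).
rewrite /area_element gramE; apply: (congr1 (fun M => Num.sqrt (\det M))).
by apply: formmx_eq => i j; exact: gramb_orth.
Qed.

Lemma mean_curvature_orth : (forall v w, differentiable (fun p => g p v w) (Y (orthV A q))) ->
  mean_curvature g (orthV B \o Y \o orthV A) (orthV B \o N \o orthV A) q =
  mean_curvature g Y N (orthV A q).
Proof.
move=> dg; rewrite (mean_curvature_frame Aq1 (frame_orth o (cyl_frameP q1)) dY dN dg).
have E1 : second_form g (orthV B \o Y \o orthV A) (orthV B \o N \o orthV A) q =
    formmx (secb g Y N (orthV A q)) (orthV A \o cyl_frame q).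
  rewrite second_formE; apply: formmx_eq => i j; exact: secb_orth.
have E2 : gram g (orthV B \o Y \o orthV A) q =
    formmx (gramb g Y (orthV A q)) (orthV A \o cyl_frame q).
  rewrite gramE; apply: formmx_eq => i j; exact: gramb_orth.
by rewrite /mean_curvature E1 E2.
Qed.

End Equivariance.
End Geometry.

Section CspaceDifferentiable.
Context {R : realType}.

Lemma coordinates_cspace n : exists s, coordinates (V := cspace R n) s.
Proof. by eexists; exact: coordinates_prod (coordinates_R) (coordinates_rV n). Qed.

Lemma smooth_cspace_differentiable n (U : set (cspace R n)) (Y : cspace R n -> cspace R n) q :
  open U -> smooth_on U Y -> U q -> differentiable Y q.
Proof. by have [s cs] := coordinates_cspace n; exact: (smooth_on_differentiable cs cs). Qed.

Lemma smooth_real_differentiable n (U : set (cspace R n)) (F : cspace R n -> R) q :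
  open U -> smooth_on U F -> U q -> differentiable F q.
Proof.
have [s cs] := coordinates_cspace n.
exact: (smooth_on_differentiable cs coordinates_R).
Qed.

End CspaceDifferentiable.

(** * Continuity of the area element along the spheres *)

Section AreaContinuity.
Context {R : realType} {n : nat}.
Local Notation V := (cspace R n.+1).
Variables (f h : R -> R).
Local Notation g := (@rot_metric R n.+1 f h).

Definition cbasis (k : 'I_n.+2) : V :=
  if unlift ord0 k is Some i then (0, delta_mx 0 i) else (1, 0).
Definition ccoord (k : 'I_n.+2) (v : V) : R := consv v.1 v.2 0 k.

Lemma cspace_expand v : v = \sum_k ccoord k v *: cbasis k.
Proof.
have E (k : 'I_n.+1 -> R) : \sum_i k i *: ((0, delta_mx 0 i) : V) = (0, \sum_i k i *: delta_mx 0 i).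
  elim/big_rec2: _ => [//|i y x _ ->].
  by congr pair; rewrite /= scaler0 addr0.
rewrite big_ord_recl /ccoord consv0 /cbasis unlift_none.
under eq_bigr => i _ do rewrite consvS liftK.
rewrite E [LHS]surjective_pairing; congr pair; rewrite /=.
  by rewrite addr0 [RHS]mulr1.
by rewrite scaler0 add0r {1}[v.2]row_sum_delta.
Qed.

(** Expansion in a fixed basis reduces the claim to finitely many continuous coefficients. *)
Lemma continuous_bilin (T : topologicalType) (b : T -> V -> V -> R) (v w : T -> V) p :
  (forall t, bilin (b t)) -> (forall x y, {for p, continuous (fun t => b t x y)}) ->
  {for p, continuous v} -> {for p, continuous w} ->
  {for p, continuous (fun t => b t (v t) (w t))}.
Proof.
move=> bb cb cv cw.
have cc k (u : T -> V) : {for p, continuous u} -> {for p, continuous (fun t => ccoord k (u t))}.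
  move=> cu; apply: (@continuous_comp _ _ _ u (ccoord k)) => //.
  rewrite /ccoord; case: (unliftP 0 k) => [i ->|->].
    rewrite (_ : (fun v => _) = (fun v : V => v.2 0 i)); last first.
      by apply/funext => v'; rewrite consvS.
    exact: (blin_continuous (blin_comp (blin_coord i) (@blin_snd _ _ _))).
  rewrite (_ : (fun v => _) = (fun v : V => v.1)); last first.
    by apply/funext => v'; rewrite consv0.
  exact: (blin_continuous (@blin_fst _ _ _)).
rewrite (_ : (fun t => _) = (fun t => \sum_i \sum_j
    ccoord i (v t) * ccoord j (w t) * b t (cbasis i) (cbasis j))); last first.
  by apply/funext => t; rewrite -bilin_sum// -!cspace_expand.
apply: continuous_at_sum => i; apply: continuous_at_sum => j.
by apply: continuousM => //; apply: continuousM; exact: cc.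
Qed.

Lemma continuous_det m (T : topologicalType) (A : T -> 'M[R]_m) p :
  (forall i j, {for p, continuous (fun t => A t i j)}) ->
  {for p, continuous (fun t => \det (A t))}.
Proof.
move=> cA; rewrite /determinant; apply: continuous_at_sum => s.
apply: continuousM; first exact: cst_continuous.
exact: continuous_at_prod.
Qed.

Variables (Y : V -> V) (s : R).

(** The derivative of [Y] along the tangential projection of [v], written with derivatives in fixed
    directions so that continuity in [u] is visible. *)
Definition tangent_dir (u : 'rV[R]_n.+1) (v : V) : V :=
  'D_v Y (s, u) - dotp v.2 u *: \sum_i u 0 i *: 'D_((0, delta_mx 0 i) : V) Y (s, u).

Definition tangent_proj (u : 'rV[R]_n.+1) (v : V) : V := (v.1, v.2 - dotp v.2 u *: u).

Lemma tangent_dirE u v : differentiable Y (s, u) ->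
  tangent_dir u v = 'D_(tangent_proj u v) Y (s, u).
Proof.
move=> dY; have -> : tangent_proj u v = v + (- dotp v.2 u) *:
    \sum_i u 0 i *: ((0, delta_mx 0 i) : V).
  have -> : \sum_i u 0 i *: ((0, delta_mx 0 i) : V) = (0, u).
    rewrite [in RHS](row_sum_delta u).
    elim/big_rec2: _ => [//|i y x _ ->].
    by congr pair; rewrite /= scaler0 addr0.
  by rewrite /tangent_proj; congr pair; rewrite /= ?scaler0 ?addr0// scaleNr.
by rewrite derive_dirD// derive_dirZ// derive_dir_sum// scaleNr.
Qed.

(* [cyl_frame] need not be continuous.  With the normal direction added to the Gram form,
   its determinant is that of a matrix in a fixed basis of the ambient space. *)
Definition area_form (u : 'rV[R]_n.+1) (v w : V) : R :=
  g (Y (s, u)) (tangent_dir u v) (tangent_dir u w) + dotp u v.2 * dotp u w.2.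

Definition area_matrix (u : 'rV[R]_n.+1) : 'M[R]_n.+2 :=
  \matrix_(i, j) area_form u (cbasis i) (cbasis j).

Lemma bilin_area_form u : differentiable Y (s, u) -> bilin (area_form u).
Proof.
move=> dY; have tp k (v v' : V) :
    tangent_proj u (k *: v + v') = k *: tangent_proj u v + tangent_proj u v'.
  rewrite /tangent_proj; congr pair => /=; apply/rowP => i.
  by rewrite dotpDl dotpZl !mxE; ring.
have td k (v v' : V) : tangent_dir u (k *: v + v') = k *: tangent_dir u v + tangent_dir u v'.
  by rewrite (tangent_dirE _ dY) tp (derive_dirD _ _ dY) (derive_dirZ _ _ dY) -!(tangent_dirE _ dY).
have [b1 b2] := bilin_rot_metric f h (Y (s, u)).
split=> k v v' w; rewrite /area_form td ?b1 ?b2.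
  by rewrite [(k *: v + v').2]/(k *: v.2 + v'.2) dotpDr dotpZr mulrDl -mulrA addrACA -mulrDr.
rewrite [(k *: v' + w).2]/(k *: v'.2 + w.2) dotpDr dotpZr mulrDr mulrCA addrACA.
by rewrite -mulrDr.
Qed.

(** In the orthonormal basis made of the normal [u] and the frame [e], the area form is block
    diagonal with blocks 1 and the Gram matrix. *)
Lemma det_area_matrix u e : enorm u = 1 -> frame (s, u) e -> differentiable Y (s, u) ->
  \det (area_matrix u) = \det (formmx (gramb g Y (s, u)) e).
Proof.
move=> u1 [te oe] dY; have bA := bilin_area_form dY.
have uu := (enorm1P _).1 u1.
pose o (i : 'I_n.+2) : V := if unlift ord0 i is Some j then e j else (0, u).
have o0 : o 0 = (0, u) by rewrite /o unlift_none.
have oS i : o (lift 0 i) = e i by rewrite /o liftK.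
pose O : 'M[R]_n.+2 := \matrix_(i, k) ccoord k (o i).
have ipE (v w : V) : \sum_k ccoord k v * ccoord k w = ip v w.
  by rewrite -[LHS]/(dotp (consv v.1 v.2) (consv w.1 w.2)) dotp_consv.
have OO : O *m O^T = 1%:M.
  apply/matrixP => i j; rewrite !mxE; under eq_bigr do rewrite !mxE.
  rewrite ipE; case: (unliftP 0 i) => [i' ->|->]; case: (unliftP 0 j) => [j' ->|->].
  - by rewrite !oS oe (inj_eq lift_inj).
  - by rewrite oS o0 /ip /= mulr0 add0r dotpC; exact: (te i').
  - by rewrite oS o0 /ip /= mul0r add0r; exact: (te j').
  - by rewrite o0 /ip /= mulr0 add0r uu.
pose M : 'M[R]_n.+2 := \matrix_(i, j) area_form u (o i) (o j).
have ME : M = O *m area_matrix u *m O^T.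
  apply/matrixP => i j; rewrite mxE (cspace_expand (o i)) (cspace_expand (o j)) bilin_sum// !mxE.
  rewrite exchange_big; apply: eq_bigr => k _ /=; rewrite !mxE mulr_suml.
  by apply: eq_bigr => l _; rewrite !mxE; ring.
have -> : \det (area_matrix u) = \det M.
  by rewrite ME !det_mulmx mulrAC -det_mulmx OO det1 mul1r.
have g0 v : g (Y (s, u)) 0 v = 0 /\ g (Y (s, u)) v 0 = 0.
  have [b1 b2] := bilin_rot_metric f h (Y (s, u)).
  have := b1 1 0 0 v; have := b2 1 v 0 0; rewrite !scale1r !addr0 !mul1r.
  by move=> /eqP; rewrite -subr_eq subrr => /eqP <- /eqP; rewrite -subr_eq subrr => /eqP <-.
have td0 : tangent_dir u (o 0) = 0.
  rewrite tangent_dirE// o0 /tangent_proj /= uu scale1r subrr.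
  by rewrite (_ : (0, 0) = 0 :> V)// derive0.
have tdS i : tangent_dir u (o (lift 0 i)) = 'D_(e i) Y (s, u).
  have ui : dotp u (e i).2 = 0 by exact: (te i).
  have tp : tangent_proj u (e i) = e i.
    by rewrite /tangent_proj dotpC ui scale0r subr0 -surjective_pairing.
  by rewrite oS (tangent_dirE _ dY) tp.
have uo0 : dotp u (o 0).2 = 1 by rewrite o0.
have uoS i : dotp u (o (lift 0 i)).2 = 0 by rewrite oS; exact: (te i).
have -> : M = (block_mx (1%:M : 'M[R]_1) 0 0 (formmx (gramb g Y (s, u)) e) : 'M[R]_(1 + n.+1)).
  have L0 (i : 'I_1) : lshift n.+1 i = 0 :> 'I_n.+2 by rewrite ord1; exact: val_inj.
  have LS (i : 'I_n.+1) : rshift 1 i = lift 0 i :> 'I_n.+2 by exact: val_inj.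
  apply/matrixP => i j; rewrite [LHS]mxE.
  case: (@split_ordP 1 n.+1 i) => i' ->; case: (@split_ordP 1 n.+1 j) => j' ->.
  - by rewrite [RHS](@block_mxEul _ 1 n.+1 1 n.+1 _ _ _ _ i' j') !L0 /area_form td0 (g0 _).1 uo0 mulr1 add0r !ord1 mxE eqxx.
  - by rewrite [RHS](@block_mxEur _ 1 n.+1 1 n.+1 _ _ _ _ i' j') L0 LS /area_form td0 (g0 _).1 uoS mulr0 add0r mxE.
  - by rewrite [RHS](@block_mxEdl _ 1 n.+1 1 n.+1 _ _ _ _ i' j') L0 LS /area_form td0 (g0 _).2 uoS mul0r add0r mxE.
  - by rewrite [RHS](@block_mxEdr _ 1 n.+1 1 n.+1 _ _ _ _ i' j') !LS /area_form !tdS uoS mul0r addr0 mxE.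
by rewrite (@det_ublock _ 1 n.+1) det1 mul1r.
Qed.

Lemma area_element_sphere_cont (U : set V) :
  open U -> smooth_on U Y -> (forall u, enorm u = 1 -> U (s, u)) ->
  (forall v w u, enorm u = 1 -> {for Y (s, u), continuous (fun p => g p v w)}) ->
  sphere_cont (fun u => area_element g Y (s, u)).
Proof.
move=> oU sY hU cg0; exists (fun u => Num.sqrt (\det (area_matrix u))) => u u1.
have dY : differentiable Y (s, u) by exact: (smooth_cspace_differentiable oU sY (hU _ u1)).
have u1' : enorm (s, u).2 = 1 by [].
split.
  rewrite (area_element_frame f h u1' (cyl_frameP u1') dY).
  by rewrite (det_area_matrix u1 (cyl_frameP u1') dY).
have cs : {for u, continuous (fun u => (s, u) : V)}.
  rewrite (_ : pair s = (fun u => ((0, u) : V) + (s, 0))); last first.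
    by apply/funext => x; congr pair; rewrite /= ?add0r ?addr0.
  apply: continuousD; last exact: cst_continuous.
  exact: (blin_continuous (blin_pair (@blin_zero _ _ _) (@blin_id _ _))).
have cD v : {for u, continuous (fun u => 'D_v Y (s, u))}.
  apply: (@continuous_comp _ _ _ (fun u => (s, u) : V) ('D_v Y)) => //.
  exact: smooth_on_continuous (smooth_on_derive v sY) _ (hU _ u1).
have cY : {for u, continuous (fun u => Y (s, u))}.
  apply: (@continuous_comp _ _ _ (fun u => (s, u) : V) Y) => //.
  exact: smooth_on_continuous sY _ (hU _ u1).
have cid : {for u, continuous (fun u : 'rV[R]_n.+1 => u)} by exact: cvg_id.
have cst0 (w : 'rV[R]_n.+1) : {for u, continuous (fun _ : 'rV[R]_n.+1 => w)}.
  exact: cst_continuous.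
have cd1 (w : 'rV[R]_n.+1) : {for u, continuous (fun u => dotp w u)}.
  exact: continuous_dotp (cst0 w) cid.
have cd2 (w : 'rV[R]_n.+1) : {for u, continuous (fun u => dotp u w)}.
  exact: continuous_dotp cid (cst0 w).
have csum : {for u, continuous (fun u : 'rV[R]_n.+1 =>
    \sum_i u 0 i *: 'D_((0, delta_mx 0 i) : V) Y (s, u))}.
  apply: continuous_at_sum => i; apply: continuousZ; last exact: cD.
  exact: (blin_continuous (blin_coord i)).
have ct v : {for u, continuous (fun u => tangent_dir u v)}.
  apply: (@continuousB _ _ _ (fun u => 'D_v Y (s, u))); first exact: cD.
  exact: (@continuousZ _ _ _ _ _ _ (cd1 v.2) csum).
apply: (@continuous_comp _ _ _ (fun u => \det (area_matrix u)) Num.sqrt); last exact: sqrt_continuous.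
apply: continuous_det => i j; rewrite /area_matrix.
rewrite (_ : (fun t => _) = (fun u => area_form u (cbasis i) (cbasis j))); last first.
  by apply/funext => t; rewrite mxE.
have cg x y : {for u, continuous (fun u => g (Y (s, u)) x y)}.
  apply: (@continuous_comp _ _ _ (fun u => Y (s, u)) (fun p => g p x y)); first exact: cY.
  exact: cg0.
apply: (@continuousD _ _ _ (fun u => g (Y (s, u)) (tangent_dir u (cbasis i))
    (tangent_dir u (cbasis j)))); last first.
  exact: (continuousM (cd2 (cbasis i).2) (cd2 (cbasis j).2)).
apply: (@continuous_bilin _ (fun u => g (Y (s, u)))); [|exact: cg|exact: ct|exact: ct].
by move=> t; exact: bilin_rot_metric.
Qed.

End AreaContinuity.

(** * Rotated solutions *)

Section Equivariance.
Context {R : realType} {n : nat}.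
Local Notation V := (cspace R n.+1).

Section Flow.
Variables (J : set R) (Rad : \bar R) (f h : R -> R).
Hypothesis hspace : rot_sym_space (n := n.+1) J Rad f h.
Local Notation g := (@rot_metric R n.+1 f h).
Local Notation M := (@ambient R n.+1 J Rad).

Lemma metric_continuous p v w : M p -> {for p, continuous (fun q => g q v w)}.
Proof.
by have [_ _ _ _ /(_ v w)[U [oU MU sU]]] := hspace; move=> /MU; exact: smooth_on_continuous.
Qed.

Lemma metric_differentiable p v w : M p -> differentiable (fun q => g q v w) p.
Proof.
have [_ _ _ _ /(_ v w)[U [oU MU sU]]] := hspace; move=> /MU.
exact: smooth_real_differentiable oU sU.
Qed.

Variables (a b : R) (rho : R -> R) (T : \bar R) (X N : R -> V -> V).
Hypothesis ab : a < b.
Hypothesis flow : flow_with_normal g M a b rho T X N.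
Local Notation TD := (time_domain T).

Lemma cyl_orth (A B : 'rV[R]_n.+1 -> 'rV[R]_n.+1) (q : V) : orthmap A B -> cyl a b q -> cyl a b (orthV A q).
Proof. by move=> o [q1 q2]; split=> //=; rewrite (orth_enorm o). Qed.

Lemma flow_slice (Z : R -> V -> V) t : smooth_near [set p | TD p.1 /\ cyl a b p.2]
    (fun p => Z p.1 p.2) -> TD t ->
  exists U : set V, [/\ open U, cyl a b `<=` U & smooth_on U (Z t)].
Proof.
move=> [U [oU DU sU]] Tt.
have hphi (p q : V) : (t, p + q) = (0, p) + (t, q) :> R * V by congr pair; rewrite /= add0r.
have bL : blin (fun p : V => (0 : R, p)) by exact: blin_pair (@blin_zero _ _ _) (@blin_id _ _).
have [_ sZ] := smooth_on_affine (phi := fun p : V => (t, p)) oU bL hphi sU.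
exists ((fun p => (t, p)) @^-1` U); split => //; last by move=> q cq; apply: DU.
apply: open_comp => // p _.
rewrite (_ : (fun p => (t, p)) = (fun p : V => (0, p) + (t, 0))); last first.
  by apply/funext => x; rewrite -hphi addr0.
by apply: continuousD; [exact: blin_continuous|exact: cst_continuous].
Qed.

Let sX := proj1 (let: And4 x _ _ _ := flow in x).
Let sN := proj2 (let: And4 x _ _ _ := flow in x).
Let flow_t t (Tt : TD t) := (let: And4 _ _ x _ := flow in x) t Tt.
Let flow_eq t q (Tt : TD t) (cq : cyl a b q) := (let: And4 _ _ _ x := flow in x) t q Tt cq.

Lemma flow_derivable_time (Z : R -> V -> V) t q :
  smooth_near [set p | TD p.1 /\ cyl a b p.2] (fun p => Z p.1 p.2) -> TD t -> cyl a b q ->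
  is_derive t 1 (Z ^~ q) ('D_((1, 0) : R * V) (fun p => Z p.1 p.2) (t, q)).
Proof.
move=> [U [oU DU sU]] Tt cq; have Up : U (t, q) by apply: DU.
apply: (@is_derive_affine _ _ _ _ (fun t => (t, q)) (fun p => Z p.1 p.2) t 1 (1, 0)).
  by move=> k; congr pair; rewrite /= ?scaler0 ?add0r.
exact: smooth_on_is_derive sU _ _ Up.
Qed.

(** The flow equation paired with the unit normal; it expresses the mean curvature without any
    frame. *)
Lemma flow_speed t q : TD t -> cyl a b q ->
  g (X t q) ('D_1 (X ^~ q) t) (N t q) =
    average_mean_curvature g a b (X t) (N t) - mean_curvature g (X t) (N t) q.
Proof.
move=> Tt cq; rewrite flow_eq//; have [_ _ /(_ q cq)[_ NN] _] := flow_t Tt.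
have [b1 _] := bilin_rot_metric f h (X t q).
have := b1 (average_mean_curvature g a b (X t) (N t) - mean_curvature g (X t) (N t) q) (N t q) 0 (N t q).
rewrite addr0 NN mulr1 => ->.
have := b1 1 0 0 (N t q); rewrite scale1r addr0 mul1r => /eqP.
by rewrite -subr_eq subrr => /eqP <-; rewrite addr0.
Qed.

Lemma continuous_slice (Z : R * V -> V) t s u :
  {for (t, (s, u)), continuous Z} -> {for u, continuous (fun u => Z (t, (s, u)))}.
Proof.
move=> cZ; apply: (@continuous_comp _ _ _ (fun u => (t, (s, u))) Z) => //.
have bL : blin (fun u : 'rV[R]_n.+1 => (0 : R, (0 : R, u))).
  exact: blin_pair (@blin_zero _ _ _) (blin_pair (@blin_zero _ _ _) (@blin_id _ _)).
rewrite (_ : (fun u => (t, (s, u))) = (fun u : 'rV[R]_n.+1 => (0, (0, u)) + (t, (s, 0)))); last first.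
  by apply/funext => x; congr pair; [rewrite /= add0r|congr pair; rewrite /= ?add0r ?addr0].
by apply: continuousD; [exact: blin_continuous|exact: cst_continuous].
Qed.

(** Continuity is read off from the flow equation: the mean curvature is the average minus the
    normal speed, and the latter involves only [X], its time derivative and [N]. *)
Lemma mean_curvature_sphere_cont t s : TD t -> a <= s <= b ->
  sphere_cont (fun u => mean_curvature g (X t) (N t) (s, u)).
Proof.
move=> Tt sab; set c := average_mean_curvature g a b (X t) (N t).
exists (fun u => c - g (X t (s, u)) ('D_((1, 0) : R * V) (fun p => X p.1 p.2) (t, (s, u))) (N t (s, u))).
move=> u u1; have cq : cyl a b (s, u) by split.
split.
  have [_ <-] := flow_derivable_time sX Tt cq.
  by rewrite flow_speed//; rewrite opprB addrC subrK.
have [UX [oX DX sUX]] := sX; have [UN [oN DN sUN]] := sN.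
have Dp : [set p : R * V | TD p.1 /\ cyl a b p.2] (t, (s, u)) by [].
have cX := smooth_on_continuous sUX (DX _ Dp).
have cN := smooth_on_continuous sUN (DN _ Dp).
have cD := smooth_on_continuous (smooth_on_derive ((1, 0) : R * V) sUX) (DX _ Dp).
have MX : M (X t (s, u)) by have [+ _ _ _] := flow_t Tt; apply.
apply: (@continuousB _ _ _ (fun=> c)); first exact: cst_continuous.
apply: (@continuous_bilin _ _ _ (fun u => g (X t (s, u)))
   (fun u => 'D_((1, 0) : R * V) (fun p => X p.1 p.2) (t, (s, u))) (fun u => N t (s, u))).
- by move=> u'; exact: bilin_rot_metric.
- move=> x y; apply: (@continuous_comp _ _ _ (fun u => X t (s, u)) (fun p => g p x y)).
    exact: (@continuous_slice (fun p => X p.1 p.2)).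
  exact: metric_continuous.
- exact: (@continuous_slice ('D_((1, 0) : R * V) (fun p => X p.1 p.2))).
- exact: (@continuous_slice (fun p => N p.1 p.2)).
Qed.

Lemma area_sphere_cont t s : TD t -> a <= s <= b ->
  sphere_cont (fun u => area_element g (X t) (s, u)).
Proof.
move=> Tt sab; have [U [oU cU sU]] := flow_slice sX Tt.
apply: (area_element_sphere_cont oU sU) => [u u1|v w u u1]; first by apply: cU.
by apply: metric_continuous; have [+ _ _ _] := flow_t Tt; apply.
Qed.

Lemma sphere_contM (phi psi : 'rV[R]_n.+1 -> R) : sphere_cont phi -> sphere_cont psi ->
  sphere_cont (fun u => phi u * psi u).
Proof.
move=> [p hp] [q hq]; exists (fun u => p u * q u) => u u1.
have [-> cp] := hp _ u1; have [-> cq] := hq _ u1; split=> //; exact: continuousM.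
Qed.

Lemma sphere_cont_orth A B (phi : 'rV[R]_n.+1 -> R) : orthmap A B ->
  sphere_cont phi -> sphere_cont (phi \o A).
Proof.
move=> oA [psi hp]; exists (psi \o A) => u u1.
have Au : enorm (A u) = 1 by rewrite (orth_enorm oA).
have [E c] := hp _ Au; split=> //.
by apply: continuous_comp => //; exact: blin_continuous (blin_orth oA) _.
Qed.

Lemma sphere_cont_cst (c : R) : sphere_cont (fun _ : 'rV[R]_n.+1 => c).
Proof. by exists (fun=> c) => u _; split=> //; exact: cst_continuous. Qed.

Section Rotated.
Variables (A B : 'rV[R]_n.+1 -> 'rV[R]_n.+1).
Hypothesis gA : good_orth A B.
Let o := proj1 gA.
Let o' := orthmap_sym o.
Let X' t := orthV B \o X t \o orthV A.
Let N' t := orthV B \o N t \o orthV A.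

Lemma hyp_integral_orth t phi phi' : TD t ->
  (forall s, a <= s <= b -> sphere_cont (fun u => phi (s, u))) ->
  (forall q, cyl a b q -> phi' q = phi (orthV A q)) ->
  hyp_integral g a b (X' t) phi' = hyp_integral g a b (X t) phi.
Proof.
move=> Tt cphi E; apply: eq_Rintegral => s; rewrite inE/= in_itv/= => sab.
have cpa := sphere_contM (cphi s sab) (area_sphere_cont Tt sab).
rewrite -[RHS](sphere_integral_orth gA cpa).
apply/esym/(sphere_integral_ext (sphere_cont_orth o cpa)) => u u1 /=.
have cq : cyl a b (s, u) by split.
have [U [oU cU sU]] := flow_slice sX Tt.
have dX : differentiable (X t) (orthV A (s, u)).
  by apply: (smooth_cspace_differentiable oU sU); apply: cU; exact: cyl_orth o cq.
have u1' : enorm (s, u).2 = 1 by [].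
apply: (congr2 *%R); [exact/esym/(E _ cq)|exact/esym/(area_element_orth f h o u1' dX)].
Qed.

Lemma mean_curvature_rotated t q : TD t -> cyl a b q ->
  mean_curvature g (X' t) (N' t) q = mean_curvature g (X t) (N t) (orthV A q).
Proof.
move=> Tt cq; have [U [oU cU sU]] := flow_slice sX Tt.
have [U' [oU' cU' sU']] := flow_slice sN Tt.
have cAq := cyl_orth o cq.
have dX := smooth_cspace_differentiable oU sU (cU _ cAq).
have dN := smooth_cspace_differentiable oU' sU' (cU' _ cAq).
apply: (mean_curvature_orth o (proj2 cq) dX dN) => v w.
by apply: metric_differentiable; have [+ _ _ _] := flow_t Tt; apply.
Qed.

(** Each clause is transported by the isometry. The only nonlocal one is the flow equation: its
    average is unchanged because both integrals in the quotient are invariant. *)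
Lemma flow_rotated : flow_with_normal g M a b rho T X' N'.
Proof.
have [_ init _ _] := flow.
have sm (Z : R -> V -> V) : smooth_near [set p | TD p.1 /\ cyl a b p.2] (fun p => Z p.1 p.2) ->
    smooth_near [set p | TD p.1 /\ cyl a b p.2] (fun p => (orthV B \o Z p.1 \o orthV A) p.2).
  move=> [U [oU DU sU]]; pose phi (p : R * V) := (p.1, orthV A p.2).
  have bphi : blin phi.
    exact: blin_pair (@blin_fst _ _ _) (blin_comp (blin_orthV o) (@blin_snd _ _ _)).
  have [_ sZ] := smooth_on_affine oU bphi (blinD bphi) sU.
  have oU' : open (phi @^-1` U) by apply: open_comp => // p _; exact: blin_continuous.
  exists (phi @^-1` U); split; first exact: oU'.
    by move=> p [pt pq]; exact: DU (phi p) (conj pt (cyl_orth o pq)).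
  exact: (smooth_on_blin oU' (blin_orthV o') sZ).
have derX t q v : TD t -> cyl a b q ->
    'D_v (X' t) q = orthV B ('D_(orthV A v) (X t) (orthV A q)).
  move=> Tt cq; have [U [oU cU sU]] := flow_slice sX Tt.
  apply: (derive_orthV o); apply: smooth_on_derivable sU _ _ _.
  by apply: cU; exact: cyl_orth o cq.
have normalA t q nu : TD t -> cyl a b q ->
    normal_at g (X' t) q nu -> normal_at g (X t) (orthV A q) (orthV A nu).
  move=> Tt cq hn v tv; have := hn (orthV B v).
  rewrite derX// (orthVK o') -(rot_metric_orth f h _ _ _ o) !(orthVK o').
  apply; rewrite /cyl_tangent/=; move: tv; rewrite /cyl_tangent/= => <-.
  by rewrite -(orth_dotp o) (orthKV o).
split; first by split; apply: sm.
- move=> q cq; have [E P] := init _ (cyl_orth o cq).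
  have XE : X' 0 q = revolution rho q.
    by rewrite /X'/= E /revolution /orthV/= -(orthZ o) (orthK o).
  split=> //; move: P; rewrite -(rot_metric_orth f h _ _ _ o').
  rewrite (_ : orthV B (e_r _) = e_r (X' 0 q))//.
  by rewrite /orthV /e_r /= (orthZ o') (orth_enorm o').
- move=> t Tt; have [memX immX unX orX] := flow_t Tt; split.
  + move=> q cq; have [m1 m2] := memX _ (cyl_orth o cq).
    by split=> //=; rewrite (orth_enorm o').
  + move=> q cq v tv v0; rewrite derX//.
    have -> : 0 = orthV B 0 :> V by rewrite /orthV/= (orth0 o').
    rewrite (can_eq (orthVK o')); apply: immX; first exact: cyl_orth o cq.
      by rewrite /cyl_tangent/= (orth_dotp o).
    have -> : 0 = orthV A 0 :> V by rewrite /orthV/= (orth0 o).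
    by rewrite (can_eq (orthVK o)).
  + move=> q cq; have [h1 h2] := unX _ (cyl_orth o cq); split; last first.
      by rewrite /X' /N' /= (rot_metric_orth _ _ _ _ _ o').
    move=> v tv; rewrite derX// /X' /N' /= (rot_metric_orth _ _ _ _ _ o').
    by apply: h1; rewrite /cyl_tangent/= (orth_dotp o).
  + move=> q [qb q1]; have cbA : cyl_boundary a b (orthV A q) by split=> //=; rewrite (orth_enorm o).
    have [b1 b2] := orX _ cbA; split=> // nu hn.
    have cq : cyl a b q by split=> //; case: qb => ->; rewrite lexx ltW.
    have := b2 _ (normalA _ _ _ Tt cq hn).
    rewrite -(rot_metric_orth f h _ _ _ o') /= (orthVK o).
    by rewrite (_ : orthV B e_z = e_z)// /orthV /e_z /= (orth0 o').
- move=> t q Tt cq.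
  have -> : X'^~ q = orthV B \o (X ^~ (orthV A q)) by [].
  have cAq := cyl_orth o cq.
  have [dX _] := flow_derivable_time sX Tt cAq.
  have [_ ->] := is_derive_blin (blin_orthV o') (derivableP dX).
  have key (k k' : R) v : k = k' -> orthV B (k *: v) = k' *: orthV B v.
    by move=> ->; exact: (blinZ (blin_orthV o')).
  rewrite (flow_eq Tt cAq); apply: key.
  apply: (congr2 (fun x y : R => x - y)); last exact/esym/mean_curvature_rotated.
  have e1 := hyp_integral_orth Tt (fun s sab => mean_curvature_sphere_cont Tt sab)
    (fun q' cq' => mean_curvature_rotated Tt cq').
  have e2 := hyp_integral_orth (phi := fun=> 1) (phi' := fun=> 1) Tt
    (fun s sab => sphere_cont_cst 1) (fun q' cq' => erefl).
  exact: (congr2 (fun x y : R => x / y) (esym e1) (esym e2)).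
Qed.

End Rotated.
End Flow.

(* The rotated solution has the same initial hypersurface, so maximality identifies it
   with X. *)
Lemma maximal_orth (J : set R) (Rad : \bar R) (f h : R -> R) (a b : R) (rho : R -> R)
    (T : \bar R) (X : R -> V -> V) (A B : 'rV[R]_n.+1 -> 'rV[R]_n.+1) t q :
  rot_sym_space (n := n.+1) J Rad f h -> a < b ->
  maximal_vpmcf_solution (rot_metric f h) (ambient J Rad) a b rho T X ->
  good_orth A B -> time_domain T t -> cyl a b q ->
  X t (orthV A q) = orthV A (X t q).
Proof.
move=> hs ab [[T0 [N flow]] maxX] gA Tt cq.
have [_ /(_ t q Tt cq) E] := maxX _ _ (conj T0 (ex_intro _ _ (flow_rotated hs ab flow gA))).
by rewrite -E /= (orthVK (orthmap_sym (proj1 gA))).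
Qed.

Definition pole : 'rV[R]_n.+1 := consv 1 0.

Lemma dotp_pole : dotp pole pole = 1.
Proof. by rewrite dotp_consv mulr1 dotp0r addr0. Qed.

Lemma enorm_pole : enorm pole = 1.
Proof. exact/enorm1P/dotp_pole. Qed.

(** Flips that fix the pole annihilate the other components of the point over the pole, so it is
    radial; transitivity carries the formula to every [u]. *)
Lemma maximal_profile (J : set R) (Rad : \bar R) (f h : R -> R) (a b : R) (rho : R -> R)
    (T : \bar R) (X : R -> V -> V) t s u :
  rot_sym_space (n := n.+1) J Rad f h -> a < b ->
  maximal_vpmcf_solution (rot_metric f h) (ambient J Rad) a b rho T X ->
  time_domain T t -> a <= s <= b -> enorm u = 1 ->
  X t (s, u) = ((X t (s, pole)).1, (X t (s, pole)).2 0 0 *: u).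
Proof.
move=> hs ab mX Tt sab u1.
have c0 : cyl a b (s, pole) by split; last exact: enorm_pole.
have E0 : (X t (s, pole)).2 = (X t (s, pole)).2 0 0 *: pole.
  apply/rowP => i; rewrite mxE; case: (unliftP 0 i) => [j ->|->]; last by rewrite consv0 mulr1.
  rewrite consvS mxE mulr0; have [A [B [gA EA]]] := @good_orth_flip_coord R _ (lift 0 j : 'I_n.+1).
  have Ap : A pole = pole.
    apply/rowP => k; rewrite EA; case: eqP => // ->.
    by rewrite consvS mxE oppr0.
  have := maximal_orth hs ab mX gA Tt c0; rewrite {1}/orthV/= Ap => /(congr1 snd)/=.
  move=> /rowP/(_ (lift 0 j)); rewrite EA eqxx; lra.
have /good_orth_transitive[A [B [gA Ap]]] : dotp u u = 1 by apply/enorm1P.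
have := maximal_orth hs ab mX gA Tt c0; rewrite {1}/orthV/= Ap => ->.
by rewrite /orthV E0 (orthZ (proj1 gA)) Ap -E0.
Qed.

End Equivariance.

(** * Smooth functions of one variable *)

Section RealDerivatives.
Context {R : realType}.
Implicit Types (f g : R -> R) (x a b : R).

Lemma is_derive_add f g x a b : is_derive x 1 f a -> is_derive x 1 g b ->
  is_derive x 1 (fun t => f t + g t) (a + b).
Proof. by move=> hf hg; exact: is_deriveD. Qed.

Lemma is_derive_sub f g x a b : is_derive x 1 f a -> is_derive x 1 g b ->
  is_derive x 1 (fun t => f t - g t) (a - b).
Proof. by move=> hf hg; exact: is_deriveB. Qed.

Lemma is_derive_mul f g x a b : is_derive x 1 f a -> is_derive x 1 g b ->
  is_derive x 1 (fun t => f t * g t) (a * g x + f x * b).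
Proof.
move=> hf hg; have := is_deriveM hf hg.
by rewrite !scaleRE addrC [g x * a]mulrC.
Qed.

Lemma is_derive_inv f x a : f x != 0 -> is_derive x 1 f a ->
  is_derive x 1 (fun t => (f t)^-1) (- a / f x ^+ 2).
Proof.
move=> fx hf; have := is_deriveV fx hf.
by rewrite scaleRE mulrC mulrN mulNr.
Qed.

Lemma is_derive_comp f g x a b : is_derive x 1 f a -> is_derive (f x) 1 g b ->
  is_derive x 1 (g \o f) (a * b).
Proof. by move=> hf hg; rewrite mulrC; exact: is_derive1_comp hg hf. Qed.

Lemma is_derive_sqrt f x a : 0 < f x -> is_derive x 1 f a ->
  is_derive x 1 (fun t => Num.sqrt (f t)) (a / (2 * Num.sqrt (f x))).
Proof. by move=> fx hf; exact: (is_derive_comp hf (is_derive1_sqrt fx)). Qed.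

Lemma is_derive_continuous f x a : is_derive x 1 f a -> {for x, continuous f}.
Proof. by case=> df _; exact/differentiable_continuous/derivable1_diffP. Qed.

End RealDerivatives.

Section SmoothReal.
Context {R : realType}.
Implicit Types (F G : R -> R) (U : set R).

(** In one variable all directional derivatives are multiples of ['D_1], so a chain of derivatives
    along 1 suffices. Unlike [smooth_on], it comes with a finite order on which products, quotients
    and composites can be handled by induction. *)
Fixpoint Ck (k : nat) U F : Prop :=
  if k is k'.+1 then (forall p, U p -> derivable F p 1) /\ Ck k' U ('D_1 F)
  else forall p, U p -> {for p, continuous F}.

Lemma Ck_eq k U F G : open U -> (forall p, U p -> F p = G p) -> Ck k U F -> Ck k U G.
Proof.
move=> oU; elim: k F G => [|k IH] F G E /=.
  by move=> cF p Up; exact: continuous_open_eq oU Up E (cF p Up).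
move=> [dF cF]; split=> [p Up|].
  exact: near_eq_derivable (open_near_eq oU Up E) (dF p Up).
by apply: IH cF => p Up; exact: near_eq_derive (open_near_eq oU Up E).
Qed.

Lemma Ck_derive k U F F' : open U -> (forall p, U p -> is_derive p 1 F (F' p)) ->
  Ck k U F' -> Ck k.+1 U F.
Proof.
move=> oU dF cF; split=> [p Up|]; first by have [] := dF p Up.
by apply: Ck_eq cF => // p Up; have [_ ->] := dF p Up.
Qed.

Lemma Ck_is_derive k U F p : Ck k.+1 U F -> U p -> is_derive p 1 F ('D_1 F p).
Proof. by move=> [dF _] Up; apply: derivableP; exact: dF. Qed.

Lemma Ck_pred k U F : Ck k.+1 U F -> Ck k U F.
Proof.
elim: k F => [|k IH] F; last by move=> [dF cF]; split=> //; exact: IH.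
by move=> cF p Up; exact: is_derive_continuous (Ck_is_derive cF Up).
Qed.

Lemma Ck_cst k U (c : R) : open U -> Ck k U (fun=> c).
Proof.
move=> oU; elim: k c => [|k IH] c; first by move=> p _; exact: cst_continuous.
by apply: (Ck_derive oU (F' := fun=> 0)) => // p _; exact: is_derive_cst.
Qed.

Lemma Ck_id k U : open U -> Ck k U id.
Proof.
case: k => [|k] oU; first by move=> p _.
by apply: (Ck_derive oU (F' := fun=> 1)); exact: Ck_cst.
Qed.

Lemma Ck_add k U F G : open U -> Ck k U F -> Ck k U G -> Ck k U (fun p => F p + G p).
Proof.
move=> oU; elim: k F G => [|k IH] F G cF cG.
  by move=> p Up; apply: (@continuousD _ _ _ F G); [exact: cF|exact: cG].
apply: (Ck_derive oU (fun p Up => is_derive_add (Ck_is_derive cF Up) (Ck_is_derive cG Up))).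
exact: IH (proj2 cF) (proj2 cG).
Qed.

Lemma Ck_mul k U F G : open U -> Ck k U F -> Ck k U G -> Ck k U (fun p => F p * G p).
Proof.
move=> oU; elim: k F G => [|k IH] F G cF cG.
  by move=> p Up; apply: (@continuousM _ _ F G); [exact: cF|exact: cG].
apply: (Ck_derive oU (fun p Up => is_derive_mul (Ck_is_derive cF Up) (Ck_is_derive cG Up))).
by apply: Ck_add => //; apply: IH;
  [exact: proj2 cF|exact: Ck_pred|exact: Ck_pred|exact: proj2 cG].
Qed.

Lemma Ck_inv k U F : open U -> (forall p, U p -> F p != 0) -> Ck k U F ->
  Ck k U (fun p => (F p)^-1).
Proof.
move=> oU F0; elim: k => [|k IH] cF.
  by move=> p Up; apply: (@continuousV _ _ F); [exact: F0|exact: cF].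
apply: (Ck_derive oU (fun p Up => is_derive_inv (F0 p Up) (Ck_is_derive cF Up))).
have cV := IH (Ck_pred cF); have cF' : Ck k U ('D_1 F) by case: cF.
have c := Ck_mul oU (Ck_mul oU (Ck_cst k (- 1) oU) cF') (Ck_mul oU cV cV).
by apply: Ck_eq oU _ c => p Up; rewrite -invfM -expr2 mulN1r.
Qed.

Lemma Ck_sqrt k U F : open U -> (forall p, U p -> 0 < F p) -> Ck k U F ->
  Ck k U (fun p => Num.sqrt (F p)).
Proof.
move=> oU F0; elim: k => [|k IH] cF.
  move=> p Up; apply: (@continuous_comp _ _ _ F Num.sqrt); [exact: cF|exact: sqrt_continuous].
apply: (Ck_derive oU (fun p Up => is_derive_sqrt (F0 p Up) (Ck_is_derive cF Up))).
apply: Ck_mul => //; first exact: proj2 cF.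
apply: Ck_inv => // [p Up|]; first by rewrite mulf_neq0// sqrtr_eq0 -ltNge F0.
by apply: Ck_mul => //; [exact: Ck_cst|exact: IH (Ck_pred cF)].
Qed.

Lemma smooth_onP U F : open U -> smooth_on U F <-> forall k, Ck k U F.
Proof.
move=> oU; split=> [sF k|cF].
  elim: k F sF => [|k IH] F sF; first by move=> p Up; exact: smooth_on_continuous sF p Up.
  split=> [p Up|]; first exact: smooth_on_derivable sF _ _ Up.
  by apply: IH; exact: smooth_on_derive.
move=> vs; elim/last_ind: vs F cF => [|vs v IH] F cF p Up.
  split; first exact: cF 0%N p Up.
  move=> v; have := is_deriveZdir v (Ck_is_derive (cF 1%N) Up).
  by rewrite (_ : v *: 1 = v) => [[]|]//; rewrite scaleRE mulr1.
rewrite iter_derive_rcons; apply: IH Up => k.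
apply: (@Ck_eq k U (fun p => v * 'D_1 F p)) => // [q Uq|].
  have [_] := is_deriveZdir v (Ck_is_derive (cF 1%N) Uq).
  by rewrite scaleRE mulr1 => ->.
by apply: Ck_mul => //; [exact: Ck_cst|exact: proj2 (cF k.+1)].
Qed.

End SmoothReal.

(** * Smoothness and monotonicity of the metric coefficients *)

Section MetricCoefficients.
Context {R : realType} {n : nat}.
Local Notation V := (cspace R n.+2).

Lemma segment_monotone (f df : R -> R) (a b : R) : a <= b ->
  (forall x, a <= x <= b -> is_derive x 1 f (df x)) ->
  (forall x, a <= x <= b -> 0 <= df x) -> f a <= f b.
Proof.
move=> ab hf df0.
have [||c cab E] := @MVT_segment _ f df a b ab.
- by move=> x; rewrite in_itv/= => /andP[ax xb]; apply: hf; rewrite !ltW.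
- exact: is_derive_segment_continuous hf.
- by rewrite -subr_ge0 E mulr_ge0 ?subr_ge0//; apply: df0; move: cab; rewrite in_itv.
Qed.

(** For the tangent vector [v2 *: u + e] at [r *: u] one has [dr = v2] and [du = e / r], whence the
    factor [h r / r]. *)
Lemma metric_polar (f h : R -> R) (z r v1 v2 w1 w2 : R) (u e e' : 'rV[R]_n.+2) : 0 < r -> enorm u = 1 ->
  dotp u e = 0 -> dotp u e' = 0 ->
  rot_metric f h (z, r *: u) (v1, v2 *: u + e) (w1, w2 *: u + e') =
  f r ^+ 2 * (v1 * w1) + v2 * w2 + (h r / r) ^+ 2 * dotp e e'.
Proof.
move=> r0 u1 ue ue'; have uu : dotp u u = 1 by exact/enorm1P.
have rn : enorm (r *: u) = r by rewrite enormZ u1 mulr1 gtr0_norm.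
have dr (k : R) x : dotp u x = 0 -> dotp (r *: u) (k *: u + x) / r = k.
  by move=> ux; rewrite dotpZl dotpDr dotpZr uu ux addr0 mulr1 mulrC mulKf// gt_eqF.
rewrite /rot_metric/= rn ifF; last first.
  by apply/negP; rewrite -enorm_eq0 rn gt_eqF.
rewrite !dr//; congr (_ + _).
have du (k : R) x : k *: u + x - (k / r) *: (r *: u) = x.
  by rewrite scalerA divfK ?gt_eqF// addrC addKr.
by rewrite !du dotpZl dotpZr; set d := dotp _ _; field; exact: lt0r_neq0.
Qed.

Variables (J : set R) (Rad : \bar R) (f h : R -> R) (z0 : R).
Hypothesis hspace : rot_sym_space (n := n.+2) J Rad f h.
Hypothesis Jz0 : J z0.
Local Notation g := (@rot_metric R n.+2 f h).
Let p0 := @pole R n.+1.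

Definition radii : set R := [set r | 0 < r /\ (r%:E < Rad)%E].

Lemma open_radii : open radii.
Proof.
have -> : radii = [set r | 0 < r] `&` [set r | (r%:E < Rad)%E] by [].
apply: openI; first exact: open_gt.
case: Rad => [x| |].
- by under eq_set do rewrite lte_fin; exact: open_lt.
- have -> : [set r : R | (r%:E < +oo)%E] = setT.
    by rewrite eqEsubset; split=> // r _; exact: ltry.
  exact: openT.
- have -> : [set r : R | (r%:E < -oo)%E] = set0 by rewrite eqEsubset; split=> // r.
  exact: open0.
Qed.

(** Smoothness of [f] and [h] is not assumed; it is extracted from the metric along a ray orthogonal
    to the axis. The ray includes its origin, which later controls [h] near the axis. *)
Lemma metric_ray_smooth (v w : V) : exists U : set R, [/\ open U,
  forall r, 0 <= r -> (r%:E < Rad)%E -> U r & smooth_on U (fun r => g (z0, r *: p0) v w)].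
Proof.
have [_ _ _ _ /(_ v w)[U [oU MU sU]]] := hspace.
have hphi (p q : R) : (z0, (p + q) *: p0) = (0, p *: p0) + (z0, q *: p0) :> V.
  by congr pair; rewrite /= ?add0r ?scalerDl.
have bL : blin (fun p : R => (0 : R, p *: p0)).
  exact: blin_pair (@blin_zero _ _ _) (blin_scale _).
have [_ sZ] := smooth_on_affine (phi := fun p : R => (z0, p *: p0)) oU bL hphi sU.
exists ((fun p : R => (z0, p *: p0)) @^-1` U); split=> //.
  apply: open_comp => // p _.
  rewrite (_ : (fun p => (z0, p *: p0)) = (fun p : R => (0, p *: p0) + (z0, 0))); last first.
    by apply/funext => x; congr pair; rewrite /= ?add0r ?addr0.
  by apply: continuousD; [exact: blin_continuous|exact: cst_continuous].
move=> r r0 rR; apply: MU; split=> //=.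
by rewrite enormZ enorm_pole mulr1 ger0_norm.
Qed.

Let fh_gt0 r : radii r -> 0 < f r /\ 0 < h r.
Proof. by have [_ _ _ + _] := hspace; move=> + [r0 rR]; apply. Qed.

Lemma metric_coef_f_smooth k : Ck k radii f.
Proof.
have [U [oU IU sU]] := metric_ray_smooth e_z e_z.
have E r : radii r -> g (z0, r *: p0) e_z e_z = f r ^+ 2.
  move=> [r0 rR].
  have := @metric_polar f h z0 r 1 0 1 0 p0 0 0 r0 (enorm_pole) (dotp0r _) (dotp0r _).
  by rewrite scale0r addr0 dotp0r !mulr0 !addr0 !mulr1.
have UI : radii `<=` U by move=> r [r0 rR]; apply: IU => //; exact: ltW.
have cF := (smooth_onP _ open_radii).1 (smooth_onW UI sU) k.
apply: (Ck_eq open_radii _ (Ck_sqrt open_radii _ cF)).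
  by move=> r Ir; rewrite E// sqrtr_sqr gtr0_norm; have [] := fh_gt0 Ir.
by move=> r Ir; rewrite E// exprn_gt0; have [] := fh_gt0 Ir.
Qed.

(** A unit vector orthogonal to the pole; it exists because the dimension is at least 2, and the
    metric on it determines [h]. *)
Let e' : 'rV[R]_n.+2 := consv 0 (@pole R n).

Let metric_e' r : radii r -> g (z0, r *: p0) (0, e') (0, e') = (h r / r) ^+ 2.
Proof.
move=> [r0 rR]; have pe : dotp p0 e' = 0 by rewrite dotp_consv mulr0 dotp0l addr0.
have := @metric_polar f h z0 r 0 0 0 0 p0 e' e' r0 (enorm_pole) pe pe.
rewrite scale0r add0r !mulr0 !add0r => ->.
by rewrite dotp_consv mulr0 add0r dotp_pole mulr1.
Qed.

Lemma metric_coef_h_smooth k : Ck k radii h.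
Proof.
have [U [oU IU sU]] := metric_ray_smooth (0, e') (0, e').
have UI : radii `<=` U by move=> r [r0 rR]; apply: IU => //; exact: ltW.
have cF := (smooth_onP _ open_radii).1 (smooth_onW UI sU) k.
have hr0 r : radii r -> 0 < h r / r.
  by move=> Ir; rewrite divr_gt0//; [have [] := fh_gt0 Ir|case: Ir].
apply: (Ck_eq open_radii _ (Ck_mul open_radii (Ck_id k open_radii) (Ck_sqrt open_radii _ cF))).
  move=> r Ir; rewrite metric_e'// sqrtr_sqr gtr0_norm ?hr0// mulrC divfK// gt_eqF//.
  by case: Ir.
by move=> r Ir; rewrite metric_e'// exprn_gt0// hr0.
Qed.

(** Continuity of the metric at the axis gives [(h r / r) ^+ 2 < 4] nearby, so [h r < 2 * r] there;
    this explains the bound [e / 2]. *)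
Lemma metric_coef_h_axis (e : R) : 0 < e -> exists2 d, 0 < d &
  forall r, radii r -> r < d -> h r < e.
Proof.
move=> e0; have [U [oU IU sU]] := metric_ray_smooth (0, e') (0, e').
have [_ R0 _ _ _] := hspace.
have c0 : {for (0 : R), continuous (fun r : R => g (z0, r *: p0) (0, e') (0, e'))}.
  by apply: smooth_on_continuous sU _ _; exact: IU.
have E0 : g (z0, 0 *: p0) (0, e') (0, e') = 1.
  by rewrite scale0r /rot_metric/= eqxx mulr0 add0r dotp_consv mulr0 add0r dotp_pole.
have : \forall r \near (0 : R), g (z0, r *: p0) (0, e') (0, e') < 2 ^+ 2.
  by apply: (cvgr_lt _ c0); rewrite E0; lra.
move=> /nbhs_ballP[d /= d0 hd]; exists (Num.min d (e / 2)); first by rewrite lt_min d0 divr_gt0.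
move=> r Ir; rewrite lt_min => /andP[rd re]; have r0 : 0 < r by case: Ir.
have := hd r; rewrite /ball/= sub0r normrN gtr0_norm// metric_e'// => /(_ rd).
have hr : 0 <= h r / r by rewrite ltW// divr_gt0//; have [] := fh_gt0 Ir.
rewrite ltr_pXn2r ?nnegrE// ltr_pdivrMr// => /lt_le_trans; apply.
by rewrite mulrC -ler_pdivlMr// ltW.
Qed.

(** If [h'] were negative at [r], convexity would keep it negative on []0, r]], so [h] would stay
    above [h r > 0] down to the axis, where it tends to 0. *)
Lemma metric_coef_h_nondecreasing :
  (forall r, radii r -> 0 <= 'D_1 ('D_1 h) r) -> forall r, radii r -> 0 <= 'D_1 h r.
Proof.
move=> h2 r Ir; rewrite leNgt; apply/negP => hr.
have [r0 rR] := Ir; have [_ hr0] := fh_gt0 Ir.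
have sub (s : R) : 0 < s -> s <= r -> radii s.
  by move=> s0 sr; split=> //; apply: le_lt_trans rR; rewrite lee_fin.
have d1 (s : R) : 0 < s -> s <= r -> 'D_1 h s <= 'D_1 h r.
  move=> s0 sr; apply: (@segment_monotone ('D_1 h) ('D_1 ('D_1 h)) s r sr) => x /andP[sx xr].
    have c1 : Ck 1 radii ('D_1 h) by have [] := metric_coef_h_smooth 2.
    exact: Ck_is_derive c1 (sub x (lt_le_trans s0 sx) xr).
  by apply: h2; exact: sub (lt_le_trans s0 sx) xr.
have [d d0 hd] := metric_coef_h_axis hr0.
pose s := Num.min (d / 2) r.
have s0 : 0 < s by rewrite lt_min r0 divr_gt0.
have sr : s <= r by rewrite ge_min lexx orbT.
have sd : s < d by rewrite gt_min; apply/orP; left; lra.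
have := hd s (sub s s0 sr) sd; apply/negP; rewrite -leNgt -lerN2.
apply: (@segment_monotone (fun s => - h s) (fun s => - 'D_1 h s) s r sr) => x /andP[sx xr].
  by apply: is_deriveN; exact: Ck_is_derive (metric_coef_h_smooth 1) (sub x (lt_le_trans s0 sx) xr).
by rewrite oppr_ge0 (le_trans (d1 x _ _))// ?ltW//; exact: lt_le_trans sx.
Qed.

(** In the curved case, nonpositivity of [S_ri] gives convexity of [h], hence [h' >= 0]; negativity
    of [S_zi] gives [h' f' > 0], hence [f' >= 0]. *)
Lemma metric_coef_monotone :
  (forall r : R, 0 <= r -> (r%:E < Rad)%E -> S_zi f h r < 0 /\ S_ri h r <= 0) \/
  euclidean_space J Rad f h ->
  forall r, radii r -> 0 <= 'D_1 f r /\ 0 <= 'D_1 h r.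
Proof.
case=> [curv r Ir|[_ _ eucl] r Ir]; last first.
  have Ef q : radii q -> f q = cst (1 : R) q by move=> [q0 _]; have [] := eucl q (ltW q0).
  have Eh q : radii q -> h q = id q by move=> [q0 _]; have [] := eucl q (ltW q0).
  rewrite (near_eq_derive (1 : R) (open_near_eq open_radii Ir Ef)) derive_cst.
  by rewrite (near_eq_derive (1 : R) (open_near_eq open_radii Ir Eh)) derive_id.
have D1 (k : R -> R) : derive1 k = 'D_1 k by apply/funext => x; exact: derive1E.
have h'0 : forall r, radii r -> 0 <= 'D_1 h r.
  apply: metric_coef_h_nondecreasing => s Is; have [s0 sR] := Is.
  have [_] := curv s (ltW s0) sR; rewrite /S_ri gt_eqF// /S_ri_off !D1 mulNr oppr_le0.
  by have [_ hs] := fh_gt0 Is; rewrite pmulr_lge0// invr_gt0.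
have [r0 rR] := Ir; have [fr hr] := fh_gt0 Ir.
have [+ _] := curv r (ltW r0) rR; rewrite /S_zi gt_eqF// /S_zi_off !D1 mulNr oppr_lt0.
rewrite pmulr_lgt0; last by rewrite invr_gt0 mulr_gt0.
move=> hf; split; last exact: h'0.
rewrite leNgt; apply/negP => f0; move: hf; apply/negP; rewrite -leNgt.
by rewrite mulr_ge0_le0 ?h'0 ?ltW.
Qed.

End MetricCoefficients.

(** * The generating curve *)

Section SphericalDerivative.
Context {R : realType} {n : nat}.

Lemma blin_dotp (u : 'rV[R]_n) : blin (dotp u).
Proof.
split=> [k p q|]; first by rewrite dotpDr dotpZr.
exists (\sum_i `|u 0 i| + 1) => [|p]; first by rewrite ltr_wpDl// sumr_ge0.
apply: (le_trans (ler_norm_sum _ _ _)); rewrite mulrDl mulr_suml.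
rewrite ler_wpDr// ?mul1r//; apply: ler_sum => i _; rewrite normrM ler_wpM2l//.
rewrite [leRHS]mx_normrE.
exact: (le_bigmax _ (fun ij : 'I_1 * 'I_n => `|p ij.1 ij.2|) (0, i)).
Qed.

Local Notation V := (cspace R n.+1).

(** The formula for [Y] is known on the unit sphere only, so the derivative is taken along a curve
    that stays on the sphere and has velocity [e]. *)
Lemma derive_sphere_dir (Y : V -> V) (s z y : R) (u e : 'rV[R]_n.+1) :
  differentiable Y (s, u) -> enorm u = 1 -> dotp u e = 0 ->
  (forall u', enorm u' = 1 -> Y (s, u') = (z, y *: u')) ->
  'D_((0, e) : V) Y (s, u) = (0, y *: e).
Proof.
move=> dY u1 ue hY; have uu : dotp u u = 1 by exact/enorm1P.
(* The squared length of [u + x *: e]; multiplying by [c x] normalizes that vector. *)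
pose r (x : R) := 1 + x * x * dotp e e.
have r0 x : 0 < r x.
  by rewrite ltr_pwDl// mulr_ge0 ?dotp_ge0// -expr2 sqr_ge0.
pose c (x : R) := (Num.sqrt (r x))^-1.
have dr : is_derive (0 : R) 1 r 0.
  have := is_derive_add (is_derive_cst (1 : R) (0 : R) (1 : R)) (is_derive_mul
    (is_derive_mul (is_derive_id (0 : R) (1 : R)) (is_derive_id (0 : R) (1 : R)))
    (is_derive_cst (dotp e e) (0 : R) (1 : R))).
  by rewrite !mulr0 !mul0r !addr0 mul0r addr0.
have c1 : c 0 = 1 by rewrite /c /r !mul0r addr0 sqrtr1 invr1.
have dc : is_derive (0 : R) 1 c 0.
  have := is_derive_inv _ (is_derive_sqrt (r0 0) dr).
  by rewrite !mul0r oppr0 mul0r; apply; rewrite sqrtr_eq0 -ltNge r0.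
have dcurve : is_derive (0 : R) 1 (fun x => c x *: u + (x * c x) *: e) e.
  have d2 := is_derive_mul (is_derive_id (0 : R) (1 : R)) dc.
  have e1 := is_derive_blin (blin_scale u) dc.
  have e2 := is_derive_blin (blin_scale e) d2.
  have := is_deriveD e1 e2.
  by rewrite /= scale0r add0r mulr0 addr0 c1 mulr1 scale1r.
have dpair : is_derive (0 : R) 1 (fun x => (s, c x *: u + (x * c x) *: e) : V) (0, e).
  have b2 : blin (fun x : 'rV[R]_n.+1 => (0, x) : V) by exact: blin_pair (@blin_zero _ _ _) (@blin_id _ _).
  have := is_deriveD (is_derive_cst ((s, 0) : V) (0 : R) (1 : R)) (is_derive_blin b2 dcurve).
  rewrite add0r; congr is_derive; apply/funext => x; congr pair; rewrite /= ?addr0 ?add0r//.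
have g0 : (s, c 0 *: u + (0 * c 0) *: e) = (s, u) :> V.
  by rewrite c1 mul0r scale0r addr0 scale1r.
have := is_derive_curve dpair; rewrite g0 => /(_ _ Y dY) [_ <-].
have E x : Y (s, c x *: u + (x * c x) *: e) = (z, y *: (c x *: u + (x * c x) *: e)).
  apply: hY; apply/enorm1P.
  rewrite dotpDl !dotpDr !dotpZl !dotpZr uu ue [dotp e u]dotpC ue.
  rewrite !mulr0 !mulr1 add0r addr0.
  have -> : c x * c x + x * c x * (x * c x * dotp e e) = c x ^+ 2 * r x by rewrite /r; ring.
  by rewrite /c exprVn sqr_sqrtr ?ltW// mulVf// gt_eqF.
rewrite (_ : _ \o _ = fun x => (z, y *: (c x *: u + (x * c x) *: e))); last by apply/funext => x; exact: E.
have b3 : blin (fun x : 'rV[R]_n.+1 => (0, y *: x) : V).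
  apply: blin_pair (@blin_zero _ _ _) _; split=> [k p q|]; first by rewrite scalerDr !scalerA mulrC.
  by exists (`|y| + 1) => [|p]; rewrite ?ltr_wpDl// normrZ ler_wpM2r// lerDl.
have := is_deriveD (is_derive_cst ((z, 0) : V) (0 : R) (1 : R)) (is_derive_blin b3 dcurve).
rewrite add0r => -[_ <-]; apply: (congr1 (fun k : R -> V => 'D_(1 : R) k (0 : R))).
by apply/funext => x; congr pair; rewrite /= ?addr0 ?add0r.
Qed.

End SphericalDerivative.

(** * Coordinates of the generating curve and components of its normal *)

Section Profile.
Context {R : realType} {n : nat}.
Local Notation V := (cspace R n.+2).
Local Notation p0 := (@pole R n.+1).

Section Projections.
Variables (Z : R -> V -> V).

(** Applied to [X] these two give the generating curve, applied to [N] the axial and radial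
    components of the normal. *)
Definition prof_z (p : R * R) : R := (Z p.1 (p.2, p0)).1.
Definition prof_y (p : R * R) : R := (Z p.1 (p.2, p0)).2 0 0.

Lemma profile_smooth (A : set (R * V)) (D : set (R * R)) (c : V -> R) : blin c ->
  smooth_near A (fun p => Z p.1 p.2) -> (forall p, D p -> A (p.1, (p.2, p0))) ->
  smooth_near D (fun p => c (Z p.1 (p.2, p0))).
Proof.
move=> bc [U [oU AU sU]] DA.
have hphi (p q : R * R) : ((p + q).1, ((p + q).2, p0)) =
    (p.1, (p.2, 0)) + (q.1, (q.2, p0)) :> R * V.
  by congr pair; congr pair; rewrite /= add0r.
have bL : blin (fun p : R * R => (p.1, (p.2, (0 : 'rV[R]_n.+2)))).
  exact: blin_pair (@blin_fst _ _ _) (blin_pair (@blin_snd _ _ _) (@blin_zero _ _ _)).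
have [_ sZ] := smooth_on_affine (phi := fun p : R * R => (p.1, (p.2, p0))) oU bL hphi sU.
have oU' : open ((fun p : R * R => (p.1, (p.2, p0))) @^-1` U).
  apply: open_comp => // p _.
  rewrite (_ : (fun p => _) = (fun p : R * R => (p.1, (p.2, 0)) + (0, (0, p0)))); last first.
    by apply/funext => x; congr pair; rewrite /= ?addr0//; congr pair; rewrite /= ?addr0 ?add0r.
  by apply: continuousD; [exact: blin_continuous|exact: cst_continuous].
exists ((fun p : R * R => (p.1, (p.2, p0))) @^-1` U); split=> //.
  by move=> p /DA/AU.
exact: smooth_on_blin oU' bc sZ.
Qed.

Lemma blin_polar : blin (fun v : V => v.2 0 0).
Proof. exact: blin_comp (blin_coord 0) (@blin_snd _ _ _). Qed.

End Projections.

Lemma is_derive_partial1 (F : R * R -> R) (t s : R) : derivable F (t, s) (1, 0) ->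
  is_derive t 1 (fun t => F (t, s)) ('D_((1, 0) : R * R) F (t, s)).
Proof.
move=> dF; apply: (@is_derive_affine _ _ _ _ (fun t => (t, s)) F t 1 (1, 0)).
  by move=> k; congr pair; rewrite /= ?scaler0 ?add0r.
exact: derivableP.
Qed.

Lemma is_derive_partial2 (F : R * R -> R) (t s : R) : derivable F (t, s) (0, 1) ->
  is_derive s 1 (fun s => F (t, s)) ('D_((0, 1) : R * R) F (t, s)).
Proof.
move=> dF; apply: (@is_derive_affine _ _ _ _ (fun s => (t, s)) F s 1 (0, 1)).
  by move=> k; congr pair; rewrite /= ?scaler0 ?add0r.
exact: derivableP.
Qed.

Variables (J : set R) (Rad : \bar R) (f h : R -> R).
Hypothesis hspace : rot_sym_space (n := n.+2) J Rad f h.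
Local Notation g := (@rot_metric R n.+2 f h).
Local Notation M := (@ambient R n.+2 J Rad).
Variables (a b : R) (rho : R -> R) (T : \bar R) (X N : R -> V -> V).
Hypothesis ab : a < b.
Hypothesis flow : flow_with_normal g M a b rho T X N.
Hypothesis sym : forall t s u, time_domain T t -> a <= s <= b -> enorm u = 1 ->
  X t (s, u) = ((X t (s, p0)).1, (X t (s, p0)).2 0 0 *: u).
Local Notation TD := (time_domain T).
Local Notation z := (prof_z X).
Local Notation y := (prof_y X).
Local Notation nu := (prof_z N).
Local Notation w := (prof_y N).
Local Notation Dt F := ('D_((1, 0) : R * R) F).
Local Notation Ds F := ('D_((0, 1) : R * R) F).

Definition strip : set (R * R) := [set p | TD p.1 /\ a <= p.2 <= b].

Let sX := proj1 (let: And4 x _ _ _ := flow in x).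
Let sN := proj2 (let: And4 x _ _ _ := flow in x).
Let flow_t t (Tt : TD t) := (let: And4 _ _ x _ := flow in x) t Tt.
Let flow_eq t q (Tt : TD t) (cq : cyl a b q) := (let: And4 _ _ _ x := flow in x) t q Tt cq.

Let stripA p : strip p -> [set p : R * V | TD p.1 /\ cyl a b p.2] (p.1, (p.2, p0)).
Proof. by move=> [pt ps]; split=> //; split=> //=; exact: enorm_pole. Qed.

Lemma prof_smooth : [/\ smooth_near strip z, smooth_near strip y,
  smooth_near strip nu & smooth_near strip w].
Proof.
have b1 : blin (fst : V -> R) by exact: blin_fst.
have b2 : blin (fun v : V => v.2 0 0) by exact: blin_polar.
by split; [exact: profile_smooth b1 sX stripA|exact: profile_smooth b2 sX stripA|
  exact: profile_smooth b1 sN stripA|exact: profile_smooth b2 sN stripA].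
Qed.

Lemma smooth_near_derivable (D : set (R * R)) (F : R * R -> R) p v : smooth_near D F -> D p -> derivable F p v.
Proof. by move=> [U [oU DU sU]] /DU; exact: smooth_on_derivable. Qed.

Let dXt t q : TD t -> cyl a b q -> differentiable (X t) q.
Proof.
move=> Tt cq; have [U [oU cU sU]] := flow_slice sX Tt.
exact: smooth_cspace_differentiable oU sU (cU _ cq).
Qed.

Let dNt t q : TD t -> cyl a b q -> differentiable (N t) q.
Proof.
move=> Tt cq; have [U [oU cU sU]] := flow_slice sN Tt.
exact: smooth_cspace_differentiable oU sU (cU _ cq).
Qed.

Lemma prof_X t s u : TD t -> a <= s <= b -> enorm u = 1 ->
  X t (s, u) = (z (t, s), y (t, s) *: u).
Proof. exact: sym. Qed.

Lemma is_derive_axis (Y : V -> V) s u : differentiable Y (s, u) ->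
  is_derive s 1 (fun s => Y (s, u)) ('D_((1, 0) : V) Y (s, u)).
Proof.
move=> dY; apply: (@is_derive_affine _ _ _ _ (fun s => (s, u)) Y s 1 (1, 0)).
  by move=> k; congr pair; rewrite /= ?scaler0 ?add0r.
exact/derivableP/diff_derivable.
Qed.

(** The expression for [Y] holds only for [s] in [[a, b]], so both components are compared through
    one-sided derivatives. *)
Lemma prof_ds (Y : V -> V) (F G : R * R -> R) t s u : differentiable Y (s, u) ->
  derivable F (t, s) (0, 1) -> derivable G (t, s) (0, 1) -> a <= s <= b ->
  (forall s, a <= s <= b -> Y (s, u) = (F (t, s), G (t, s) *: u)) ->
  'D_((1, 0) : V) Y (s, u) = (Ds F (t, s), Ds G (t, s) *: u).
Proof.
move=> dY dF dG sab E; have d := is_derive_axis dY.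
have d1 := is_derive_blin (@blin_fst _ _ _) d.
have d2 := is_derive_blin (@blin_snd _ _ _) d.
have e1 := is_derive_partial2 dF.
have e2 := is_derive_blin (blin_scale u) (is_derive_partial2 dG).
have E1 := is_derive_segment_eq ab sab d1 e1 (fun s' h' => congr1 fst (E s' h')).
have E2 := is_derive_segment_eq ab sab d2 e2 (fun s' h' => congr1 snd (E s' h')).
by rewrite [LHS]surjective_pairing E1 E2.
Qed.

Lemma prof_Xs t s u : TD t -> a <= s <= b -> enorm u = 1 ->
  'D_((1, 0) : V) (X t) (s, u) = (Ds z (t, s), Ds y (t, s) *: u).
Proof.
move=> Tt sab u1; have [hz hy _ _] := prof_smooth.
apply: prof_ds => //.
- exact: dXt.
- exact: smooth_near_derivable hz _.
- exact: smooth_near_derivable hy _.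
- by move=> s' sab'; exact: prof_X.
Qed.

Lemma prof_Xu t s u e : TD t -> a <= s <= b -> enorm u = 1 -> dotp u e = 0 ->
  'D_((0, e) : V) (X t) (s, u) = (0, y (t, s) *: e).
Proof.
move=> Tt sab u1 ue; apply: (derive_sphere_dir (z := z (t, s))) => //.
  exact: dXt.
by move=> u' u1'; exact: prof_X.
Qed.

Lemma time_domain_sub t t' : TD t -> 0 <= t' <= t -> TD t'.
Proof.
move=> [t0 tT] /andP[t'0 t't]; split=> //; apply: le_lt_trans tT.
by rewrite lee_fin.
Qed.

(** The derivative of [X t] along a direction tangent to the sphere is [y] times that direction, so
    an immersion forbids [y = 0]. *)
Lemma prof_y0 t s : TD t -> a <= s <= b -> y (t, s) != 0.
Proof.
move=> Tt sab; apply/eqP => y0.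
pose e : 'rV[R]_n.+2 := consv 0 (@pole R n).
have pe : dotp p0 e = 0 by rewrite dotp_consv mulr0 dotp0l addr0.
have ee : dotp e e = 1 by rewrite dotp_consv mulr0 add0r dotp_pole.
have [_ imm _ _] := flow_t Tt.
have cq : cyl a b (s, p0) by split=> //; exact: enorm_pole.
have e0 : ((0, e) : V) != 0.
  apply/eqP => -[E]; move: ee; rewrite E dotp0l => /eqP.
  by rewrite eq_sym oner_eq0.
have := imm _ cq (0, e) pe e0; rewrite (prof_Xu Tt sab enorm_pole pe) y0 scale0r.
by rewrite eqxx.
Qed.

Hypothesis rho0 : forall z, a <= z <= b -> 0 < rho z.

Let init t s u : TD t -> a <= s <= b -> enorm u = 1 -> X 0 (s, u) = (s, rho s *: u) /\
  0 < g (X 0 (s, u)) (N 0 (s, u)) (e_r (X 0 (s, u))).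
Proof.
move=> Tt sab u1; have [_ + _ _] := flow.
by move=> /(_ (s, u)); apply.
Qed.

Let TD0 t : TD t -> TD 0.
Proof. by move=> Tt; have [t0 _] := Tt; apply: (time_domain_sub Tt); rewrite lexx. Qed.

Lemma prof_init t s : TD t -> a <= s <= b -> z (0, s) = s /\ y (0, s) = rho s.
Proof.
move=> Tt sab; have [E _] := init Tt sab enorm_pole; split.
  by rewrite /prof_z E.
by rewrite /prof_y E /= mxE consv0 mulr1.
Qed.

(** [y] starts at [rho > 0] and cannot change sign in time without vanishing. *)
Lemma prof_y_gt0 t s : TD t -> a <= s <= b -> 0 < y (t, s).
Proof.
move=> Tt sab; have t0 : 0 <= t by case: Tt.
have [_ hy _ _] := prof_smooth.
have TD' x : 0 <= x <= t -> TD x by exact: time_domain_sub.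
apply: (@segment_positive _ (fun t => y (t, s)) 0 t t0).
- apply: is_derive_segment_continuous => x xt; apply: is_derive_partial1.
  by apply: smooth_near_derivable hy _; split=> //; exact: TD'.
- by move=> x /TD' Tx; exact: prof_y0.
- by have [_ ->] := prof_init Tt sab; exact: rho0.
Qed.

Lemma prof_radii t s : TD t -> a <= s <= b -> radii Rad (y (t, s)).
Proof.
move=> Tt sab; split; first exact: prof_y_gt0.
have [+ _ _ _] := flow_t Tt; move=> /(_ (s, p0) (conj sab enorm_pole)) [_].
by rewrite prof_X// ?enorm_pole// /= enormZ enorm_pole mulr1 gtr0_norm// prof_y_gt0.
Qed.

Let fh_gt0 r : radii Rad r -> 0 < f r /\ 0 < h r.
Proof. by have [_ _ _ + _] := hspace; move=> + [r0 rR]; apply. Qed.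

Let nuu t s u := (N t (s, u)).1.
Let wu t s u := dotp u (N t (s, u)).2.

Let metric_radial z r u v1 v2 w1 w2 : 0 < r -> enorm u = 1 ->
  g (z, r *: u) (v1, v2 *: u) (w1, w2 *: u) = f r ^+ 2 * (v1 * w1) + v2 * w2.
Proof.
move=> r0 u1; have := metric_polar f h z v1 v2 w1 w2 r0 u1 (dotp0r u) (dotp0r u).
by rewrite !addr0 dotp0r mulr0 addr0.
Qed.

(** Orthogonality to the image of the sphere direction [e], where [e] is the tangential part of the
    normal itself, forces [e = 0]. *)
Let N_radial t s u : TD t -> a <= s <= b -> enorm u = 1 ->
  N t (s, u) = (nuu t s u, wu t s u *: u).
Proof.
move=> Tt sab u1; have uu : dotp u u = 1 by exact/enorm1P.
pose e := (N t (s, u)).2 - wu t s u *: u.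
have ue : dotp u e = 0 by rewrite dotpBr dotpZr uu mulr1 subrr.
have [_ _ /(_ (s, u) (conj sab u1))[nrm _] _] := flow_t Tt.
have := nrm (0, e) ue; rewrite (prof_Xu Tt sab u1 ue) prof_X//.
have -> : N t (s, u) = (nuu t s u, wu t s u *: u + e).
  by rewrite addrC subrK -surjective_pairing.
have yu : dotp u (y (t, s) *: e) = 0 by rewrite dotpZr ue mulr0.
have y0 := prof_y_gt0 Tt sab.
have := metric_polar f h (z (t, s)) (nuu t s u) (wu t s u) 0 0 y0 u1 ue yu.
rewrite scale0r add0r => ->; rewrite !mulr0 !add0r dotpZr => /eqP.
have [_ hy0] := fh_gt0 (prof_radii Tt sab).
have q0 : (h (y (t, s)) / y (t, s)) ^+ 2 != 0.
  by rewrite expf_neq0// mulf_neq0 ?invr_eq0 ?gt_eqF.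
rewrite mulf_eq0 (negbTE q0)/= mulf_eq0 (gt_eqF y0)/= dotp_eq0.
by move=> /eqP ->; rewrite addr0.
Qed.

(** Linear algebra in the half-plane, with [F] standing for the square of [f]: a vector orthogonal
    to the unit normal [(v, c)] is a multiple of [(c, - F * v)]. *)
Lemma unit_normal_frame (F zs ys v c : R) : c ^+ 2 + F * v ^+ 2 = 1 -> F * v * zs + c * ys = 0 ->
  zs = (zs * c - ys * v) * c /\ ys = - (zs * c - ys * v) * F * v.
Proof.
move=> E1 E2; split.
  have -> : (zs * c - ys * v) * c =
    zs * (c ^+ 2 + F * v ^+ 2) - v * (F * v * zs + c * ys) by ring.
  by rewrite E1 E2; ring.
have -> : - (zs * c - ys * v) * F * v =
  ys * (c ^+ 2 + F * v ^+ 2) - c * (F * v * zs + c * ys) by ring.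
by rewrite E1 E2; ring.
Qed.

Let N_unit t s u : TD t -> a <= s <= b -> enorm u = 1 ->
  wu t s u ^+ 2 + f (y (t, s)) ^+ 2 * nuu t s u ^+ 2 = 1.
Proof.
move=> Tt sab u1; have y0 := prof_y_gt0 Tt sab.
have [_ _ /(_ (s, u) (conj sab u1))[_ +] _] := flow_t Tt.
by rewrite N_radial// prof_X// metric_radial// => <-; ring.
Qed.

Let N_orth t s u : TD t -> a <= s <= b -> enorm u = 1 ->
  f (y (t, s)) ^+ 2 * nuu t s u * Ds z (t, s) + wu t s u * Ds y (t, s) = 0.
Proof.
move=> Tt sab u1; have y0 := prof_y_gt0 Tt sab.
have [_ _ /(_ (s, u) (conj sab u1))[/(_ (1, 0)) + _] _] := flow_t Tt.
have tg : cyl_tangent (s, u) ((1, 0) : V) by rewrite /cyl_tangent/= dotp0r.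
rewrite prof_Xs// N_radial// prof_X// metric_radial// => /(_ tg) E0.
by rewrite -[RHS]E0; ring.
Qed.

Let kk t s u := Ds z (t, s) * wu t s u - Ds y (t, s) * nuu t s u.

Let kk_neq0 t s u : TD t -> a <= s <= b -> enorm u = 1 -> kk t s u != 0.
Proof.
move=> Tt sab u1; apply/eqP => k0.
have [E1 E2] := unit_normal_frame (N_unit Tt sab u1) (N_orth Tt sab u1).
move: E1 E2; rewrite -/(kk t s u) k0 oppr0 !mul0r => E1 E2.
have [_ imm _ _] := flow_t Tt.
have e0 : ((1, 0) : V) != 0.
  by apply/eqP => -[/eqP]; rewrite oner_eq0.
have tg : cyl_tangent (s, u) ((1, 0) : V) by rewrite /cyl_tangent/= dotp0r.
have := imm (s, u) (conj sab u1) _ tg e0.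
by rewrite prof_Xs// E1 E2 scale0r eqxx.
Qed.

(** The immersion property excludes zeros, and at time 0 the sign is fixed by [z_s = 1] and the
    outward normal. *)
Let kk_gt0 t s u : TD t -> a <= s <= b -> enorm u = 1 -> 0 < kk t s u.
Proof.
move=> Tt sab u1; have t0 : 0 <= t by case: Tt.
have TD' x : 0 <= x <= t -> TD x by exact: time_domain_sub.
have [hz hy _ _] := prof_smooth.
apply: (@segment_positive _ (fun t => kk t s u) 0 t t0).
- apply: (is_derive_segment_continuous (df := 'D_1 (fun t => kk t s u))) => x /TD' Tx.
  apply: derivableP.
  have Sx : strip (x, s) by [].
  have smD (F : R * R -> R) : smooth_near strip F -> derivable (Ds F) (x, s) (1, 0).
    by move=> [U [oU DU sU]]; exact: smooth_on_derivable (smooth_on_derive _ sU) _ _ (DU _ Sx).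
  have dN := flow_derivable_time sN Tx (conj sab u1 : cyl a b (s, u)).
  have d1 := is_derive_blin (@blin_fst _ _ _) dN.
  have bu : blin (fun v : V => dotp u v.2).
    by apply: (blin_comp (c := dotp u) _ (@blin_snd _ _ _)); exact: blin_dotp.
  have d2 := is_derive_blin bu dN.
  have [d _] := is_derive_sub (is_derive_mul (is_derive_partial1 (smD _ hz)) d2)
    (is_derive_mul (is_derive_partial1 (smD _ hy)) d1).
  exact: d.
- by move=> x /TD' Tx; exact: kk_neq0.
have T0 := TD0 Tt; have S0 : strip (0, s) by [].
have zs : Ds z (0, s) = 1.
  have dz := is_derive_partial2 (smooth_near_derivable hz S0).
  apply: (is_derive_segment_eq ab sab dz (is_derive_id s (1 : R))) => x xab.
  by have [] := prof_init Tt xab.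
have y0 := prof_y_gt0 T0 sab.
have w0 : 0 < wu 0 s u.
  have [_ +] := init Tt sab u1; rewrite N_radial// prof_X//.
  rewrite (_ : e_r _ = (0, 1 *: u)) ?metric_radial//.
    by rewrite mulr0 mulr0 add0r mulr1.
  by rewrite /e_r/= enormZ u1 mulr1 gtr0_norm// scalerA mulVf ?gt_eqF.
have [E1 _] := unit_normal_frame (N_unit T0 sab u1) (N_orth T0 sab u1).
have Ek : kk 0 s u * wu 0 s u = 1 by exact: (etrans (esym E1) zs).
by rewrite -(pmulr_lgt0 _ w0) Ek.
Qed.

Let kk_sqr t s u : TD t -> a <= s <= b -> enorm u = 1 ->
  f (y (t, s)) ^+ 2 * kk t s u ^+ 2 = f (y (t, s)) ^+ 2 * Ds z (t, s) ^+ 2 + Ds y (t, s) ^+ 2.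
Proof.
move=> Tt sab u1.
have [E1 E2] := unit_normal_frame (N_unit Tt sab u1) (N_orth Tt sab u1).
rewrite {1}E1 {2}E2 -/(kk t s u); have := N_unit Tt sab u1.
move: (f _) (kk _ _ _) (wu _ _ _) (nuu _ _ _) => F k c v E.
by rewrite -[LHS]mulr1 -E; ring.
Qed.

(* The sign of [kk] is constant in time and [kk_sqr] gives its square independently of u. *)
Lemma prof_N t s u : TD t -> a <= s <= b -> enorm u = 1 ->
  N t (s, u) = (nu (t, s), w (t, s) *: u).
Proof.
move=> Tt sab u1; rewrite N_radial//.
have p1 : enorm p0 = 1 by exact: enorm_pole.
have [fy _] := fh_gt0 (prof_radii Tt sab).
have kE : kk t s u = kk t s p0.
  apply/eqP; rewrite -(eqrXn2 (n := 2)) ?ltW ?kk_gt0//; apply/eqP.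
  by apply: (mulfI (lt0r_neq0 (exprn_gt0 2 fy))); rewrite !kk_sqr.
have k0 := lt0r_neq0 (kk_gt0 Tt sab p1).
have [E1 E2] := unit_normal_frame (N_unit Tt sab u1) (N_orth Tt sab u1).
have [E1' E2'] := unit_normal_frame (N_unit Tt sab p1) (N_orth Tt sab p1).
have Ew : wu t s u = wu t s p0.
  by apply: (mulfI k0); rewrite -{1}kE -[LHS]E1 [LHS]E1'.
have En : nuu t s u = nuu t s p0.
  have F0 : - kk t s p0 * f (y (t, s)) ^+ 2 != 0.
    by rewrite mulf_neq0 ?oppr_eq0 ?expf_eq0 ?(gt_eqF fy).
  by apply: (mulfI F0); rewrite -{1}kE -[LHS]E2 [LHS]E2'.
rewrite Ew En; congr (_, _ *: _).
by rewrite /prof_y N_radial//= mxE consv0 mulr1.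
Qed.

(* The speed of the generating curve divided by f: [z_s = k w] and [y_s = - k f^2 nu]. *)
Definition prof_k p : R := Ds z p * w p - Ds y p * nu p.

Let wuE t s : TD t -> a <= s <= b -> wu t s p0 = w (t, s).
Proof.
move=> Tt sab; rewrite /wu prof_N//; last exact: enorm_pole.
by rewrite dotpZr dotp_pole mulr1.
Qed.

Lemma prof_unit p : strip p -> w p ^+ 2 + f (y p) ^+ 2 * nu p ^+ 2 = 1.
Proof. by case: p => t s [/= Tt sab]; rewrite -wuE// N_unit//; exact: enorm_pole. Qed.

Lemma prof_k_gt0 p : strip p -> 0 < prof_k p.
Proof.
case: p => t s [/= Tt sab]; have := kk_gt0 Tt sab (enorm_pole (n := n.+1)).
by rewrite /kk wuE.
Qed.

Lemma prof_tangent p : strip p ->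
  Ds z p = prof_k p * w p /\ Ds y p = - prof_k p * f (y p) ^+ 2 * nu p.
Proof.
case: p => t s Sp; have [/= Tt sab] := Sp; apply: unit_normal_frame; first exact: prof_unit.
by have := N_orth Tt sab (enorm_pole (n := n.+1)); rewrite wuE.
Qed.

Lemma prof_Ns t s u : TD t -> a <= s <= b -> enorm u = 1 ->
  'D_((1, 0) : V) (N t) (s, u) = (Ds nu (t, s), Ds w (t, s) *: u).
Proof.
move=> Tt sab u1; have [_ _ hn hw] := prof_smooth.
apply: prof_ds => //.
- exact: dNt.
- exact: smooth_near_derivable hn _.
- exact: smooth_near_derivable hw _.
- by move=> s' sab'; exact: prof_N.
Qed.

Lemma prof_Nu t s u e : TD t -> a <= s <= b -> enorm u = 1 -> dotp u e = 0 ->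
  'D_((0, e) : V) (N t) (s, u) = (0, w (t, s) *: e).
Proof.
move=> Tt sab u1 ue; apply: (derive_sphere_dir (z := nu (t, s))) => //.
  exact: dNt.
by move=> u' u1'; exact: prof_N.
Qed.

(** The normal itself is an admissible vector in the orthogonality clause, which then reads
    [f ^+ 2 * nu = 0]. *)
Lemma prof_boundary t s : TD t -> s = a \/ s = b -> nu (t, s) = 0 /\ (z (t, s) = a \/ z (t, s) = b).
Proof.
move=> Tt sb; have sab : a <= s <= b by case: sb => ->; rewrite lexx ltW.
have p1 : enorm p0 = 1 by exact: enorm_pole.
have [_ _ un /(_ (s, p0) (conj sb p1))[zb orth]] := flow_t Tt.
split=> //; have [nrm _] := un _ (conj sab p1 : cyl a b (s, p0)).
have [fy _] := fh_gt0 (prof_radii Tt sab).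
have := orth _ nrm; rewrite prof_N// prof_X// (_ : e_z = (1, 0 *: p0)); last by rewrite scale0r.
rewrite metric_radial ?prof_y_gt0// mulr0 addr0 mulr1 => /eqP.
by rewrite mulf_eq0 expf_eq0 (gt_eqF fy)/= => /eqP.
Qed.

(** The normal speed of the flow, evaluated over the pole. *)
Definition prof_V p : R := average_mean_curvature g a b (X p.1) (N p.1)
  - mean_curvature g (X p.1) (N p.1) (p.2, p0).

Lemma prof_dt p : strip p -> Dt z p = prof_V p * nu p /\ Dt y p = prof_V p * w p.
Proof.
case: p => t s [/= Tt sab]; have cq : cyl a b (s, p0) by split=> //; exact: enorm_pole.
have [hz hy _ _] := prof_smooth; have Sp : strip (t, s) by [].
have dX := flow_derivable_time sX Tt cq.
have [dX1 dX2] := dX; rewrite flow_eq// in dX2; rewrite -dX2 in dX.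
have [_ E1] := is_derive_blin (@blin_fst _ _ _) dX.
have [_ E2] := is_derive_blin (@blin_polar) dX.
have [_ E3] := is_derive_partial1 (smooth_near_derivable hz Sp).
have [_ E4] := is_derive_partial1 (smooth_near_derivable hy Sp).
split; first exact: (etrans (esym E3) E1).
apply: (etrans (esym E4) (etrans E2 _)).
by rewrite /= mxE.
Qed.

End Profile.

(** * Area element and mean curvature of a hypersurface of revolution *)

Section ProfileCurvature.
Context {R : realType} {n : nat}.
Local Notation V := (cspace R n.+2).
Local Notation p0 := (@pole R n.+1).
Variables (J : set R) (Rad : \bar R) (f h : R -> R).
Hypothesis hspace : rot_sym_space (n := n.+2) J Rad f h.
Local Notation g := (@rot_metric R n.+2 f h).
Local Notation M := (@ambient R n.+2 J Rad).

Let fh_gt0 r : radii Rad r -> 0 < f r /\ 0 < h r.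
Proof. by have [_ _ _ + _] := hspace; move=> + [r0 rR]; apply. Qed.

(** Along the straight line in direction [(v, c *: u)] the radial direction stays [u], so
    [metric_polar] applies at every point of it and the claim becomes a one-variable derivative. *)
Lemma metric_normal_derive z r c v v1 v2 (u e : 'rV[R]_n.+2) :
  J z -> radii Rad r -> enorm u = 1 -> dotp u e = 0 ->
  'D_((v, c *: u) : V) (fun p => g p (v1, v2 *: u + e) (v1, v2 *: u + e)) (z, r *: u) =
  c * (2 * f r * 'D_1 f r * v1 ^+ 2
       + 2 * (h r / r) * (('D_1 h r * r - h r) / r ^+ 2) * dotp e e).
Proof.
move=> Jz Ir u1 ue; have [r0 rR] := Ir; set Y := (v1, _).
pose G p := g p Y Y.
have Mp : M (z, r *: u) by split=> //=; rewrite enormZ u1 mulr1 gtr0_norm.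
have dG : differentiable G (z, r *: u) by exact: (metric_differentiable hspace).
have aff (k l : R) : is_derive (0 : R) 1 (fun x => k + x * l) l.
  have := is_derive_add (is_derive_cst k (0 : R) (1 : R)) (is_derive_mul
    (is_derive_id (0 : R) (1 : R)) (is_derive_cst l (0 : R) (1 : R))).
  by rewrite mulr0 add0r addr0 mul1r.
have dc : is_derive (0 : R) 1 (fun x : R => (z, r *: u) + x *: ((v, c *: u) : V)) (v, c *: u).
  have := is_deriveD (is_derive_cst ((z, r *: u) : V) (0 : R) (1 : R))
    (is_derive_blin (blin_scale ((v, c *: u) : V)) (is_derive_id (0 : R) (1 : R))).
  by rewrite add0r scale1r.
have g0 : (z, r *: u) + 0 *: ((v, c *: u) : V) = (z, r *: u) by rewrite scale0r addr0.
have := is_derive_curve dc; rewrite g0 => /(_ _ G dG) [_ <-].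
pose rr (x : R) := r + x * c.
have rr0 : rr 0 = r by rewrite /rr mul0r addr0.
have Ir' : radii Rad (rr 0) by rewrite rr0.
have df := is_derive_comp (aff r c) (Ck_is_derive (metric_coef_f_smooth hspace Jz 1) Ir').
have dh := is_derive_comp (aff r c) (Ck_is_derive (metric_coef_h_smooth hspace Jz 1) Ir').
have rn : rr 0 != 0 by rewrite rr0 gt_eqF.
have dq := is_derive_mul dh (is_derive_inv rn (aff r c)).
pose phi x := f (rr x) * f (rr x) * (v1 * v1) + v2 * v2
   + (h (rr x) / rr x) * (h (rr x) / rr x) * dotp e e.
have dphi := is_derive_add (is_derive_add
  (is_derive_mul (is_derive_mul df df) (is_derive_cst (v1 * v1) (0 : R) (1 : R)))
  (is_derive_cst (v2 * v2) (0 : R) (1 : R)))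
  (is_derive_mul (is_derive_mul dq dq) (is_derive_cst (dotp e e) (0 : R) (1 : R))).
transitivity ('D_(1 : R) phi (0 : R)).
  apply: near_eq_derive.
  have : \forall x \near (0 : R), 0 < rr x.
    by apply: (cvgr_gt _ (is_derive_continuous (aff r c))); rewrite -/(rr 0) rr0.
  apply: filterS => x rx; rewrite /G /=.
  have -> : (z, r *: u) + x *: ((v, c *: u) : V) = (z + x * v, rr x *: u).
    by congr pair; rewrite /= scalerDl scalerA.
  by rewrite /G /Y metric_polar// /phi !expr2.
have [_ ->] := dphi; rewrite /= -/(rr 0) rr0.
move: ('D_1 f r) ('D_1 h r) (f r) (h r) (dotp e e) => f' h' fr hr d.
by field; exact: lt0r_neq0.
Qed.

Variables (a b : R) (rho : R -> R) (T : \bar R) (X N : R -> V -> V).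
Hypothesis ab : a < b.
Hypothesis flow : flow_with_normal g M a b rho T X N.
Hypothesis sym : forall t s u, time_domain T t -> a <= s <= b -> enorm u = 1 ->
  X t (s, u) = ((X t (s, p0)).1, (X t (s, p0)).2 0 0 *: u).
Hypothesis rho0 : forall z, a <= z <= b -> 0 < rho z.
Local Notation TD := (time_domain T).
Local Notation strip := (strip a b T).
Local Notation z := (prof_z X).
Local Notation y := (prof_y X).
Local Notation nu := (prof_z N).
Local Notation w := (prof_y N).
Local Notation k := (prof_k X N).
Local Notation Dt F := ('D_((1, 0) : R * R) F).
Local Notation Ds F := ('D_((0, 1) : R * R) F).

Let sX := proj1 (let: And4 x _ _ _ := flow in x).
Let sN := proj2 (let: And4 x _ _ _ := flow in x).
Let flow_t t (Tt : TD t) := (let: And4 _ _ x _ := flow in x) t Tt.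

Let metric_diff t s u v1 v2 : TD t -> a <= s <= b -> enorm u = 1 ->
  differentiable (fun p => g p v1 v2) (X t (s, u)).
Proof.
move=> Tt sab u1; apply: (metric_differentiable hspace).
by have [+ _ _ _] := flow_t Tt; apply.
Qed.

Let diffX t s u : TD t -> a <= s <= b -> enorm u = 1 -> differentiable (X t) (s, u).
Proof.
move=> Tt sab u1; have [U [oU cU sU]] := flow_slice sX Tt.
exact: smooth_cspace_differentiable oU sU (cU (s, u) (conj sab u1)).
Qed.

Let diffN t s u : TD t -> a <= s <= b -> enorm u = 1 -> differentiable (N t) (s, u).
Proof.
move=> Tt sab u1; have [U [oU cU sU]] := flow_slice sN Tt.
exact: smooth_cspace_differentiable oU sU (cU (s, u) (conj sab u1)).
Qed.

Let Jz t s : TD t -> a <= s <= b -> J (z (t, s)).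
Proof.
move=> Tt sab; have [+ _ _ _] := flow_t Tt.
by move=> /(_ (s, p0) (conj sab enorm_pole)) [].
Qed.

Lemma rot_metric_sym p v v' : g p v v' = g p v' v.
Proof.
rewrite /rot_metric/=; case: ifP => _; first by rewrite mulrC dotpC.
by rewrite [v.1 * _]mulrC [dotp p.2 v.2 / _ * _]mulrC [dotp (_ *: _) _]dotpC.
Qed.

(** The Gram matrix is diagonal in the adapted frame, so the trace needs only the diagonal entries
    of the second form. *)
Let radial_frame t s u : TD t -> a <= s <= b -> enorm u = 1 -> exists e : 'I_n.+2 -> V,
  [/\ frame (s, u) e,
   forall i j, i != j -> gramb g (X t) (s, u) (e i) (e j) = 0,
   gramb g (X t) (s, u) (e 0) (e 0) = (f (y (t, s)) * k (t, s)) ^+ 2 /\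
   secb g (X t) (N t) (s, u) (e 0) (e 0) =
     f (y (t, s)) ^+ 2 * (Ds nu (t, s) * Ds z (t, s)) + Ds w (t, s) * Ds y (t, s)
     + w (t, s) * f (y (t, s)) * 'D_1 f (y (t, s)) * Ds z (t, s) ^+ 2 &
   forall i, gramb g (X t) (s, u) (e (lift 0 i)) (e (lift 0 i)) = h (y (t, s)) ^+ 2 /\
   secb g (X t) (N t) (s, u) (e (lift 0 i)) (e (lift 0 i)) =
     w (t, s) * h (y (t, s)) * 'D_1 h (y (t, s))].
Proof.
move=> Tt sab u1; have [e [fe e0 ei]] := @frame_exists R n.+1 (s, u) u1.
have Sp : strip (t, s) by [].
have Ir := prof_radii flow sym rho0 Tt sab; have [r0 _] := Ir.
have [fe1 fe2] := fe.
have ue i : dotp u (e (lift 0 i)).2 = 0 by exact: fe1.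
have eE i : e (lift 0 i) = (0, (e (lift 0 i)).2) by rewrite [LHS]surjective_pairing ei.
have DX0 : 'D_(e 0) (X t) (s, u) = (Ds z (t, s), Ds y (t, s) *: u + 0).
  by rewrite e0 addr0 (prof_Xs ab flow sym).
have DXi i : 'D_(e (lift 0 i)) (X t) (s, u) = (0, 0 *: u + y (t, s) *: (e (lift 0 i)).2).
  by rewrite eE (prof_Xu flow sym)//= scale0r add0r.
have DN0 : 'D_(e 0) (N t) (s, u) = (Ds nu (t, s), Ds w (t, s) *: u + 0).
  by rewrite e0 addr0 (prof_Ns hspace ab flow sym rho0).
have DNi i : 'D_(e (lift 0 i)) (N t) (s, u) = (0, 0 *: u + w (t, s) *: (e (lift 0 i)).2).
  by rewrite eE (prof_Nu hspace ab flow sym rho0)//= scale0r add0r.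
have XE := prof_X sym Tt sab u1.
have NE := prof_N hspace ab flow sym rho0 Tt sab u1.
have ee i j : dotp (e (lift 0 i)).2 (e (lift 0 j)).2 = (i == j)%:R.
  have := fe2 (lift 0 i) (lift 0 j); rewrite /ip ei mul0r add0r => ->.
  by rewrite (inj_eq (@lift_inj _ _)).
have dZ0 i c : dotp u (c *: (e (lift 0 i)).2) = 0 by rewrite dotpZr ue mulr0.
have d00 := dotp0r u.
have gs : forall p v v', g p v v' = g p v' v by exact: rot_metric_sym.
have gd : forall v v', differentiable (fun p => g p v v') (X t (s, u)).
  by move=> v v'; exact: metric_diff.
have [Ez Ey] := prof_tangent hspace ab flow sym rho0 Sp.
have Eu := prof_unit hspace ab flow sym rho0 Sp.
exists e; split=> //.
- move=> i j; rewrite /gramb XE.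
  case: (unliftP 0 i) => [i' ->|->]; case: (unliftP 0 j) => [j' ->|->] ij.
  + rewrite !DXi metric_polar// dotpZl dotpZr ee.
    by rewrite (inj_eq (@lift_inj _ _)) in ij; rewrite (negbTE ij) !mulr0 !addr0.
  + by rewrite DX0 DXi metric_polar// dotp0r !mul0r !mulr0 !addr0.
  + by rewrite DX0 DXi metric_polar// dotp0l !mulr0 !addr0.
  + by move: ij; rewrite eqxx.
- split.
    rewrite /gramb XE DX0 metric_polar// dotp0r mulr0 addr0 Ez Ey.
    rewrite -[RHS]mulr1 -Eu; move: (f _) (k _) (w _) (nu _) => F K c v; ring.
  rewrite /secb christoffel_diag// XE DX0 DN0 NE metric_polar// dotp0r mulr0 addr0.
  rewrite metric_normal_derive//; last exact: Jz.
  by rewrite dotp0r mulr0 addr0; field.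
- move=> i; split.
    rewrite /gramb XE DXi metric_polar// dotpZl dotpZr ee eqxx mulr1n.
    by field; exact: lt0r_neq0.
  rewrite /secb christoffel_diag// XE DXi DNi NE metric_polar// !dotpZl !dotpZr ee eqxx mulr1n.
  rewrite metric_normal_derive//; last exact: Jz.
  rewrite dotpZl dotpZr ee eqxx mulr1n.
  by field; exact: lt0r_neq0.
Qed.

Lemma prof_area t s u : TD t -> a <= s <= b -> enorm u = 1 ->
  area_element g (X t) (s, u) = f (y (t, s)) * k (t, s) * h (y (t, s)) ^+ n.+1.
Proof.
move=> Tt sab u1; have [e [fe gij [g0 _] gi]] := radial_frame Tt sab u1.
have Sp : strip (t, s) by [].
have [fr hr] := fh_gt0 (prof_radii flow sym rho0 Tt sab).
have k0 := prof_k_gt0 hspace ab flow sym rho0 Sp.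
rewrite (area_element_frame f h _ fe)//; last exact: diffX.
have [|_ ->] := @form_diag R n.+2 (gramb g (X t) (s, u)) (gramb g (X t) (s, u)) e gij.
  move=> i; case: (unliftP 0 i) => [j ->|->].
    by have [-> _] := gi j; rewrite expf_neq0// gt_eqF.
  by rewrite g0 expf_neq0// mulf_neq0// gt_eqF.
rewrite big_ord_recl g0 (eq_bigr (fun=> h (y (t, s)) ^+ 2)); last by move=> i _; have [] := gi i.
rewrite prodr_const card_ord -exprM mulnC exprM -exprMn sqrtr_sqr gtr0_norm//.
by rewrite !mulr_gt0// exprn_gt0.
Qed.

(** The spheres have dimension [n.+1] and each of their directions contributes [w h' / h]; the other
    two terms are the principal curvature along the generating curve. *)
Lemma prof_H t s u : TD t -> a <= s <= b -> enorm u = 1 ->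
  mean_curvature g (X t) (N t) (s, u) =
  (w (t, s) * Ds nu (t, s) - nu (t, s) * Ds w (t, s)) / k (t, s)
  + w (t, s) ^+ 3 * ('D_1 f (y (t, s)) / f (y (t, s)))
  + n.+1%:R * w (t, s) * ('D_1 h (y (t, s)) / h (y (t, s))).
Proof.
move=> Tt sab u1; have [e [fe gij [g0 s0] gi]] := radial_frame Tt sab u1.
have Sp : strip (t, s) by [].
have [fr hr] := fh_gt0 (prof_radii flow sym rho0 Tt sab).
have k0 := prof_k_gt0 hspace ab flow sym rho0 Sp.
have [Ez Ey] := prof_tangent hspace ab flow sym rho0 Sp.
rewrite (@mean_curvature_frame R n.+1 f h (X t) (N t) (s, u) e u1 fe)//; first last.
- by move=> v v'; exact: metric_diff.
- exact: diffN.
- exact: diffX.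
have [|-> _] := @form_diag R n.+2 (secb g (X t) (N t) (s, u)) (gramb g (X t) (s, u)) e gij.
  move=> i; case: (unliftP 0 i) => [j ->|->].
    by have [-> _] := gi j; rewrite expf_neq0// gt_eqF.
  by rewrite g0 expf_neq0// mulf_neq0// gt_eqF.
rewrite big_ord_recl g0 s0 (eq_bigr (fun=> w (t, s) * ('D_1 h (y (t, s)) / h (y (t, s))))); last first.
  move=> i _; have [-> ->] := gi i.
  by move: ('D_1 h _) (h _) hr (w _) => h' h0 hr c; field; exact: lt0r_neq0.
rewrite sumr_const card_ord; congr (_ + _); last by rewrite -mulrA mulr_natl.
rewrite Ez Ey; move: ('D_1 f _) (f _) fr (k _) k0 (w _) (nu _) (Ds w _) (Ds nu _) => f' F F0 K K0 c v c' v'.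
by field; rewrite !gt_eqF.
Qed.

Lemma prof_unit_ds p : strip p ->
  w p * Ds w p + f (y p) ^+ 2 * nu p * Ds nu p
  + f (y p) * 'D_1 f (y p) * Ds y p * nu p ^+ 2 = 0.
Proof.
case: p => t s Sp; have [/= Tt sab] := Sp.
have [_ hy hn hw] := prof_smooth flow.
have dw := is_derive_partial2 (smooth_near_derivable hw Sp).
have dn := is_derive_partial2 (smooth_near_derivable hn Sp).
have dy := is_derive_partial2 (smooth_near_derivable hy Sp).
have Ir := prof_radii flow sym rho0 Tt sab.
have df := is_derive_comp dy (Ck_is_derive (metric_coef_f_smooth hspace (Jz Tt sab) 1) Ir).
have dn2 := is_derive_mul df dn.
have dE := is_derive_sub (is_derive_add (is_derive_mul dw dw) (is_derive_mul dn2 dn2))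
  (is_derive_cst (1 : R) s (1 : R)).
have := is_derive_segment_cst ab sab dE.
rewrite /= => /(_ _)/wrap[x xab|].
  have := prof_unit hspace ab flow sym rho0 (conj Tt xab : strip (t, x)).
  by move=> /eqP; rewrite -subr_eq0 => /eqP <-; rewrite /=; ring.
move=> E; apply: (mulfI (_ : 2 != 0 :> R)); first by rewrite pnatr_eq0.
by rewrite mulr0 -[RHS]E; ring.
Qed.

End ProfileCurvature.

(** * Sign of the averaged mean curvature *)

Section CkCalculus.
Context {R : realType}.
Implicit Types (F G : R -> R) (U W : set R).

Lemma is_derive_pow F (x a : R) m : is_derive x 1 F a ->
  is_derive x 1 (fun t => F t ^+ m.+1) (m.+1%:R * F x ^+ m * a).
Proof.
move=> hF; elim: m => [|m IH]; first by rewrite expr0 !mul1r; under eq_fun do rewrite expr1.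
under eq_fun do rewrite exprS; have := is_derive_mul hF IH.
by rewrite (_ : a * _ + _ = m.+2%:R * F x ^+ m.+1 * a)// -[m.+2]addn1 natrD exprS; ring.
Qed.

Lemma Ck_sub k U W F : W `<=` U -> Ck k U F -> Ck k W F.
Proof.
move=> WU; elim: k F => [|k IH] F; first by move=> cF p /WU; exact: cF.
by move=> [dF cF]; split=> [p /WU|]; [exact: dF|exact: IH].
Qed.

Lemma Ck_pow k U F m : open U -> Ck k U F -> Ck k U (fun p => F p ^+ m).
Proof.
move=> oU cF; elim: m => [|m IH].
  by under eq_fun do rewrite expr0; exact: Ck_cst.
by under eq_fun do rewrite exprS; exact: Ck_mul.
Qed.

Lemma Ck_opp k U F : open U -> Ck k U F -> Ck k U (fun p => - F p).
Proof.
by move=> oU cF; under eq_fun do rewrite -mulN1r; apply: Ck_mul => //; exact: Ck_cst.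
Qed.

Lemma Ck_div k U F G : open U -> (forall p, U p -> G p != 0) -> Ck k U F -> Ck k U G ->
  Ck k U (fun p => F p / G p).
Proof. by move=> oU G0 cF cG; apply: Ck_mul => //; exact: Ck_inv. Qed.

Lemma Ck_comp k U W F G : open U -> (forall p, U p -> W (F p)) -> Ck k U F -> Ck k W G ->
  Ck k U (fun p => G (F p)).
Proof.
move=> oU UW; elim: k G => [|k IH] G cF cG.
  by move=> p Up; apply: (@continuous_comp _ _ _ F G); [exact: cF|exact: cG (UW _ Up)].
apply: (Ck_derive oU (fun p Up =>
  is_derive_comp (Ck_is_derive cF Up) (Ck_is_derive cG (UW _ Up)))).
by apply: Ck_mul => //; [exact: proj2 cF|exact: IH (Ck_pred cF) (proj2 cG)].
Qed.

Lemma Ck_atan k : Ck k setT (@atan R).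
Proof.
case: k => [|k]; first by move=> p _; exact: continuous_atan.
apply: (Ck_derive openT (F' := fun p => (1 + p ^+ 2)^-1)).
apply: Ck_inv; first exact: openT.
  by move=> p _; rewrite gt_eqF// ltr_pwDl// sqr_ge0.
apply: Ck_add; [exact: openT|exact: Ck_cst openT|].
by apply: Ck_pow; [exact: openT|exact: Ck_id openT].
Qed.

Lemma open_preimage_on (S T : topologicalType) (U : set S) (W : set T) (F : S -> T) : open U -> open W ->
  (forall p, U p -> {for p, continuous F}) -> open (U `&` F @^-1` W).
Proof.
move=> oU oW cF; rewrite openE => p [Up Wp]; apply: filterI.
  exact: open_nbhs_nbhs.
by apply: cF => //; exact: open_nbhs_nbhs.
Qed.

Notation mu := (@lebesgue_measure R).

Lemma increment_le_Rintegral U G phi (a b : R) : a < b -> open U ->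
  (forall s, a <= s <= b -> U s) -> Ck 1 U G -> Ck 0 U phi ->
  (forall s, a <= s <= b -> 'D_1 G s <= phi s) ->
  G b - G a <= \int[mu]_(s in `[a, b]) phi s.
Proof.
move=> ab oU abU cG cphi Gphi.
have within F : Ck 0 U F -> {within `[a, b], continuous F}.
  move=> cF; apply: continuous_in_subspaceT => x.
  by rewrite inE/= in_itv/= => /abU; exact: cF.
have cG' : Ck 0 U ('D_1 G) := proj2 cG.
have int F : Ck 0 U F -> mu.-integrable `[a, b] (EFin \o F).
  move=> cF; apply: continuous_compact_integrable; first exact: segment_compact.
  exact: within.
have -> : G b - G a = \int[mu]_(s in `[a, b]) 'D_1 G s.
  rewrite /Rintegral (@continuous_FTC2 _ _ G)//; first exact: within.
  - have cg x : a <= x <= b -> {for x, continuous G}.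
      by move=> /abU Ux; exact: (Ck_pred cG) _ Ux.
    split.
    + by move=> x; rewrite in_itv/= => /andP[ax xb]; apply: (proj1 cG); apply: abU; rewrite !ltW.
    + by apply: cvg_at_right_filter; apply: cg; rewrite lexx ltW.
    + by apply: cvg_at_left_filter; apply: cg; rewrite lexx ltW.
  - by move=> x _; rewrite derive1E.
apply: le_Rintegral; [exact: measurable_itv|exact: int|exact: int|].
by move=> s; rewrite /= in_itv/=; exact: Gphi.
Qed.

(** The integrand is mean curvature times area element, with [c] in the role of the area of the unit
    sphere and [m.+1] its dimension. *)
Lemma total_curvature_ge0 (I : set R) (f h : R -> R) U (y nu w k : R -> R) (a b c : R) (m : nat) :
  a < b -> open I -> open U -> Ck 2 I f -> Ck 2 I h ->
  (forall r, I r -> [/\ 0 < f r, 0 < h r, 0 <= 'D_1 f r & 0 <= 'D_1 h r]) ->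
  (forall s, a <= s <= b -> U s) -> Ck 2 U y -> Ck 2 U nu -> Ck 2 U w -> Ck 2 U k ->
  (forall s, a <= s <= b -> [/\ I (y s), 0 < w s & 0 < k s]) ->
  (forall s, a <= s <= b -> w s ^+ 2 + f (y s) ^+ 2 * nu s ^+ 2 = 1) ->
  (forall s, a <= s <= b -> 'D_1 y s = - k s * f (y s) ^+ 2 * nu s) ->
  nu a = 0 -> nu b = 0 -> 0 <= c ->
  0 <= \int[mu]_(s in `[a, b])
    (((w s * 'D_1 nu s - nu s * 'D_1 w s) / k s
      + w s ^+ 3 * ('D_1 f (y s) / f (y s))
      + m.+1%:R * w s * ('D_1 h (y s) / h (y s)))
     * (f (y s) * k s * h (y s) ^+ m.+1) * c).
Proof.
move=> ab oI oU cf ch fh abU cy cnu cw ck hyp unit tang nua nub c0.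
(* The hypotheses hold on [[a, b]] only; [W] is an open neighbourhood on which all denominators
   remain nonzero. *)
pose W := (((U `&` y @^-1` I) `&` (w @^-1` [set x | 0 < x])) `&` (k @^-1` [set x | 0 < x])).
have c2 F p : Ck 2 U F -> U p -> {for p, continuous F}.
  by move=> cF Up; exact: (Ck_pred (Ck_pred cF)) _ Up.
have oW : open W.
  apply: open_preimage_on; [|exact: open_gt|by move=> p [[Up _] _]; exact: c2].
  apply: open_preimage_on; [|exact: open_gt|by move=> p [Up _]; exact: c2].
  by apply: open_preimage_on => // p Up; exact: c2.
have WU : W `<=` U by move=> s [[[]]].
have abW s : a <= s <= b -> W s.
  by move=> sab; have [? ? ?] := hyp s sab; do ! split=> //=; exact: abU.
have wW F : Ck 2 U F -> Ck 2 W F by exact: Ck_sub.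
have p1 F : Ck 2 W F -> Ck 1 W F by exact: Ck_pred.
have p0 F : Ck 1 W F -> Ck 0 W F by exact: Ck_pred.
have d1 F : Ck 2 W F -> Ck 1 W ('D_1 F) by case.
have yI s : W s -> I (y s) by move=> [[[]]].
have cfy : Ck 2 W (fun s => f (y s)) by exact: Ck_comp oW yI (wW _ cy) cf.
have chy : Ck 2 W (fun s => h (y s)) by exact: Ck_comp oW yI (wW _ cy) ch.
have cf'y : Ck 1 W (fun s => 'D_1 f (y s)).
  exact: Ck_comp oW yI (p1 _ (wW _ cy)) (proj2 cf).
have ch'y : Ck 1 W (fun s => 'D_1 h (y s)).
  exact: Ck_comp oW yI (p1 _ (wW _ cy)) (proj2 ch).
have w0 s : W s -> w s != 0 by move=> [[_ /=] /gt_eqF ->].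
have k0 s : W s -> k s != 0 by move=> [_ /= /gt_eqF ->].
have f0 s : W s -> f (y s) != 0 by move=> /yI/fh[/gt_eqF ->].
have h0 s : W s -> h (y s) != 0 by move=> /yI/fh[_ /gt_eqF ->].
(* [atan (slope s)] is minus the angle between the generating curve and the axis.  Its
   derivative is the curvature of the curve up to terms of known sign, so that [G] below has
   derivative at most the integrand, and it vanishes at both ends. *)
pose slope s := f (y s) * nu s / w s.
have cslope : Ck 1 W slope.
  exact: Ck_div oW w0 (Ck_mul oW (p1 _ cfy) (p1 _ (wW _ cnu))) (p1 _ (wW _ cw)).
pose G s := atan (slope s) * h (y s) ^+ m.+1 * c.
have catan : Ck 1 W (fun s => atan (slope s)).
  exact: Ck_comp oW (fun _ _ => Logic.I) cslope (Ck_atan 1).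
have cG : Ck 1 W G.
  exact: Ck_mul oW (Ck_mul oW catan (Ck_pow m.+1 oW (p1 _ chy))) (Ck_cst 1 c oW).
have Ga : G a = 0 by rewrite /G /slope nua mulr0 mul0r atan0 !mul0r.
have Gb : G b = 0 by rewrite /G /slope nub mulr0 mul0r atan0 !mul0r.
rewrite -[leLHS](subrr (0 : R)) -{1}Gb -Ga.
apply: (increment_le_Rintegral ab oW abW cG).
  have q F : Ck 2 U F -> Ck 0 W F by move=> cF; exact/p0/p1/wW.
  have q' F : Ck 2 U F -> Ck 0 W ('D_1 F) by move=> cF; exact/p0/d1/wW.
  have e1 := Ck_add oW (Ck_mul oW (q _ cw) (q' _ cnu))
    (Ck_opp oW (Ck_mul oW (q _ cnu) (q' _ cw))).
  have e2 := Ck_mul oW (Ck_pow 3 oW (q _ cw)) (Ck_div oW f0 (p0 _ cf'y) (p0 _ (p1 _ cfy))).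
  have e3 := Ck_mul oW (Ck_mul oW (Ck_cst 0 m.+1%:R oW) (q _ cw))
    (Ck_div oW h0 (p0 _ ch'y) (p0 _ (p1 _ chy))).
  have e4 := Ck_mul oW (Ck_mul oW (p0 _ (p1 _ cfy)) (q _ ck))
    (Ck_pow m.+1 oW (p0 _ (p1 _ chy))).
  exact: Ck_mul oW (Ck_mul oW (Ck_add oW (Ck_add oW (Ck_div oW k0 e1 (q _ ck)) e2) e3) e4)
    (Ck_cst 0 c oW).
move=> s sab; have Ws := abW s sab; have Us := WU _ Ws.
have [Iy ws ks] := hyp s sab; have [fs hs f's h's] := fh _ Iy.
have dy := Ck_is_derive cy Us; have dnu := Ck_is_derive cnu Us; have dw := Ck_is_derive cw Us.
have df := is_derive_comp dy (Ck_is_derive cf Iy).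
have dh := is_derive_comp dy (Ck_is_derive ch Iy).
have dslope := is_derive_mul (is_derive_mul df dnu) (is_derive_inv (w0 s Ws) dw).
have datan := is_derive_comp dslope (is_derive1_atan (slope s)).
have dpow : is_derive s 1 (fun s => h (y s) ^+ m.+1)
    (m.+1%:R * h (y s) ^+ m * ('D_1 y s * 'D_1 h (y s))).
  exact: is_derive_pow dh.
have [_ ->] := is_derive_mul (is_derive_mul datan dpow) (is_derive_cst c s (1 : R)).
rewrite /cst mulr0 addr0 ler_wpM2r//.
(* By the unit relation [w] is the cosine of the angle whose tangent is [slope]. *)
have E1 : (1 + slope s ^+ 2)^-1 = w s ^+ 2.
  have w2 : w s ^+ 2 != 0 by rewrite expf_neq0// gt_eqF.
  rewrite -[RHS]invrK; congr (_^-1); apply: (mulIf w2); rewrite mulVf// mulrDl mul1r.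
  by rewrite /slope !exprMn exprVn mulfVK// unit.
have St : 0 <= atan (slope s) * nu s.
  have sl : slope s = f (y s) / w s * nu s by rewrite /slope mulrAC.
  have fw : 0 < f (y s) / w s by rewrite divr_gt0.
  case: (lerP 0 (nu s)) => n0.
    rewrite mulr_ge0// -[leLHS](@atan0 R); apply: le_atan.
    by rewrite sl mulr_ge0// ltW.
  rewrite mulr_le0// ?(ltW n0)// -[leRHS](@atan0 R); apply: le_atan.
  by rewrite sl pmulr_rle0// ltW.
rewrite E1 /= (tang s sab) -/(slope s).
move: St; have := unit s sab; move: ws ks fs hs f's h's.
move: (atan (slope s)) ('D_1 f _) ('D_1 h _) ('D_1 nu s) ('D_1 w s) => A f' h' n' w'.
move: (f _) (h _) (w s) (k s) (nu s) => F H C K v C0 K0 F0 H0 f'0 h'0 E AV.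
rewrite -subr_ge0.
(* The terms in [n'] and [w'] cancel. What remains is a multiple of [f'], simplified by the unit
   relation, and a multiple of [h'], nonnegative because the angle [A] has the sign of [v]. *)
have -> : ((C * n' - v * w') / K + C ^+ 3 * (f' / F) + m.+1%:R * C * (h' / H)) * (F * K * H ^+ m.+1)
  - (((- K * F ^+ 2 * v * f' * v + F * n') / C + F * v * (- w' / C ^+ 2)) * C ^+ 2 * H ^+ m.+1
     + A * (m.+1%:R * H ^+ m * (- K * F ^+ 2 * v * h')))
  = H ^+ m.+1 * f' * K * C * (C ^+ 2 + F ^+ 2 * v ^+ 2)
    + m.+1%:R * H ^+ m * h' * K * F * (C + F * (A * v)).
  by rewrite !exprS; field; rewrite !gt_eqF.
rewrite E mulr1 addr_ge0//; first by rewrite !mulr_ge0 ?exprn_ge0// ltW.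
have CA : 0 <= C + F * (A * v) := addr_ge0 (ltW C0) (mulr_ge0 (ltW F0) AV).
have Hm : 0 <= H ^+ m by rewrite exprn_ge0 ?ltW.
by rewrite !mulr_ge0 ?ler0n// ltW.
Qed.

End CkCalculus.

(** * The minimum principle *)

(* The hypotheses are the t-derivatives of [f^2 nu z_s + w y_s = 0] and of
   [w^2 + f^2 nu^2 = 1], then the s-derivatives of [w z_t = nu y_t], of the second of these
   relations and of [prof_curvature_radial], and the latter itself, at a point where [w_s = 0];
   the t-derivative of the normal and the second derivatives of z and y drop out. *)
Lemma minimum_inequality (R : realFieldType) (F f' C v K c q q' yt wt vt zst yst vs yss wss : R) :
  0 < F -> 0 < C -> 0 < K -> 0 <= f' -> 0 <= c -> 0 <= wss -> C ^+ 2 + F ^+ 2 * v ^+ 2 = 1 ->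
  2 * F * f' * yt * v * (K * C) + F ^+ 2 * vt * (K * C) + F ^+ 2 * v * zst
    + wt * (- K * F ^+ 2 * v) + C * yst = 0 ->
  C * wt + F * v * (yt * f' * v + F * vt) = 0 ->
  C * zst - vs * yt - v * yst = 0 ->
  F ^+ 2 * v * vs + F * f' * (- K * F ^+ 2 * v) * v ^+ 2 = 0 ->
  yst * (- K * F ^+ 2 * v) + yt * yss - (c * C * yss - C * (wss + yss * (C * q)
    + (- K * F ^+ 2 * v) * (C * ((- K * F ^+ 2 * v) * q')))) = 0 ->
  yt * (- K * F ^+ 2 * v) = c * C * (- K * F ^+ 2 * v) - C * ((- K * F ^+ 2 * v) * (C * q)) ->
  F ^+ 2 * v ^+ 2 * C * (q' - f' / F * q) <= wt.
Proof.
move=> F0 C0 K0 f'0 c0 wss0 E e1 e2 e3 e2s e4 e0.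
(* The general case divides by [y_s], which is a multiple of [v]; for [v = 0] the unit length
   relation alone gives [wt = 0]. *)
have [v0|v0] := eqVneq v 0.
  have : C * wt = 0 by rewrite -[RHS]e2 v0; ring.
  move=> /eqP; rewrite mulf_eq0 (gt_eqF C0)/= => /eqP ->.
  by rewrite v0 expr0n/= mulr0 !mul0r.
have nz : - K * F ^+ 2 * v != 0.
  by rewrite mulf_neq0// mulf_neq0 ?oppr_eq0 ?gt_eqF// exprn_gt0.
have A : K * C * wt = v * yst + K * F * f' * yt * v ^+ 2.
  apply/eqP; rewrite -subr_eq0; apply/eqP.
  (* The multipliers of the four relations are chosen so that [vt], [zst] and [vs] cancel. *)
  have -> : K * C * wt - (v * yst + K * F * f' * yt * v ^+ 2) =
     K * C * wt * (1 - (C ^+ 2 + F ^+ 2 * v ^+ 2))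
     - (v * yst + K * F * f' * yt * v ^+ 2) * (1 - (C ^+ 2 + F ^+ 2 * v ^+ 2))
     - C * v * (2 * F * f' * yt * v * (K * C) + F ^+ 2 * vt * (K * C) + F ^+ 2 * v * zst
    + wt * (- K * F ^+ 2 * v) + C * yst)
     + K * C ^+ 2 * (C * wt + F * v * (yt * f' * v + F * vt))
     + F ^+ 2 * v ^+ 2 * (C * zst - vs * yt - v * yst)
     + v * yt * (F ^+ 2 * v * vs + F * f' * (- K * F ^+ 2 * v) * v ^+ 2) by ring.
  by rewrite E e1 e2 e3 e2s subrr !mulr0 !subr0 !addr0.
have yE : yt = C * (c - C * q) by apply: (mulIf nz); rewrite e0; ring.
have B : yst * (- K * F ^+ 2 * v) = - C * wss - C ^+ 2 * (- K * F ^+ 2 * v) ^+ 2 * q'.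
  by apply/eqP; rewrite -subr_eq0 -[eqbRHS]e4 yE; apply/eqP; ring.
have {}A : wt = wss / (K ^+ 2 * F ^+ 2) + C * F ^+ 2 * v ^+ 2 * q' + F * f' * v ^+ 2 * (c - C * q).
  have ystE : yst = (- C * wss - C ^+ 2 * (- K * F ^+ 2 * v) ^+ 2 * q') / (- K * F ^+ 2 * v).
    by rewrite -B mulfK.
  have KC : K * C != 0 by rewrite mulf_neq0 ?gt_eqF.
  apply: (mulfI KC); rewrite A ystE yE; field.
  by rewrite v0 !gt_eqF.
rewrite -subr_ge0; have -> : wt - F ^+ 2 * v ^+ 2 * C * (q' - f' / F * q) =
    wss / (K ^+ 2 * F ^+ 2) + F * f' * v ^+ 2 * c.
  by rewrite A; field; rewrite !gt_eqF.
have h1 : 0 <= wss / (K ^+ 2 * F ^+ 2) := divr_ge0 wss0 (mulr_ge0 (sqr_ge0 K) (sqr_ge0 F)).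
exact: addr_ge0 h1 (mulr_ge0 (mulr_ge0 (mulr_ge0 (ltW F0) f'0) (sqr_ge0 v)) c0).
Qed.

(** * Evolution of the radial component of the normal *)

Section ProfileEvolution.
Context {R : realType} {n : nat}.
Local Notation V := (cspace R n.+2).
Local Notation p0 := (@pole R n.+1).
Variables (J : set R) (Rad : \bar R) (f h : R -> R).
Hypothesis hspace : rot_sym_space (n := n.+2) J Rad f h.
Local Notation g := (@rot_metric R n.+2 f h).
Local Notation M := (@ambient R n.+2 J Rad).
Variables (a b : R) (rho : R -> R) (T : \bar R) (X N : R -> V -> V).
Hypothesis ab : a < b.
Hypothesis flow : flow_with_normal g M a b rho T X N.
Hypothesis sym : forall t s u, time_domain T t -> a <= s <= b -> enorm u = 1 ->
  X t (s, u) = ((X t (s, p0)).1, (X t (s, p0)).2 0 0 *: u).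
Hypothesis rho0 : forall z, a <= z <= b -> 0 < rho z.
Hypothesis mono : forall r, radii Rad r -> 0 <= 'D_1 f r /\ 0 <= 'D_1 h r.
Local Notation TD := (time_domain T).
Local Notation strip := (strip a b T).
Local Notation z := (prof_z X).
Local Notation y := (prof_y X).
Local Notation nu := (prof_z N).
Local Notation w := (prof_y N).
Local Notation k := (prof_k X N).
Local Notation Dt F := ('D_((1, 0) : R * R) F).
Local Notation Ds F := ('D_((0, 1) : R * R) F).
Local Notation avg t := (average_mean_curvature g a b (X t) (N t)).

Let Jz t s : TD t -> a <= s <= b -> J (z (t, s)).
Proof.
move=> Tt sab; have [_ _ + _] := flow; move=> /(_ t Tt)[+ _ _ _].
by move=> /(_ (s, p0) (conj sab enorm_pole)) [].
Qed.

Let fh_gt0 r : radii Rad r -> 0 < f r /\ 0 < h r.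
Proof. by have [_ _ _ + _] := hspace; move=> + [r0 rR]; apply. Qed.

Let radii_y t s : TD t -> a <= s <= b -> radii Rad (y (t, s)).
Proof. by move=> Tt sab; apply: (prof_radii flow). Qed.

Lemma slice_Ck (F : R * R -> R) t : smooth_near strip F -> TD t ->
  exists U : set R, [/\ open U, (forall s, a <= s <= b -> U s) &
    forall m, Ck m U (fun s => F (t, s))].
Proof.
move=> [W [oW DW sW]] Tt.
have hphi (p q : R) : (t, p + q) = (0, p) + (t, q) :> R * R by congr pair; rewrite /= add0r.
have bL : blin (fun p : R => ((0 : R), p)) by exact: blin_pair (@blin_zero _ _ _) (@blin_id _ _).
have [_ sZ] := smooth_on_affine (phi := fun p : R => (t, p)) oW bL hphi sW.
have oU : open ((fun p : R => (t, p)) @^-1` W).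
  apply: open_comp => // p _.
  rewrite (_ : (fun p => (t, p)) = (fun p : R => (0, p) + (t, 0))); last first.
    by apply/funext => x; rewrite -hphi addr0.
  by apply: continuousD; [exact: blin_continuous|exact: cst_continuous].
exists ((fun p => (t, p)) @^-1` W); split=> //.
  by move=> s sab; apply: DW.
exact/smooth_onP.
Qed.

Lemma smooth_near_derive (D : set (R * R)) (F : R * R -> R) v :
  smooth_near D F -> smooth_near D ('D_v F).
Proof. by move=> [W [oW DW sW]]; exists W; split; [exact: oW|exact: DW|exact: smooth_on_derive]. Qed.

Lemma slice_D1 (F : R * R -> R) t s : smooth_near strip F -> TD t -> a <= s <= b ->
  'D_1 (fun s => F (t, s)) s = Ds F (t, s).
Proof.
move=> sF Tt sab; have [] := is_derive_partial2 (smooth_near_derivable (v := (0, 1)) sF (conj Tt sab : strip (t, s))).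
by [].
Qed.

(** Mean curvature and area element do not depend on the point of the sphere, so the sphere integral
    factors out and [total_curvature_ge0] handles the remaining variable. *)
Lemma average_mean_curvature_ge0 t : TD t -> (forall s, a <= s <= b -> 0 < w (t, s)) ->
  0 <= avg t.
Proof.
move=> Tt w0; have [hz hy hn hw] := prof_smooth flow.
have [U1 [op1 ab1 c1]] := slice_Ck hy Tt.
have [U2 [op2 ab2 c2]] := slice_Ck hn Tt.
have [U3 [op3 ab3 c3]] := slice_Ck hw Tt.
have [U4 [op4 ab4 c4]] := slice_Ck (smooth_near_derive (0, 1) hz) Tt.
have [U5 [op5 ab5 c5]] := slice_Ck (smooth_near_derive (0, 1) hy) Tt.
pose U := U1 `&` U2 `&` U3 `&` U4 `&` U5.
have oU : open U by do ! apply: openI.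
have abU s : a <= s <= b -> U s.
  by move=> sab; do ! split; [exact: ab1|exact: ab2|exact: ab3|exact: ab4|exact: ab5].
have s1 : U `<=` U1 by move=> s [[[[]]]].
have s2 : U `<=` U2 by move=> s [[[[]]]].
have s3 : U `<=` U3 by move=> s [[[]]].
have s4 : U `<=` U4 by move=> s [[]].
have s5 : U `<=` U5 by move=> s [].
have cy := Ck_sub s1 (c1 2%N); have cn := Ck_sub s2 (c2 2%N); have cw := Ck_sub s3 (c3 2%N).
have ck : Ck 2 U (fun s => k (t, s)).
  exact: Ck_add oU (Ck_mul oU (Ck_sub s4 (c4 2%N)) cw)
    (Ck_opp oU (Ck_mul oU (Ck_sub s5 (c5 2%N)) cn)).
have aab : a <= a <= b by rewrite lexx ltW.
have J0 := Jz Tt aab.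
have sab0 s : a <= s <= b -> strip (t, s) by [].
rewrite /average_mean_curvature divr_ge0//; last first.
  apply: Rintegral_ge0 => s _; apply: sphere_integral_ge0 => u.
  by rewrite mul1r sqrtr_ge0.
rewrite /hyp_integral.
have -> : \int[lebesgue_measure]_(s in `[a, b])
    sphere_integral (fun u => mean_curvature g (X t) (N t) (s, u) * area_element g (X t) (s, u)) =
  \int[lebesgue_measure]_(s in `[a, b])
    (((w (t, s) * 'D_1 (fun s => nu (t, s)) s - nu (t, s) * 'D_1 (fun s => w (t, s)) s) / k (t, s)
      + w (t, s) ^+ 3 * ('D_1 f (y (t, s)) / f (y (t, s)))
      + n.+1%:R * w (t, s) * ('D_1 h (y (t, s)) / h (y (t, s))))
     * (f (y (t, s)) * k (t, s) * h (y (t, s)) ^+ n.+1)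
     * sphere_integral (fun _ : 'rV[R]_n.+2 => 1)).
  apply: eq_Rintegral => s; rewrite inE/= in_itv/= => sab.
  rewrite -sphere_integral_cst; apply: sphere_integral_ext.
    apply: sphere_contM; first exact: (mean_curvature_sphere_cont hspace flow Tt sab).
    exact: (area_sphere_cont hspace flow Tt sab).
  move=> u u1; have eH := prof_H hspace ab flow sym rho0 Tt sab u1.
  have eA := prof_area hspace ab flow sym rho0 Tt sab u1.
  rewrite (slice_D1 hn Tt sab) (slice_D1 hw Tt sab).
  exact: (congr2 *%R eH eA).
have fhI r : radii Rad r -> [/\ 0 < f r, 0 < h r, 0 <= 'D_1 f r & 0 <= 'D_1 h r].
  by move=> Ir; have [? ?] := fh_gt0 Ir; have [? ?] := mono Ir.
have hyp s : a <= s <= b -> [/\ radii Rad (y (t, s)), 0 < w (t, s) & 0 < k (t, s)].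
  move=> sab; split; [exact: radii_y|exact: w0|].
  exact: (prof_k_gt0 hspace ab flow sym rho0 (sab0 s sab)).
have tang s : a <= s <= b ->
    'D_1 (fun s => y (t, s)) s = - k (t, s) * f (y (t, s)) ^+ 2 * nu (t, s).
  move=> sab; rewrite (slice_D1 hy Tt sab).
  by have [] := prof_tangent hspace ab flow sym rho0 (sab0 s sab).
have unit s (sab : a <= s <= b) := prof_unit hspace ab flow sym rho0 (sab0 s sab).
have [nua _] := prof_boundary hspace ab flow sym rho0 Tt (or_introl erefl : a = a \/ a = b).
have [nub _] := prof_boundary hspace ab flow sym rho0 Tt (or_intror erefl : b = a \/ b = b).
have sig0 : 0 <= sphere_integral (fun _ : 'rV[R]_n.+2 => 1 : R).
  by apply: sphere_integral_ge0 => u.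
exact: (@total_curvature_ge0 R (radii Rad) f h U (fun s => y (t, s)) (fun s => nu (t, s))
  (fun s => w (t, s)) (fun s => k (t, s)) a b _ n ab (@open_radii R Rad) oU
  (metric_coef_f_smooth hspace J0 2) (metric_coef_h_smooth hspace J0 2) fhI abU cy cn cw ck
  hyp unit tang nua nub sig0).
Qed.

(** The mean curvature of the cylinder at distance [r] from the axis. *)
Definition mean_coef (r : R) : R := 'D_1 f r / f r + n.+1%:R * ('D_1 h r / h r).
Local Notation q := mean_coef.

(** Multiplying by [Ds y], a multiple of [f ^+ 2 * nu], lets [prof_unit_ds] replace the derivative
    of [nu] by that of [w]. No division by [nu] occurs, so the relation holds along the whole curve
    and can be differentiated in [s]. *)
Lemma prof_curvature_radial p : strip p ->
  Dt y p * Ds y p = avg p.1 * w p * Ds y p - w p * (Ds w p + Ds y p * (w p * q (y p))).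
Proof.
case: p => t s Sp; have [/= Tt sab] := Sp.
have [fr hr] := fh_gt0 (radii_y Tt sab).
have k0 := prof_k_gt0 hspace ab flow sym rho0 Sp.
have [_ Ey] := prof_tangent hspace ab flow sym rho0 Sp.
have E1 := prof_unit hspace ab flow sym rho0 Sp.
have E2 := prof_unit_ds hspace ab flow sym rho0 Sp.
have [_ ->] := prof_dt flow Sp.
rewrite /prof_V/= (prof_H hspace ab flow sym rho0)//; last exact: enorm_pole.
rewrite /q.
move: E1 E2; rewrite Ey.
move: (avg t) => c.
move: ('D_1 f _) ('D_1 h _) (f _) fr (h _) hr (k _) k0 (w _) (nu _) (Ds w _) (Ds nu _)
  => f' h' F F0 H H0 K K0 C v C' v' E1 E2.
have e2 : F ^+ 2 * v * v' = - (C * C') + K * f' * F ^+ 3 * v ^+ 3.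
  by rewrite -[LHS]subr0 -E2; ring.
set Hc := (X in c - X).
have -> : Hc = (C * v' - v * C') / K + C ^+ 3 * (f' / F) + n.+1%:R * C * (h' / H) by [].
have key : - K * F ^+ 2 * v * ((C * v' - v * C') / K + C ^+ 3 * (f' / F) + n.+1%:R * C * (h' / H))
    = C' + - K * F ^+ 2 * v * (C * (f' / F + n.+1%:R * (h' / H))).
  transitivity (- C * (F ^+ 2 * v * v') + F ^+ 2 * v ^+ 2 * C'
      - K * F ^+ 2 * v * (C ^+ 3 * (f' / F) + n.+1%:R * C * (h' / H))).
    by field; rewrite !gt_eqF.
  rewrite e2; transitivity ((C ^+ 2 + F ^+ 2 * v ^+ 2) * C'
      - K * F * v * f' * C * (C ^+ 2 + F ^+ 2 * v ^+ 2) - K * F ^+ 2 * v * (n.+1%:R * C * (h' / H))).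
    by field; rewrite !gt_eqF.
  by rewrite E1; field; rewrite !gt_eqF.
by rewrite -key; ring.
Qed.

(** The flow equation gives no direct formula for the motion of the normal. It is obtained by
    differentiating in time the orthogonality and unit length relations, with the mixed derivatives
    of [z] and [y] exchanged by [schwarz]. *)
Lemma prof_w_dt t s : TD t -> 0 < t -> a <= s <= b -> 0 < w (t, s) -> 0 <= avg t ->
  Ds w (t, s) = 0 -> 0 <= Ds (Ds w) (t, s) ->
  f (y (t, s)) ^+ 2 * nu (t, s) ^+ 2 * w (t, s) *
    ('D_1 q (y (t, s)) - 'D_1 f (y (t, s)) / f (y (t, s)) * q (y (t, s))) <= Dt w (t, s).
Proof.
move=> Tt t0 sab w0 c0 ws wss; have [hz hy hn hw] := prof_smooth flow.
have Sp : strip (t, s) by [].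
have sm v (F : R * R -> R) : smooth_near strip F -> smooth_near strip ('D_v F).
  exact: smooth_near_derive.
have ds (F : R * R -> R) : smooth_near strip F ->
    is_derive s 1 (fun s => F (t, s)) (Ds F (t, s)).
  by move=> hF; exact: is_derive_partial2 (smooth_near_derivable hF Sp).
have dt (F : R * R -> R) : smooth_near strip F ->
    is_derive t 1 (fun t => F (t, s)) (Dt F (t, s)).
  by move=> hF; exact: is_derive_partial1 (smooth_near_derivable hF Sp).
have swap (F : R * R -> R) : smooth_near strip F -> Dt (Ds F) (t, s) = Ds (Dt F) (t, s).
  by move=> [W [oW DW sW]]; exact: schwarz oW sW (DW _ Sp).
have Ir := radii_y Tt sab; have [fr hr] := fh_gt0 Ir; have [f'0 _] := mono Ir.
have J0 := Jz Tt sab.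
have cf := metric_coef_f_smooth hspace J0; have ch := metric_coef_h_smooth hspace J0.
have df := Ck_is_derive (cf 1%N) Ir.
have cq : Ck 1 (radii Rad) q.
  apply: Ck_add; [exact: open_radii| |apply: Ck_mul; [exact: open_radii|exact/Ck_cst/open_radii|]].
    apply: Ck_div; [exact: open_radii| |exact: (proj2 (cf 2%N))|exact: cf].
    by move=> r /fh_gt0[/gt_eqF ->].
  apply: Ck_div; [exact: open_radii| |exact: (proj2 (ch 2%N))|exact: ch].
  by move=> r /fh_gt0[_ /gt_eqF ->].
have dq := Ck_is_derive cq Ir.
have k0 := prof_k_gt0 hspace ab flow sym rho0 Sp.
have [Ez Ey] := prof_tangent hspace ab flow sym rho0 Sp.
have E1 := prof_unit hspace ab flow sym rho0 Sp.
have E2 := prof_unit_ds hspace ab flow sym rho0 Sp.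
have [Et1 Et2] := prof_dt flow Sp.
have Ec := prof_curvature_radial Sp.
have tt : 0 <= t <= t by rewrite lexx ltW.
have TD' x : 0 <= x <= t -> TD x by exact: time_domain_sub.
have R1 x : 0 <= x <= t -> f (y (x, s)) * f (y (x, s)) * nu (x, s) * Ds z (x, s)
    + w (x, s) * Ds y (x, s) = 0.
  move=> /TD' Tx.
  by have [-> ->] := prof_tangent hspace ab flow sym rho0 (conj Tx sab : strip (x, s)); ring.
have R2 x : 0 <= x <= t -> w (x, s) * w (x, s)
    + f (y (x, s)) * nu (x, s) * (f (y (x, s)) * nu (x, s)) - 1 = 0.
  move=> /TD' Tx; have := prof_unit hspace ab flow sym rho0 (conj Tx sab : strip (x, s)).
  by move=> /eqP; rewrite -subr_eq0 => /eqP <-; ring.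
have R3 x : a <= x <= b -> w (t, x) * Dt z (t, x) - nu (t, x) * Dt y (t, x) = 0.
  by move=> xab; have [-> ->] := prof_dt flow (conj Tt xab : strip (t, x)); ring.
have R4 x : a <= x <= b -> Dt y (t, x) * Ds y (t, x) - (avg t * w (t, x) * Ds y (t, x)
    - w (t, x) * (Ds w (t, x) + Ds y (t, x) * (w (t, x) * q (y (t, x))))) = 0.
  by move=> xab; rewrite (prof_curvature_radial (conj Tt xab : strip (t, x))) subrr.
have dfy := is_derive_comp (dt _ hy) df.
have dfys := is_derive_comp (ds _ hy) df.
(* The relations in time are used on [[0, t]], with [t] as right endpoint; [0 < t] makes this
   segment nondegenerate. *)
have dR1 := is_derive_segment_cst t0 tt (is_derive_add
  (is_derive_mul (is_derive_mul (is_derive_mul dfy dfy) (dt _ hn)) (dt _ (sm (0, 1) _ hz)))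
  (is_derive_mul (dt _ hw) (dt _ (sm (0, 1) _ hy)))) _.
have dR2 := is_derive_segment_cst t0 tt (is_derive_sub (is_derive_add
  (is_derive_mul (dt _ hw) (dt _ hw))
  (is_derive_mul (is_derive_mul dfy (dt _ hn)) (is_derive_mul dfy (dt _ hn))))
  (is_derive_cst (1 : R) t (1 : R))) _.
have dR3 := is_derive_segment_cst ab sab (is_derive_sub
  (is_derive_mul (ds _ hw) (ds _ (sm (1, 0) _ hz)))
  (is_derive_mul (ds _ hn) (ds _ (sm (1, 0) _ hy)))) _.
have dqy := is_derive_comp (ds _ hy) dq.
have dR4 := is_derive_segment_cst ab sab (is_derive_sub
  (is_derive_mul (ds _ (sm (1, 0) _ hy)) (ds _ (sm (0, 1) _ hy)))
  (is_derive_sub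
    (is_derive_mul (is_derive_mul (is_derive_cst (avg t) s (1 : R)) (ds _ hw)) (ds _ (sm (0, 1) _ hy)))
    (is_derive_mul (ds _ hw) (is_derive_add (ds _ (sm (0, 1) _ hw))
      (is_derive_mul (ds _ (sm (0, 1) _ hy)) (is_derive_mul (ds _ hw) dqy)))))) _.
have e1 := dR1 (fun x xt => R1 x xt).
have e2 := dR2 (fun x xt => R2 x xt).
have e3 := dR3 (fun x xt => R3 x xt).
have e4 := dR4 (fun x xt => R4 x xt).
move: e1 e2 e3 e4 Ec E1 E2 {dR1 dR2 dR3 dR4 dfy dfys dqy R1 R2 R3 R4} => /=.
rewrite (swap _ hz) (swap _ hy) -/(q (y (t, s))) ws Ez Ey.
move: fr k0 w0 f'0 c0 wss; move: ('D_1 q _) (q _) (Dt y _) (Dt w _) (Dt nu _) (Ds (Dt z) _)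
  (Ds (Dt y) _) (Ds nu _) (Ds (Ds y) _) (Ds (Ds w) _) (avg t) ('D_1 f _) (f _) (k _) (w _) (nu _)
  (Dt z _).
move=> q' q0 yt wt vt zst yst vs yss wss c f' F K C v zt F0 K0 C0 f'0 c0 wss0 e1 e2 e3 e4 e0 E E2'.
apply: (minimum_inequality F0 C0 K0 f'0 c0 wss0 E (vt := vt) (zst := zst) (yst := yst)
  (vs := vs) (yss := yss) (yt := yt)).
- by rewrite -[RHS]e1; ring.
- by apply: (mulfI (_ : 2 != 0 :> R)); rewrite ?pnatr_eq0// mulr0 -[RHS]e2; ring.
- by rewrite -[RHS]e3; ring.
- by rewrite -[RHS]E2'; ring.
- by rewrite -[RHS]e4; ring.
- by rewrite e0; ring.
Qed.

End ProfileEvolution.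

(** * First time at which a continuous function reaches a level *)

Section FirstCrossing.
Context {R : realType}.

(** A positive derivative would make [F] smaller just before [t]; only earlier times are
    compared. *)
Lemma derive_left_min (F : R -> R) (t : R) d : 0 < t -> is_derive t 1 F d ->
  (forall x, 0 <= x < t -> F t <= F x) -> d <= 0.
Proof.
move=> t0 [dF <-] Fmin; rewrite leNgt; apply/negP => d0.
move/cvgr_gt : (dF) => /(_ _ d0).
rewrite near_withinE => /nbhs_normP[e /= e0 he].
pose x := - Num.min e t / 2.
have m0 : 0 < Num.min e t by rewrite lt_min e0.
have [me mt] : Num.min e t <= e /\ Num.min e t <= t by rewrite !ge_min !lexx orbT.
have x0 : x < 0 by rewrite /x; lra.
have /he : ball_ Num.norm 0 e x.
  by rewrite /ball_/= sub0r normrN ltr0_norm//; rewrite /x; lra.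
rewrite lt_eqF// => /(_ isT) /=; rewrite [_%:A]mulr1.
rewrite nmulr_rgt0 ?invr_lt0// subr_lt0; apply/negP; rewrite -leNgt.
by apply: Fmin; rewrite /x; apply/andP; split; lra.
Qed.

Variables (t1 a b : R).
Hypotheses (t10 : 0 <= t1) (ab : a <= b).

Let D : set (R * R) := `[0, t1] `*` `[a, b].

Let DP p : D p <-> 0 <= p.1 <= t1 /\ a <= p.2 <= b.
Proof. by rewrite /D /= !in_itv. Qed.

Let cD : compact D.
Proof. by apply: compact_setX; exact: segment_compact. Qed.

(** A continuous retraction onto the rectangle. Composed with it, a function continuous at the
    points of [D] becomes continuous everywhere, so its sublevel sets are closed. *)
Let clamp (p : R * R) : R * R := (Num.max 0 (Num.min t1 p.1), Num.max a (Num.min b p.2)).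

Let clampD p : D (clamp p).
Proof.
by apply/DP => /=; rewrite !le_max !ge_max !ge_min !lexx t10 ab.
Qed.

Let clamp_id p : D p -> clamp p = p.
Proof.
case: p => t s /DP[/= /andP[t0 tt1] /andP[sa sb]].
by rewrite /clamp /= (min_idPr tt1) (min_idPr sb) (max_idPr t0) (max_idPr sa).
Qed.

Let clamp_continuous : continuous clamp.
Proof.
have cmm (c d : R) (F : R * R -> R) p : {for p, continuous F} ->
    {for p, continuous (fun p => Num.max c (Num.min d (F p)))}.
  move=> cF; rewrite /prop_for /continuous_at.
  apply: (@continuous_max R (R * R)%type (cst c) (fun p => Num.min d (F p))).
    exact: cst_continuous.
  rewrite /prop_for /continuous_at.
  by apply: (@continuous_min R (R * R)%type (cst d) F) => //; exact: cst_continuous.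
move=> p; have c1 := cmm 0 t1 fst p cvg_fst; have c2 := cmm a b snd p cvg_snd.
exact: (cvg_pair (c1 (nbhs_filter _)) (c2 (nbhs_filter _))).
Qed.

Lemma rectangle_max (F : R * R -> R) : (forall p, D p -> {for p, continuous F}) ->
  exists2 p, D p & forall p', D p' -> F p' <= F p.
Proof.
move=> cF; have D0 : D !=set0 by exists (0, a); apply/DP => /=; rewrite !lexx t10.
have [|p pD pF] := compact_EVT_max D0 cD (f := F).
  by apply: continuous_in_subspaceT => p; rewrite inE; exact: cF.
exists p; first by rewrite inE in pD.
by move=> p' p'D; apply: pF; rewrite inE.
Qed.

(** Minimize the time over the compact set of points of the rectangle where [F <= m]. *)
Lemma first_crossing (F : R * R -> R) (m : R) : (forall p, D p -> {for p, continuous F}) ->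
  (forall s, a <= s <= b -> m < F (0, s)) -> (exists2 p, D p & F p <= m) ->
  exists t s, [/\ 0 < t <= t1, a <= s <= b, F (t, s) = m &
    (forall s', a <= s' <= b -> m <= F (t, s')) /\
    (forall t' s', 0 <= t' < t -> a <= s' <= b -> m < F (t', s'))].
Proof.
move=> cF F0 [p Dp Fp].
have cFc : continuous (F \o clamp).
  by move=> q; apply: continuous_comp; [exact: clamp_continuous|exact: cF].
pose Z := D `&` [set q | (F \o clamp) q <= m].
have cZ : compact Z.
  apply: compact_closedI cD _.
  have -> : [set q | (F \o clamp) q <= m] = (F \o clamp) @^-1` [set x | x <= m] by [].
  by apply: closed_comp; [move=> q _; exact: cFc|exact: closed_le].
have Z0 : Z !=set0 by exists p; split=> //=; rewrite clamp_id.
have [|[t s] tsZ tmin] := compact_EVT_min Z0 cZ (f := fst).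
  by apply: continuous_subspaceT => q; exact: cvg_fst.
move: tsZ; rewrite inE => -[Dts /=]; rewrite clamp_id// => Fts.
have [/= /andP[t0 tt1] sab] := (DP _).1 Dts.
have tpos : 0 < t.
  rewrite lt_neqAle t0 andbT; apply/negP => /eqP t0'.
  by move: (F0 s sab); rewrite t0' ltNge Fts.
have before t' s' : 0 <= t' < t -> a <= s' <= b -> m < F (t', s').
  move=> /andP[t'0 t't] s'ab; rewrite ltNge; apply/negP => Fm.
  have D' : D (t', s') by apply/DP; split=> //=; rewrite t'0 (le_trans (ltW t't)).
  have : (t', s') \in Z by rewrite inE; split=> //=; rewrite clamp_id.
  by move=> /tmin /=; rewrite leNgt t't.
(* A value below [m] at time [t] would persist, by continuity, at slightly earlier times. *)
have after s' : a <= s' <= b -> m <= F (t, s').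
  move=> s'ab; rewrite leNgt; apply/negP => Fm.
  have D' : D (t, s') by apply/DP; rewrite /= t0.
  have cl : {for t, continuous (fun t => F (t, s'))}.
    apply: (@continuous_comp _ _ _ (fun t => (t, s')) F); last exact: cF.
    exact: (cvg_pair cvg_id (cvg_cst s')).
  have : \forall x \near t, F (x, s') < m by exact: cvgr_lt cl _ Fm.
  move=> /nbhs_normP[e /= e0 he].
  pose x := t - Num.min e t / 2.
  have m0 : 0 < Num.min e t by rewrite lt_min e0.
  have [me mt] : Num.min e t <= e /\ Num.min e t <= t by rewrite !ge_min !lexx orbT.
  have /he : ball_ Num.norm t e x.
    by rewrite /ball_/= /x opprB addrC subrK gtr0_norm; lra.
  rewrite /= ltNge ltW// before// /x; apply/andP; split; lra.
exists t, s; split=> //; first by rewrite tpos.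
by apply/eqP; rewrite eq_le Fts after.
Qed.

End FirstCrossing.

(** * Positivity of the radial component of the normal *)

Section GraphPreserved.
Context {R : realType} {n : nat}.
Local Notation V := (cspace R n.+2).
Local Notation p0 := (@pole R n.+1).
Variables (J : set R) (Rad : \bar R) (f h : R -> R).
Hypothesis hspace : rot_sym_space (n := n.+2) J Rad f h.
Local Notation g := (@rot_metric R n.+2 f h).
Local Notation M := (@ambient R n.+2 J Rad).
Variables (a b : R) (rho : R -> R) (T : \bar R) (X N : R -> V -> V).
Hypothesis ab : a < b.
Hypothesis flow : flow_with_normal g M a b rho T X N.
Hypothesis sym : forall t s u, time_domain T t -> a <= s <= b -> enorm u = 1 ->
  X t (s, u) = ((X t (s, p0)).1, (X t (s, p0)).2 0 0 *: u).
Hypothesis rho0 : forall z, a <= z <= b -> 0 < rho z.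
Hypothesis mono : forall r, radii Rad r -> 0 <= 'D_1 f r /\ 0 <= 'D_1 h r.
Local Notation TD := (time_domain T).
Local Notation strip := (strip a b T).
Local Notation z := (prof_z X).
Local Notation y := (prof_y X).
Local Notation nu := (prof_z N).
Local Notation w := (prof_y N).
Local Notation k := (prof_k X N).
Local Notation Dt F := ('D_((1, 0) : R * R) F).
Local Notation Ds F := ('D_((0, 1) : R * R) F).
Local Notation avg t := (average_mean_curvature g a b (X t) (N t)).
Local Notation q := (@mean_coef R n f h).

Let Jz t s : TD t -> a <= s <= b -> J (z (t, s)).
Proof.
move=> Tt sab; have [_ _ + _] := flow; move=> /(_ t Tt)[+ _ _ _].
by move=> /(_ (s, p0) (conj sab enorm_pole)) [].
Qed.

Let fh_gt0 r : radii Rad r -> 0 < f r /\ 0 < h r.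
Proof. by have [_ _ _ + _] := hspace; move=> + [r0 rR]; apply. Qed.

Let radii_y t s : TD t -> a <= s <= b -> radii Rad (y (t, s)).
Proof. by move=> Tt sab; apply: (prof_radii flow). Qed.

Lemma smooth_near_continuous (D : set (R * R)) (F : R * R -> R) p :
  smooth_near D F -> D p -> {for p, continuous F}.
Proof. by move=> [U [oU DU sU]] /DU; exact: smooth_on_continuous. Qed.

(** Initially [z (0, s) = s], so [k * w = 1] with [k > 0]. *)
Lemma prof_w_init s t : TD t -> a <= s <= b -> 0 < w (0, s).
Proof.
move=> Tt sab; have T0 : TD 0.
  by have [t0 _] := Tt; apply: (time_domain_sub Tt); rewrite lexx.
have S0 : strip (0, s) by [].
have [hz _ _ _] := prof_smooth flow.
have dz := is_derive_partial2 (smooth_near_derivable hz S0).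
have E : Ds z (0, s) = 1.
  apply: (is_derive_segment_eq ab sab dz (is_derive_id s (1 : R))) => x xab.
  by have [] := prof_init flow Tt xab.
have k0 := prof_k_gt0 hspace ab flow sym rho0 S0.
have [Ez _] := prof_tangent hspace ab flow sym rho0 S0.
by rewrite -(pmulr_rgt0 _ k0) -Ez E.
Qed.

Lemma prof_w_gt0 t1 s1 : TD t1 -> a <= s1 <= b -> 0 < w (t1, s1).
Proof.
move=> Tt1 s1ab; have [t10 _] := Tt1; have leab := ltW ab.
have TD' x : 0 <= x <= t1 -> TD x by exact: time_domain_sub.
have [hz hy hn hw] := prof_smooth flow.
have Dstrip p : (`[0, t1] `*` `[a, b])%classic p -> strip p.
  by case: p => t s; rewrite /= !in_itv/= => -[tt sab]; split=> //; exact: TD'.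
have Jy := Jz Tt1 s1ab.
have cf := metric_coef_f_smooth hspace Jy; have ch := metric_coef_h_smooth hspace Jy.
pose Q r := 'D_1 q r - 'D_1 f r / f r * q r.
have oI := @open_radii R Rad.
have f0 r : radii Rad r -> f r != 0 by move=> /fh_gt0[/gt_eqF ->].
have h0 r : radii Rad r -> h r != 0 by move=> /fh_gt0[_ /gt_eqF ->].
have cf' : Ck 1 (radii Rad) ('D_1 f) by have [] := cf 2%N.
have ch' : Ck 1 (radii Rad) ('D_1 h) by have [] := ch 2%N.
have cff := Ck_div oI f0 cf' (cf 1%N); have chh := Ck_div oI h0 ch' (ch 1%N).
have cq : Ck 1 (radii Rad) q by exact: Ck_add oI cff (Ck_mul oI (Ck_cst 1 n.+1%:R oI) chh).
have cQ : Ck 0 (radii Rad) Q.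
  have cq' : Ck 0 (radii Rad) ('D_1 q) by have [] := cq.
  exact: Ck_add oI cq' (Ck_opp oI (Ck_mul oI (Ck_pred cff) (Ck_pred cq))).
have [pM DpM QM] : exists2 p, (`[0, t1] `*` `[a, b])%classic p &
    forall p', (`[0, t1] `*` `[a, b])%classic p' -> `|Q (y p')| <= `|Q (y p)|.
  apply: (@rectangle_max R t1 a b t10 leab (fun p => `|Q (y p)|)) => -[t s] Dp.
  have [Tt sab] := Dstrip _ Dp.
  apply: (@continuous_comp _ _ _ (fun p => Q (y p)) Num.norm); last exact: norm_continuous.
  apply: (@continuous_comp _ _ _ y Q); first exact: (smooth_near_continuous hy).
  exact: cQ _ (radii_y Tt sab).
set K := `|Q (y pM)| in QM.
have [pm Dpm wm] : exists2 p, (`[0, 0] `*` `[a, b])%classic p &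
    forall p', (`[0, 0] `*` `[a, b])%classic p' -> - w p' <= - w p.
  apply: (@rectangle_max R 0 a b (lexx 0) leab (fun p => - w p)) => -[t s] [/= tt sab].
  apply: continuousN; apply: (smooth_near_continuous hw); split=> /=.
    by apply: TD'; move: tt; rewrite in_itv/= => /andP[-> /le_trans->].
  by move: sab; rewrite in_itv.
have wm0 : 0 < w pm.
  case: pm Dpm {wm} => t s []; rewrite /= !in_itv/= -eq_le => /eqP <-.
  exact: prof_w_init Tt1.
(* [w pm] is the minimum of the initial values and 1 is the boundary value; halving puts the level
   strictly below both. *)
pose m := Num.min (w pm) 1 / 2.
have m0 : 0 < Num.min (w pm) 1 by rewrite lt_min wm0 ltr01.
have [mw m1] : Num.min (w pm) 1 <= w pm /\ Num.min (w pm) 1 <= 1.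
  by rewrite !ge_min !lexx orbT.
(* [K] bounds the zeroth-order coefficient of [prof_w_dt], so [E t * w] cannot decrease to
   a new minimum; on the boundary [w = 1]. *)
pose E (t : R) := expR ((K + 1) * t).
have E0 t : 0 < E t by exact: expR_gt0.
have dE (t : R) : is_derive t 1 E (E t * (K + 1)).
  have da := is_derive_mul (is_derive_cst (K + 1) t (1 : R)) (is_derive_id t (1 : R)).
  have := is_derive_comp da (is_derive_expR _).
  by rewrite mul0r add0r mulr1 mulrC.
have K1 : 0 < K + 1 by rewrite ltr_wpDl// normr_ge0.
rewrite ltNge; apply/negP => w1.
have [|||t [s [tt sab psim [after before]]]] :=
  @first_crossing R t1 a b t10 leab (fun p => E p.1 * w p) m.
- move=> p Dp; apply: (@continuousM _ _ (fun p => E p.1) w).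
    apply: (@continuous_comp _ _ _ fst E); first exact: cvg_fst.
    exact: is_derive_continuous (dE p.1).
  exact: (smooth_near_continuous hw (Dstrip _ Dp)).
- move=> s sab; rewrite /E mulr0 expR0 mul1r.
  have : - w (0, s) <= - w pm by apply: wm; split; rewrite /= in_itv/= ?lexx.
  by rewrite lerN2; rewrite /m; lra.
- exists (t1, s1); first by split; rewrite /= in_itv/= ?t10 ?lexx.
  by rewrite /= (@le_trans _ _ 0)// ?pmulr_rle0// /m; lra.
have [t0 tt1] := andP tt.
have Tt : TD t by apply: TD'; rewrite (ltW t0).
have Sp : strip (t, s) by [].
have w0 s' : a <= s' <= b -> 0 < w (t, s').
  move=> s'ab; rewrite -(pmulr_rgt0 _ (E0 t)); apply: lt_le_trans (after s' s'ab).
  by rewrite /m; lra.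
have c0 := average_mean_curvature_ge0 hspace ab flow sym rho0 mono Tt w0.
(* On the boundary [w] has square 1 and is positive, and [E t >= 1]; hence the level is attained in
   the interior, where first and second order conditions hold. *)
have bd s' : s' = a \/ s' = b -> m < E t * w (t, s').
  move=> s'ab; have [nu0 _] := prof_boundary hspace ab flow sym rho0 Tt s'ab.
  have s'i : a <= s' <= b by case: s'ab => ->; rewrite lexx ltW.
  have := prof_unit hspace ab flow sym rho0 (conj Tt s'i : strip (t, s')).
  rewrite nu0 expr0n/= mulr0 addr0 => /eqP; rewrite sqrf_eq1 => /orP[/eqP ->|/eqP wN].
    have : expR 0 <= E t by rewrite ler_expR; exact: mulr_ge0 (ltW K1) (ltW t0).
    by rewrite expR0 mulr1 /m; lra.
  by have := w0 _ s'i; rewrite wN; lra.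
have asb : a < s < b.
  have [sa sb] := andP sab; rewrite !lt_neqAle sa sb !andbT; apply/andP; split; apply/eqP => es.
    by have := bd s (or_introl (esym es)); rewrite psim ltxx.
  by have := bd s (or_intror es); rewrite psim ltxx.
have ds (F : R * R -> R) x : smooth_near strip F -> a < x < b ->
    is_derive x 1 (fun s => F (t, s)) (Ds F (t, x)).
  move=> hF /andP[ax xb]; apply: is_derive_partial2 (smooth_near_derivable hF _).
  by split=> //=; rewrite !ltW.
have [ws wss] : Ds w (t, s) = 0 /\ 0 <= Ds (Ds w) (t, s).
  apply: (second_derivative_min (f := fun s => w (t, s)) (df := fun s => Ds w (t, s)) asb).
  - by move=> x; exact: ds hw.
  - exact: ds (smooth_near_derive (0, 1) hw) asb.
  - move=> x /andP[ax xb]; rewrite -(ler_pM2l (E0 t)) psim; apply: after.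
    by rewrite !ltW.
have := prof_w_dt hspace ab flow sym rho0 mono Tt t0 sab (w0 s sab) c0 ws wss.
have dpsi := is_derive_mul (dE t) (is_derive_partial1 (smooth_near_derivable hw Sp)).
have : E t * (K + 1) * w (t, s) + E t * Dt w (t, s) <= 0.
  apply: (derive_left_min t0 dpsi) => x /andP[x0 xt].
  by rewrite psim ltW// before// x0.
rewrite -mulrA -mulrDr pmulr_rle0// => wt_le.
have Dp : (`[0, t1] `*` `[a, b])%classic (t, s).
  by split; rewrite /= in_itv/= ?sab ?tt1 ?(ltW t0).
have := QM (t, s) Dp; rewrite ler_norml => /andP[Qge _] wt_ge.
(* Here [A = f ^+ 2 * nu ^+ 2] is at most 1, so the estimate gives [ct >= - K' * c], whereas the
   crossing gives [ct <= - (K' + 1) * c]; the extra 1 in the exponent makes this contradictory for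
   [c > 0]. *)
have alg (A c ct Qt K' : R) : 0 <= K' -> 0 <= A -> A * c * Qt <= ct -> (K' + 1) * c + ct <= 0 ->
    - K' <= Qt -> 0 < c -> c ^+ 2 + A = 1 -> False.
  move=> K'0 A0 ge le Qge' c_gt0 A1.
  have A1' : A <= 1 by rewrite -A1 lerDr sqr_ge0.
  have : - K' * (A * c) <= Qt * (A * c) by rewrite ler_wpM2r// mulr_ge0// ltW.
  have : K' * (A * c) <= K' * c by rewrite ler_wpM2l// ler_piMl// ltW.
  by nra.
apply: (alg _ _ _ _ _ (normr_ge0 _) _ wt_ge wt_le Qge (w0 s sab)).
  by rewrite mulr_ge0 ?sqr_ge0.
exact: (prof_unit hspace ab flow sym rho0 Sp).
Qed.

End GraphPreserved.

(** * The generating curve as a graph *)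

Section InverseFunction.
Context {R : realType}.

(** The derivative of the inverse is [1 / F'] composed with the inverse, so each order of regularity
    yields the next. *)
Lemma smooth_inverse (U : set R) (F G : R -> R) (a b : R) : a < b -> open U ->
  (forall s, a <= s <= b -> U s) -> (forall k, Ck k U F) -> (forall k, Ck k U G) ->
  (forall s, a <= s <= b -> 0 < 'D_1 F s) -> F a = a -> F b = b ->
  exists I : R -> R, [/\ smooth_near `[a, b]%classic (G \o I),
    (forall s, a <= s <= b -> a <= F s <= b /\ I (F s) = s) &
    forall x, a <= x <= b -> a <= I x <= b /\ F (I x) = x].
Proof.
move=> ab oU abU cF cG F'0 Fa Fb.
pose W := U `&` ('D_1 F) @^-1` [set x | 0 < x].
have cF' k : Ck k U ('D_1 F) by have [] := cF k.+1.
have oW : open W by apply: open_preimage_on oU (@open_gt R 0) (cF' 0%N).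
have abW s : a <= s <= b -> W s by move=> sab; split; [exact: abU|exact: F'0].
have WU : W `<=` U by move=> s [].
(* Room on both sides of [[a, b]] makes it lie inside an open interval of values on which the
   inverse is differentiable. *)
have [d d0 hd] : exists2 d : R, 0 < d & forall s, a - d <= s <= b + d -> W s.
  have Wa : W a by apply: abW; rewrite lexx ltW.
  have Wb : W b by apply: abW; rewrite lexx ltW.
  have /nbhs_normP[da /= da0 ha] := open_nbhs_nbhs (conj oW Wa).
  have /nbhs_normP[db /= db0 hb] := open_nbhs_nbhs (conj oW Wb).
  have m0 : 0 < Num.min da db by rewrite lt_min da0.
  have [ma mb] : Num.min da db <= da /\ Num.min da db <= db by rewrite !ge_min !lexx orbT.
  exists (Num.min da db / 2) => [|s /andP[s1 s2]]; first by rewrite divr_gt0.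
  have [sa|sa] := ltP s a.
    by apply: ha; rewrite /ball_/= gtr0_norm ?subr_gt0//; lra.
  have [sb|sb] := ltP b s.
    by apply: hb; rewrite /ball_/= ltr0_norm ?subr_lt0//; lra.
  by apply: abW; rewrite sa.
pose c := a - d; pose e := b + d.
have dF s : c <= s <= e -> is_derive s 1 F ('D_1 F s).
  by move=> /hd/WU Us; exact: Ck_is_derive (cF 1%N) Us.
have Fcont s1 s2 : c <= s1 -> s2 <= e -> {within `[s1, s2], continuous F}.
  move=> cs1 s2e; apply: (@is_derive_segment_continuous _ F ('D_1 F)) => x /andP[x1 x2].
  by apply: dF; rewrite (le_trans cs1)// (le_trans x2).
have Finc s1 s2 : c <= s1 -> s1 < s2 -> s2 <= e -> F s1 < F s2.
  move=> cs1 s12 s2e.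
  have [||x xs E] := MVT s12 (df := 'D_1 F) (f := F).
  - move=> x; rewrite in_itv/= => /andP[x1 x2].
    by apply: dF; rewrite (le_trans cs1 (ltW x1)) (le_trans (ltW x2)).
  - exact: Fcont.
  - rewrite -subr_gt0 E mulr_gt0 ?subr_gt0//.
    move: xs; rewrite in_itv/= => /andP[x1 x2].
    have [] // : W x by apply: hd; rewrite (le_trans cs1 (ltW x1)) (le_trans (ltW x2)).
have Finj s1 s2 : c <= s1 <= e -> c <= s2 <= e -> F s1 = F s2 -> s1 = s2.
  move=> /andP[a1 b1] /andP[a2 b2] E; case: (ltgtP s1 s2) => // s12.
    by have := Finc _ _ a1 s12 b2; rewrite E ltxx.
  by have := Finc _ _ a2 s12 b1; rewrite E ltxx.
(* The default [a] is taken only off the image of [[c, e]]. *)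
pose I x := xget a [set s | c <= s <= e /\ F s = x].
have IF s : c <= s <= e -> I (F s) = s.
  move=> sce; rewrite /I; case: xgetP => [s' _ [s'ce E]|/(_ s)]; first exact: Finj.
  by move=> H; case: H.
have ce : c <= e by rewrite /c /e; lra.
have surj x : F c <= x <= F e -> c <= I x <= e /\ F (I x) = x.
  move=> /andP[x1 x2]; have [|s] := IVT ce (Fcont _ _ (lexx c) (lexx e)) (v := x).
    by rewrite ge_min x1 le_max x2 orbT.
  by rewrite in_itv/= => sce <-; rewrite IF.
pose Y : set R := [set x | F c < x < F e].
have oY : open Y.
  have -> : Y = [set x | F c < x] `&` [set x | x < F e].
    by rewrite eqEsubset; split=> x /=; [move=> /andP|move=> [x1 x2]; apply/andP].
  by apply: openI; [exact: open_gt|exact: open_lt].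
have dI x : Y x -> is_derive x 1 I ('D_1 F (I x))^-1.
  move=> /andP[x1 x2]; have [|Ice FI] := surj x; first by rewrite !ltW.
  have Ioo : c < I x < e.
    have [cI Ie] := andP Ice; rewrite !lt_neqAle cI Ie !andbT; apply/andP; split; apply/eqP => E.
      by move: x1; rewrite E FI ltxx.
    by move: x2; rewrite -E FI ltxx.
  have nr (P : R -> Prop) : (forall s, c < s < e -> P s) -> \forall s \near I x, P s.
    move=> HP; have [cI Ie] := andP Ioo; near=> s; apply: HP; apply/andP; split.
      by near: s; exact: lt_nbhsr.
    by near: s; exact: lt_nbhsl.
  rewrite -{1}FI; apply: is_derive_inverse.
  - by apply: nr => s /andP[s1 s2]; apply: IF; rewrite !ltW.
  - apply: nr => s /andP[s1 s2]; apply: is_derive_continuous (dF s _); first by rewrite !ltW.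
  - exact: dF.
  - by have [_ /=] := hd _ Ice; move=> /gt_eqF ->.
have YU x : Y x -> U (I x).
  by move=> /andP[x1 x2]; apply/WU/hd; have [|//] := surj x; rewrite !ltW.
have cI k : Ck k Y I.
  elim: k => [|k IH]; first by move=> x Yx; exact: is_derive_continuous (dI x Yx).
  apply: (Ck_derive oY dI); apply: Ck_inv oY _ (Ck_comp oY YU IH (cF' k)).
  move=> x /andP[x1 x2]; have [|+ _] := surj x; first by rewrite !ltW.
  by move=> /hd[_ /=] /gt_eqF ->.
have ca : c < a by rewrite /c ltrBlDr ltrDl.
have be : b < e by rewrite /e ltrDl.
have Fca : F c < a by rewrite -[ltRHS]Fa; apply: Finc; rewrite ?lexx ?ltW// (lt_trans ab).
have Fbe : b < F e by rewrite -[ltLHS]Fb; apply: Finc; rewrite ?lexx ?ltW// (lt_trans ca).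
have abc s : a <= s <= b -> c <= s <= e.
  by move=> /andP[s1 s2]; rewrite (le_trans (ltW ca)) ?(le_trans s2 (ltW be)).
have Finc' s1 s2 : c <= s1 <= e -> c <= s2 <= e -> F s1 <= F s2 -> s1 <= s2.
  move=> /andP[a1 b1] /andP[a2 b2] F12; rewrite leNgt; apply/negP => s21.
  by have := Finc _ _ a2 s21 b1; rewrite ltNge F12.
have Fle s1 s2 : c <= s1 -> s1 <= s2 -> s2 <= e -> F s1 <= F s2.
  move=> cs1; rewrite le_eqVlt => /predU1P[->//|s12 s2e]; exact/ltW/Finc.
have aab : a <= a <= b by rewrite lexx ltW.
have bab : a <= b <= b by rewrite lexx ltW.
exists I; split.
- exists Y; split=> //.
    by move=> x; rewrite /= in_itv/= => /andP[ax xb]; rewrite /Y/= (lt_le_trans Fca)// (le_lt_trans xb).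
  by apply/smooth_onP => // k; exact: Ck_comp oY YU (cI k) (cG k).
- move=> s sab; split; last by rewrite IF// abc.
  have [as_ sb] := andP sab; have [cs se] := andP (abc s sab).
  have h1 := Fle _ _ (ltW ca) as_ se; have h2 := Fle _ _ cs sb (ltW be).
  by rewrite Fa in h1; rewrite Fb in h2; rewrite h1 h2.
- move=> x /andP[ax xb].
  have [|Ice FI] := surj x; first by rewrite (le_trans (ltW Fca))// (le_trans xb (ltW Fbe)).
  split=> //; apply/andP; split; apply: Finc' => //; rewrite ?abc// FI ?Fa ?Fb//.
Unshelve. all: by end_near. Qed.

End InverseFunction.

Theorem theorem5 (R : realType) (n : nat) (hn : (2 <= n)%N)
  (J : set R) (Rad : \bar R) (f h : R -> R)
  (hspace : rot_sym_space (n := n) J Rad f h)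
  (a b : R) (rho : R -> R)
  (hRSS2 : setting_RSS2 n J Rad f h a b rho)
  (T : \bar R) (X : R -> cspace R n -> cspace R n)
  (hX : maximal_vpmcf_solution (rot_metric f h) (ambient J Rad) a b rho T X) :
  forall t : R, time_domain T t -> is_graph_over_axis a b (X t).
Proof.
(* Dimension [n.+2] provides a direction tangent to the spheres, needed to read [h] off the metric
   and to exclude [y = 0]. *)
move=> t Tt; case: n hn hspace hRSS2 X hX => [|[|n]] // _ hspace [hRSS curv] X hX.
have [ab _ rho0 _ _] := hRSS; have [[_ [N flow]] _] := hX.
have sym t' s u (Tt' : time_domain T t') (sab : a <= s <= b) (u1 : enorm u = 1) :=
  maximal_profile hspace ab hX Tt' sab u1.
have aab : a <= a <= b by rewrite lexx ltW.
have bab : a <= b <= b by rewrite lexx ltW.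
have J0 : J (prof_z X (t, a)).
  have [_ _ /(_ t Tt)[+ _ _ _] _] := flow.
  by move=> /(_ (a, pole) (conj aab enorm_pole)) [].
have mono := metric_coef_monotone hspace J0 curv.
have [hz hy _ _] := prof_smooth flow.
have [U1 [oU1 abU1 cz]] := slice_Ck hz Tt.
have [U2 [oU2 abU2 cy]] := slice_Ck hy Tt.
have z' s : a <= s <= b -> 0 < 'D_1 (fun s => prof_z X (t, s)) s.
  move=> sab; rewrite (slice_D1 hz Tt sab).
  have Sp : strip a b T (t, s) by [].
  have [-> _] := prof_tangent hspace ab flow sym rho0 Sp.
  apply: mulr_gt0; first exact: (prof_k_gt0 hspace ab flow sym rho0 Sp).
  exact: (prof_w_gt0 hspace ab flow sym rho0 mono Tt sab).
have zab : prof_z X (t, a) < prof_z X (t, b).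
  have dz s : a <= s <= b ->
      is_derive s 1 (fun s => prof_z X (t, s)) ('D_1 (fun s => prof_z X (t, s)) s).
    by move=> /abU1; exact: Ck_is_derive (cz 1%N).
  have cont := is_derive_segment_continuous dz.
  have dzo s : s \in `]a, b[ -> is_derive s 1 (fun s => prof_z X (t, s))
      ('D_1 (fun s => prof_z X (t, s)) s).
    by rewrite in_itv/= => /andP[sa sb]; apply: dz; rewrite !ltW.
  have [s sab E] := MVT ab dzo cont.
  rewrite -subr_gt0 E mulr_gt0 ?subr_gt0//; apply: z'.
  by move: sab; rewrite in_itv/= => /andP[sa sb]; rewrite !ltW.
have [_ za] := prof_boundary hspace ab flow sym rho0 Tt (or_introl erefl : a = a \/ a = b).
have [_ zb] := prof_boundary hspace ab flow sym rho0 Tt (or_intror erefl : b = a \/ b = b).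
(* Both ends are sent into the set of the two levels [a] and [b], and [z] is strictly increasing, so
   each end keeps its level. *)
have [Ea Eb] : prof_z X (t, a) = a /\ prof_z X (t, b) = b.
  move: zab; case: za => ->; case: zb => -> //; rewrite ?ltxx//.
  by move=> /(lt_trans ab); rewrite ltxx.
have abU s : a <= s <= b -> (U1 `&` U2) s by move=> sab; split; [exact: abU1|exact: abU2].
have [I [smI zI Iz]] := smooth_inverse ab (openI oU1 oU2) abU
  (fun k => Ck_sub (@subIsetl _ U1 U2) (cz k)) (fun k => Ck_sub (@subIsetr _ U1 U2) (cy k)) z' Ea Eb.
(* The same points are swept out after reparametrizing the curve by its height [z]. *)
exists ((fun s => prof_y X (t, s)) \o I); split=> //.
  by move=> x /Iz[Ixab _]; exact: (prof_y_gt0 flow sym rho0 Tt Ixab).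
rewrite eqEsubset; split=> _ [[s u] [/= sab u1] <-].
  have [zs Is] := zI s sab; exists (prof_z X (t, s), u); first by split.
  by rewrite (prof_X sym Tt sab u1) /revolution /= Is.
have [Is zs] := Iz s sab; exists (I s, u); first by split.
by rewrite (prof_X sym Tt Is u1) /revolution /= zs.
Qed.
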